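(* Let $d\in\mathbb{N}$, $a>0$ and $\mathrm{bc}\in\{\emptyset,\mathrm{per},\mathrm{Dir}\}$. For all $\beta>0$, $\mu\in\mathbb{R}$ and $\alpha\le0$, $$\Delta^{\mathrm{PMF}}(\beta,\mu,\alpha)=\Big(\frac{d p^{\mathrm{PMF}}}{d\mu}(\beta,\mu,\alpha)-\varrho_c(\beta)\Big)_+=\Big(\frac{\mu+\alpha}a-\varrho_c(\beta)\Big)_+=\Big(\frac{\partial}{\partial\mu}\big(H^{\mathrm{PMF}}_{\mu+\alpha}-H^{\mathrm{PMF}}_{\mu+\alpha,l.s.c.}\big)\Big)(\xi^{\mathrm{PMF}}),$$ where $\xi^{\mathrm{PMF}}$ is the unique minimiser (zero) of the rate function $I^{\mathrm{PMF}}_{\mu,\alpha}$ (and in the last expression the derivative in $\mu$ is taken with the sequence held fixed, then evaluated at $\xi^{\mathrm{PMF}}$).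
   Context: $\Lambda_N=[-N,N]^d$, $|\Lambda_N|=(2N)^d$. For $\alpha\le0$ put $q_k^{(\alpha)}=\frac{e^{\beta\alpha k}}{(4\pi\beta)^{d/2}k^{1+d/2}}$, $\bar q^{(\alpha)}=\sum_kq_k^{(\alpha)}$. Let $g_t(x,y)=(4\pi t)^{-d/2}e^{-|x-y|^2/(4t)}$; $g_t^{(\mathrm{per})}(x,y)=\sum_{z\in\mathbb{Z}^d}g_t(x,y+2Nz)$; $g_t^{(\mathrm{Dir})}(x,y)$ the transition density of Brownian motion with generator $\Delta$ killed on leaving $\Lambda_N$. For $\mathrm{bc}=\emptyset$, $q_k^{(\mathrm{bc},\alpha)}=q_k^{(\alpha)}$ for all $k$; for $\mathrm{bc}\in\{\mathrm{per},\mathrm{Dir}\}$, $q_k^{(\mathrm{bc},\alpha)}=\frac{e^{\beta\alpha k}}{k|\Lambda_N|}\int_{\Lambda_N}g^{(\mathrm{bc})}_{k\beta}(x,x)\,dx$ for $k\le N$ and $0$ for $k>N$. Let $(\mathcal{N}_k)_k$ be independent Poisson variables with means $|\Lambda_N|q_k^{(\mathrm{bc},\alpha)}$ and $\nu^{(\mathrm{bc})}_{N,\alpha}$ the law of $(\mathcal{N}_k/|\Lambda_N|)_k$ on $\ell_1(\mathbb{R}_+)$. For $x\in\ell_1(\mathbb{R}_+)$: $D(x)=\sum_{k\ge1}kx_k$, $D_K(x)=\sum_{k=1}^Kkx_k$, $H^{\mathrm{PMF}}_\mu(x)=-\mu D(x)+\frac a2D(x)^2$ ($+\infty$ if $D(x)=\infty$),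 $H^{\mathrm{PMF}}_{\mu,l.s.c.}(x)=H^{\mathrm{PMF}}_\mu(x)-\frac1{2a}(\mu-aD(x))_+^2$. Particle-mean-field (PMF) measure: $\nu^{\mathrm{PMF}}_{N,\mu,\alpha}(dx)=\frac1{Z_N}e^{-|\Lambda_N|\beta H^{\mathrm{PMF}}_\mu(x)}\nu^{(\mathrm{bc})}_{N,\alpha}(dx)$, $Z_N$ the normalising constant. Condensate density: $\Delta^{\mathrm{PMF}}(\beta,\mu,\alpha)=\lim_{K\to\infty}\lim_{N\to\infty}\mathbb{E}_{\nu^{\mathrm{PMF}}_{N,\mu,\alpha}}[D-D_K]$. $I(x)=\sum_kx_k(\log\frac{x_k}{q_k^{(0)}}-1)+\bar q^{(0)}$ on $\ell_1(\mathbb{R}_+)$, $+\infty$ elsewhere. $I^{\mathrm{PMF}}_{\mu,\alpha}=\beta H^{\mathrm{PMF}}_{\mu+\alpha,l.s.c.}+I-\inf_{y\in\ell_1(\mathbb{R})}\{\beta H^{\mathrm{PMF}}_{\mu+\alpha,l.s.c.}(y)+I(y)\}$. The limiting pressure is $p^{\mathrm{PMF}}(\beta,\mu,\alpha)=\frac1\beta\bar q^{(0)}-\frac1\beta\inf_{x\in\ell_1(\mathbb{R})}\{I(x)+\beta H^{\mathrm{PMF}}_{\mu+\alpha,l.s.c.}(x)\}$. $\varrho_c(\beta)=(4\pi\beta)^{-d/2}\zeta(d/2)$ for $d\ge3$, $\varrho_c(\beta)=+\infty$ for $d=1,2$ (in which case $(\cdot-\varrho_c)_+=0$). $(t)_+=\max(t,0)$.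 *)

(* Defs.v *)
From HB Require Import structures.
From mathcomp Require Import all_boot all_order all_algebra.
From mathcomp Require Import all_classical all_reals all_analysis.
From mathcomp Require Import measurable_realfun.

Set Implicit Arguments.
Unset Strict Implicit.
Unset Printing Implicit Defensive.

Import Order.TTheory GRing.Theory Num.Theory.
Import numFieldNormedType.Exports.

Local Open Scope classical_set_scope.
Local Open Scope ring_scope.

(* Points of R^d are row vectors. The library norm on 'rV is the sup norm, so
   the Euclidean norm is written out. *)
Definition sqnorm (R : realType) (d : nat) (x : 'rV[R]_d) : R :=
  \sum_(i < d) x 0 i ^+ 2.

Definition borel (R : realType) (d : nat) : set (set 'rV[R]_d) :=
  <<s [set A : set 'rV[R]_d | open A] >>.

(* Lebesgue integral over R^d of a nonnegative Borel function, as an iterated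
   integral (Tonelli). *)
Fixpoint int_rV (R : realType) (d : nat) : ('rV[R]_d -> \bar R) -> \bar R :=
  match d return ('rV[R]_d -> \bar R) -> \bar R with
  | 0%N => fun f => f 0
  | d'.+1 => fun f =>
      (\int[lebesgue_measure]_t
         int_rV (fun v : 'rV[R]_d' =>
                   f (row_mx (t%:M : 'rV[R]_1) v : 'rV[R]_(1 + d'))))%E
  end.

Definition int_on (R : realType) (d : nat) (A : set 'rV[R]_d)
    (f : 'rV[R]_d -> R) : \bar R :=
  int_rV (fun x => (\1_A x * f x)%:E).

Definition box (R : realType) (d N : nat) : set 'rV[R]_d :=
  [set x | forall i, - N%:R <= x 0 i <= N%:R].

Definition vol (R : realType) (d N : nat) : R := (2 * N%:R) ^+ d.

Definition heat (R : realType) (d : nat) (t : R) (x y : 'rV[R]_d) : R :=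
  (4 * pi * t) `^ (- (d%:R / 2)) * expR (- (sqnorm (x - y) / (4 * t))).

Definition heat_per (R : realType) (d N : nat) (t : R) (x y : 'rV[R]_d) : R :=
  fine (\esum_(z in [set: 'rV[int]_d])
     (heat t x (y + (2 * N%:R) *: map_mx (fun m : int => m%:~R) z))%:E).

Definition mutually_independent (I : choiceType) (d d' : measure_display)
    (W : measurableType d) (T : measurableType d') (R : realType)
    (P : probability W R) (X : I -> W -> T) : Prop :=
  forall (s : seq I) (A : I -> set T), uniq s ->
    (forall i, measurable (A i)) ->
    P (\bigcap_(i in [set` s]) (X i @^-1` A i)) =
    (\big[*%E/1]_(i <- s) P (X i @^-1` A i))%E.

(* Brownian motion started at 0 with generator Delta (not Delta / 2): the
   increment over [s, t] has covariance 2 (t - s) times the identity. Only the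
   times t >= 0 matter. The independence clause covers both disjoint time
   intervals and distinct coordinates. The second argument of normal_prob is
   the standard deviation. *)
Definition brownian (R : realType) (d : nat) (disp : measure_display)
    (W : measurableType disp) (P : probability W R)
    (B : R -> W -> 'rV[R]_d) : Prop :=
  [/\ forall t i, 0 <= t -> measurable_fun [set: W] (fun w => B t w 0 i),
      forall w, B 0 w = 0,
      forall w, {within `[0, +oo[, continuous (fun t : R => B t w)},
      forall (s t : R) (i : 'I_d) (A : set R), 0 <= s < t -> measurable A ->
        P [set w | A ((B t w - B s w) 0 i)] =
        normal_prob 0 (Num.sqrt (2 * (t - s))) A
    & forall t : nat -> R, 0 <= t 0%N -> (forall j, t j <= t j.+1) ->
        mutually_independent P
          (fun (ij : 'I_d * nat) w =>
             (B (t ij.2.+1) w - B (t ij.2) w) 0 ij.1)].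

(* g t x y is the transition density of this Brownian motion killed on leaving
   the box. A density is only determined up to null sets while the diagonal
   values g t x x are needed below, so the continuous version is selected. *)
Definition killed_density (R : realType) (d N : nat)
    (g : R -> 'rV[R]_d -> 'rV[R]_d -> R) : Prop :=
  exists (disp : measure_display) (W : measurableType disp)
         (P : probability W R) (B : R -> W -> 'rV[R]_d),
  [/\ brownian P B,
      forall t x y, 0 < t -> box N x -> box N y -> 0 <= g t x y,
      forall t, 0 < t ->
        {within [set p | box N p.1 /\ box N p.2],
           continuous (fun p : 'rV[R]_d * 'rV[R]_d => g t p.1 p.2)}
    & forall t x A, 0 < t -> box N x -> borel A ->
        P [set w | (forall s, 0 <= s <= t -> box N (x + B s w)) /\
                   A (x + B t w)] =
        int_on (A `&` box N) (g t x)].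

Inductive boundary := Free | Per | Dir.

(* Cycle lengths k >= 1 are stored with an offset: index j stands for k = j+1,
   both in the weights and in the sequences below. *)
Definition qfree (R : realType) (d : nat) (beta alpha : R) (j : nat) : R :=
  expR (beta * alpha * j.+1%:R) /
  ((4 * pi * beta) `^ (d%:R / 2) * j.+1%:R `^ (1 + d%:R / 2)).

Definition qbar (R : realType) (d : nat) (beta alpha : R) : \bar R :=
  (\sum_(j <oo) (qfree d beta alpha j)%:E)%E.

Definition qkernel (R : realType) (d N : nat) (beta alpha : R)
    (g : R -> 'rV[R]_d -> 'rV[R]_d -> R) (j : nat) : R :=
  if (j.+1 <= N)%N then
    expR (beta * alpha * j.+1%:R) / (j.+1%:R * vol R d N) *
    fine (int_on (@box R d N) (fun x => g (j.+1%:R * beta) x x))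
  else 0.

(* gDir N is the Dirichlet kernel on the box; it is used for Dir only. *)
Definition qbc (R : realType) (d : nat) (bc : boundary)
    (gDir : nat -> R -> 'rV[R]_d -> 'rV[R]_d -> R) (beta alpha : R)
    (N j : nat) : R :=
  match bc with
  | Free => qfree d beta alpha j
  | Per => qkernel N beta alpha (@heat_per R d N) j
  | Dir => qkernel N beta alpha (gDir N) j
  end.

(* Real sequences with the sigma-algebra generated by the coordinates; its
   trace on l1 is the Borel sigma-algebra of l1. *)
Definition coord_sets (R : realType) : set (set (nat -> R)) :=
  [set A | exists j (B : set R), measurable B /\ A = [set x | B (x j)]].

Definition seqs (R : realType) := g_sigma_algebraType (@coord_sets R).

Definition ell1 (R : realType) : set (nat -> R) :=
  [set x | (\sum_(j <oo) `|x j|%:E < +oo)%E].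

Definition ell1_pos (R : realType) : set (nat -> R) :=
  [set x | ell1 x /\ forall j, 0 <= x j].

(* nu is the law of (Nk j / V)_j for independent Poisson variables Nk j with
   means rate j. The 0 passed to poisson_prob is a dummy argument of the
   library definition. *)
Definition poisson_law (R : realType) (rate : nat -> R) (V : R)
    (nu : probability (seqs R) R) : Prop :=
  exists (disp : measure_display) (W : measurableType disp)
         (P : probability W R) (Nk : nat -> {mfun W >-> nat}),
  [/\ mutually_independent P (fun j w => Nk j w),
      forall j (U : set nat), distribution P (Nk j) U = poisson_prob (rate j) 0 U
    & forall A : set (seqs R), measurable A ->
        nu A = P [set w | A (fun j => (Nk j w)%:R / V)]].

Definition Dtot (R : realType) (x : nat -> R) : \bar R :=
  (\sum_(j <oo) (j.+1%:R * x j)%:E)%E.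

Definition Dcut (R : realType) (K : nat) (x : nat -> R) : R :=
  \sum_(j < K) j.+1%:R * x j.

(* The energies are only meaningful on the nonnegative cone of l1; they are set
   to +oo elsewhere, so that infima over l1 ignore sequences with a negative
   entry. *)
Definition Hpmf (R : realType) (a mu : R) (x : nat -> R) : \bar R :=
  (if (x \in @ell1_pos R) && (Dtot x < +oo)
   then - mu%:E * Dtot x + (a / 2)%:E * Dtot x ^+ 2
   else +oo)%E.

Definition Hlsc (R : realType) (a mu : R) (x : nat -> R) : \bar R :=
  (if x \in @ell1_pos R
   then Hpmf a mu x
        - (2 * a)^-1%:E * (maxe 0 (mu%:E - a%:E * Dtot x)) ^+ 2
   else +oo)%E.

(* 0 * ln 0 = 0 by the library convention ln 0 = 0. *)
Definition Irate (R : realType) (d : nat) (beta : R) (x : nat -> R) : \bar R :=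
  (if x \in @ell1_pos R
   then \sum_(j <oo) (x j * (ln (x j / qfree d beta 0 j) - 1))%:E + qbar d beta 0
   else +oo)%E.

Definition Fpmf (R : realType) (d : nat) (a beta mu : R) (x : nat -> R)
    : \bar R :=
  (beta%:E * Hlsc a mu x + Irate d beta x)%E.

Definition inf_Fpmf (R : realType) (d : nat) (a beta mu : R) : \bar R :=
  ereal_inf [set Fpmf d a beta mu y | y in @ell1 R].

Definition Ipmf (R : realType) (d : nat) (a beta mu alpha : R) (x : nat -> R)
    : \bar R :=
  (Fpmf d a beta (mu + alpha) x - inf_Fpmf d a beta (mu + alpha))%E.

Definition pressure (R : realType) (d : nat) (a beta mu alpha : R) : \bar R :=
  (beta^-1%:E * qbar d beta 0 - beta^-1%:E * inf_Fpmf d a beta (mu + alpha))%E.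

Definition is_minimiser (R : realType) (F : (nat -> R) -> \bar R)
    (x : nat -> R) : Prop :=
  ell1 x /\ forall y, ell1 y -> (F x <= F y)%E.

Definition zeta (R : realType) (s : R) : \bar R :=
  (\sum_(j <oo) (j.+1%:R `^ (- s))%:E)%E.

Definition rho_c (R : realType) (d : nat) (beta : R) : \bar R :=
  (if (3 <= d)%N then ((4 * pi * beta) `^ (- (d%:R / 2)))%:E * zeta (d%:R / 2)
   else +oo)%E.

Definition pos_part (R : realType) (x : \bar R) : \bar R := maxe x 0%E.

Definition density (d : measure_display) (T : measurableType d) (R : realType)
    (m : {measure set T -> \bar R}) (w : T -> \bar R)
    (mw : measurable_fun [set: T] w) (w0 : forall x, (0 <= w x)%E)
    : set T -> \bar R :=
  fun A => (\int[m]_(x in A) w x)%E.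

Lemma density0 (d : measure_display) (T : measurableType d) (R : realType)
    (m : {measure set T -> \bar R}) (w : T -> \bar R)
    (mw : measurable_fun [set: T] w) (w0 : forall x, (0 <= w x)%E) :
  density m mw w0 set0 = 0%E.
Proof. exact: integral_set0. Qed.

Lemma density_ge0 (d : measure_display) (T : measurableType d) (R : realType)
    (m : {measure set T -> \bar R}) (w : T -> \bar R)
    (mw : measurable_fun [set: T] w) (w0 : forall x, (0 <= w x)%E) A :
  (0 <= density m mw w0 A)%E.
Proof. by apply: integral_ge0 => x _; exact: w0. Qed.

Lemma density_sigma_additive (d : measure_display) (T : measurableType d)
    (R : realType) (m : {measure set T -> \bar R}) (w : T -> \bar R)
    (mw : measurable_fun [set: T] w) (w0 : forall x, (0 <= w x)%E) :
  semi_sigma_additive (density m mw w0).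
Proof.
move=> F mF tF mUF; rewrite /density ge0_integral_bigcup//.
- by apply: is_cvg_ereal_nneg_natsum_cond => n _ _; exact: density_ge0 mw w0 _.
- exact: (measurable_funS measurableT (@subsetT _ _) mw).
Qed.

HB.instance Definition _ (d : measure_display) (T : measurableType d)
    (R : realType) (m : {measure set T -> \bar R}) (w : T -> \bar R)
    (mw : measurable_fun [set: T] w) (w0 : forall x, (0 <= w x)%E) :=
  isMeasure.Build _ _ _ (density m mw w0)
    (density0 m mw w0) (density_ge0 m mw w0)
    (@density_sigma_additive _ _ _ m _ mw w0).

Lemma measurable_coord (R : realType) (j : nat) :
  measurable_fun [set: seqs R] (fun x : seqs R => (x : nat -> R) j).
Proof.
move=> _ B mB; rewrite setTI; apply: sub_sigma_algebra.
by exists j, B.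
Qed.

Lemma measurable_pos_sum (R : realType) (c : nat -> R) :
  (forall j, 0 <= c j) ->
  measurable_fun [set: seqs R]
    (fun x : seqs R => \sum_(j <oo) (c j * `|(x : nat -> R) j|)%:E)%E.
Proof.
move=> c0.
apply: (@ge0_emeasurable_sum _ _ _ _
  (fun j (x : seqs R) => (c j * `|(x : nat -> R) j|)%:E) xpredT) => //.
  by move=> j x _ _; rewrite lee_fin mulr_ge0.
move=> j _; apply/measurable_EFinP; apply: measurable_funM => //.
by apply: measurableT_comp => //; exact: measurable_coord.
Qed.

Lemma measurable_ell1_pos (R : realType) :
  measurable (@ell1_pos R : set (seqs R)).
Proof.
have -> : (@ell1_pos R : set (seqs R)) =
    [set x | (\sum_(j <oo) (1 * `|x j|)%:E < +oo)%E] `&`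
    \bigcap_j [set x : seqs R | 0 <= (x : nat -> R) j].
  apply/seteqP; split => [x [lx x0]|x [lx x0]]; split.
  - by rewrite /mkset; under eq_eseriesr do rewrite mul1r; exact: lx.
  - by move=> j _; exact: x0.
  - by move: lx; rewrite /mkset; under eq_eseriesr do rewrite mul1r; exact.
  - by move=> j; exact: x0.
apply: measurableI.
  rewrite -[X in measurable X]setTI; apply: emeasurable_fun_infty_o => //.
  by apply: measurable_pos_sum => j; exact: ler01.
apply: bigcap_measurable => // j _.
have -> : [set x : seqs R | 0 <= (x : nat -> R) j] =
    setT `&` (fun x : seqs R => (x : nat -> R) j) @^-1` `[0, +oo[.
  by rewrite setTI; apply/seteqP; split => x /=; rewrite in_itv/= andbT.
exact: measurable_coord.
Qed.

Definition boltzmann (R : realType) (d : nat) (a beta mu : R) (N : nat)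
    (x : seqs R) : \bar R :=
  expeR (- ((vol R d N * beta)%:E * Hpmf a mu x))%E.
Arguments boltzmann {R} d a beta mu N x.

Lemma measurable_boltzmann (R : realType) (d : nat) (a beta mu : R) (N : nat) :
  measurable_fun [set: seqs R] (boltzmann d a beta mu N).
Proof.
pose E (x : seqs R) := (\sum_(j <oo) (j.+1%:R * `|(x : nat -> R) j|)%:E)%E.
have mE : measurable_fun [set: seqs R] E by exact: measurable_pos_sum.
have E0 x : (0 <= E x)%E.
  by apply: nneseries_ge0 => j _ _; rewrite lee_fin mulr_ge0.
have DE x : (x : nat -> R) \in @ell1_pos R -> Dtot x = E x.
  move=> /set_mem[_ x0]; apply: eq_eseriesr => j _.
  by rewrite ger0_norm.
pose e x := fine (E x).
have me : measurable_fun [set: seqs R] e by exact: measurableT_comp.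
have -> : boltzmann d a beta mu N = (fun x : seqs R =>
   if (x \in (@ell1_pos R : set (seqs R))) && (E x < +oo)%E
   then (expR (- (vol R d N * beta * (- mu * e x + (a / 2) * e x ^+ 2))))%:E
   else expeR (- ((vol R d N * beta)%:E * +oo))%E).
  apply/funext => x; rewrite /boltzmann /Hpmf.
  case: (boolP (x \in _)) => // xl; rewrite /= DE//.
  case: ifPn => // Ey.
  have Ef : E x \is a fin_num by rewrite ge0_fin_numE.
  by rewrite -(fineK Ef) /= .
apply: measurable_fun_ifT.
- apply: measurable_and.
    apply: (measurable_fun_bool true); rewrite setTI.
    have -> : (fun x : seqs R => x \in (@ell1_pos R : set (seqs R))) @^-1`
        [set true] = @ell1_pos R.
      by apply/seteqP; split => x /= => [/set_mem//|/mem_set->].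
    exact: measurable_ell1_pos.
  exact: measurable_fun_lte.
- apply/measurable_EFinP; apply: measurableT_comp => //.
  apply: measurableT_comp => //; apply: measurable_funM => //.
  apply: measurable_funD; first exact: measurable_funM.
  by apply: measurable_funM => //; exact: measurable_funX.
- exact: measurable_cst.
Qed.

Lemma boltzmann_ge0 (R : realType) (d : nat) (a beta mu : R) (N : nat) x :
  (0 <= boltzmann d a beta mu N x)%E.
Proof. exact: expeR_ge0. Qed.

(* The Boltzmann weight uses mu and nu carries alpha. The second argument of
   mnormalize is a fallback used only when the total mass is 0 or +oo. *)
Definition nu_pmf (R : realType) (d : nat) (a beta mu : R) (N : nat)
    (nu : probability (seqs R) R) : probability (seqs R) R :=
  mnormalize (density nu (measurable_boltzmann d a beta mu N)
                         (boltzmann_ge0 d a beta mu N)) nu.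

Definition mean_excess (R : realType) (d : nat) (a beta mu : R)
    (nu : nat -> probability (seqs R) R) (K N : nat) : \bar R :=
  (\int[nu_pmf d a beta mu N (nu N)]_(x in @ell1_pos R)
     (Dtot x - (Dcut K x)%:E))%E.

Definition condensate_density (R : realType) (d : nat) (a beta mu : R)
    (nu : nat -> probability (seqs R) R) : \bar R :=
  limn (fun K => limn (mean_excess d a beta mu nu K)).

Definition condensate_density_exists (R : realType) (d : nat) (a beta mu : R)
    (nu : nat -> probability (seqs R) R) : Prop :=
  (forall K, cvgn (mean_excess d a beta mu nu K)) /\
  cvgn (fun K => limn (mean_excess d a beta mu nu K)).

Definition Hgap (R : realType) (a alpha : R) (x : nat -> R) (mu : R) : \bar R :=
  (Hpmf a (mu + alpha) x - Hlsc a (mu + alpha) x)%E.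

(* Main.v *)
(* Write [m = mu + alpha] and [q^lam_j = q_j exp (- beta lam (j+1))]. For every
   [c] with [lam = a c - m >= 0] the function [Fpmf] equals, up to a constant
   and a nonnegative remainder, the relative entropy with respect to [q^lam].
   There is exactly one [q^lam] whose density [s = D (q^lam)] satisfies
   [s <= c] and [lam (c - s) = 0]; it is the minimiser, and [c] is the derivative of the
   pressure, so that all expressions of the theorem equal [c - s].

   For the condensate density, Laplace transforms of [D - D_K] under the PMF
   measure are bounded above by replacing the quadratic energy by its tangent
   at [c], which leaves independent Poisson variables, and the partition
   function is bounded below by the weight of a single configuration. Convexity
   of the exponential turns these bounds, at small positive and negative
   parameters, into convergence of [E(D - D_K)].

   The boundary conditions enter only through [q^bc_k -> q_k] with
   [q^bc_k <= C_N q_k] and [C_N -> 1]. In the Dirichlet case the lower bound on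
   the killed kernel comes from dyadic chaining: a path that leaves the box
   makes a large increment on some dyadic interval, and such an increment is
   almost independent of the event that the path returns to its start. *)
Require Import Defs.
From mathcomp Require Import all_boot all_order all_algebra.
From mathcomp Require Import all_classical all_reals all_analysis.
From mathcomp Require Import measurable_realfun.
From mathcomp Require Import ring lra.

Set Implicit Arguments.
Unset Strict Implicit.
Unset Printing Implicit Defensive.

Import Order.TTheory GRing.Theory Num.Theory.
Import numFieldNormedType.Exports.

Local Open Scope classical_set_scope.
Local Open Scope ring_scope.

(** * Tilted weights *)

(** The density [D] is not continuous on l1, so mass can escape to ever longer cycles. When the
    multiplier [lam] vanishes the weights decay only polynomially, and under the limiting
    independent Poisson law [D - D_K] has no positive exponential moment. The remedy is to take the
    tangent of the energy at [c + t / a] when the Laplace parameter is [t]: the slope then changes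
    by exactly [- t], which cancels the parameter on all cycles longer than [K]. Only finitely many
    coordinates remain tilted, the price is of order [t ^ 2], and the first order in [t] is the
    claimed mean.

    The killed kernel is accessible only through averages over cubes of side [eps], so the
    probability of leaving the box must be small relative to [eps ^ d]. A bound on the exit
    probability alone is useless. Every bad increment is chosen so that half of the time interval
    stays free; the return to the cube then costs a factor of order [eps ^ d] again, independently
    of the bad increment. *)

Lemma nnseries_le (R : realType) (u : nat -> R) (M : R) :
  (forall j, 0 <= u j) -> (forall n, \sum_(j < n) u j <= M) ->
  (\sum_(j <oo) (u j)%:E <= M%:E)%E.
Proof.
move=> u0 uM; apply: lime_le.
  by apply: is_cvg_nneseries => n _ _; rewrite lee_fin.
by apply: nearW => n; rewrite big_mkord sumEFin lee_fin.
Qed.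

Lemma nnseries_ge (R : realType) (u : nat -> R) n :
  (forall j, 0 <= u j) ->
  ((\sum_(j < n) u j)%:E <= \sum_(j <oo) (u j)%:E)%E.
Proof.
move=> u0; rewrite -sumEFin -(big_mkord xpredT (fun j => (u j)%:E)).
by apply: nneseries_lim_ge => k _ _; rewrite lee_fin.
Qed.

Lemma nnseries_fin (R : realType) (u : nat -> R) :
  (forall j, 0 <= u j) -> (\sum_(j <oo) (u j)%:E < +oo)%E ->
  (\sum_(j <oo) (u j)%:E)%E \is a fin_num.
Proof.
move=> u0 uoo; rewrite ge0_fin_numE//.
by apply: nneseries_ge0 => j _ _; rewrite lee_fin.
Qed.

Lemma nnseries_cvg (R : realType) (u : nat -> R) (s : R) :
  (forall j, 0 <= u j) -> (\sum_(j <oo) (u j)%:E)%E = s%:E ->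
  (fun n => \sum_(j < n) u j) @ \oo --> s.
Proof.
move=> u0 us.
have : (fun n => (\sum_(j < n) u j)%:E) @ \oo --> s%:E.
  rewrite -us; under eq_fun do rewrite -sumEFin -(big_mkord xpredT (fun j => (u j)%:E)).
  by apply: is_cvg_nneseries => n _ _; rewrite lee_fin.
by move/fine_cvgP => [_ /=].
Qed.

Lemma cvg_nnseries (R : realType) (u : nat -> R) (s : R) :
  (fun n => \sum_(j < n) u j) @ \oo --> s ->
  (\sum_(j <oo) (u j)%:E)%E = s%:E.
Proof.
move=> us; apply/cvg_lim => //.
under eq_fun do rewrite big_mkord sumEFin.
by apply/fine_cvgP; split => //=; exact: nearW.
Qed.

Section pseries.
Variable R : realType.

(** With [y ^+ 2 - x ^+ 2 = 1] the right side equals [2 / (x y (x + y))], and [x <= y]. Summed over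
    [n] it telescopes. *)
Let psqrtS (n : nat) :
  (Num.sqrt n.+2%:R ^+ 3)^-1 <= 2 * ((Num.sqrt n.+1%:R)^-1 - (Num.sqrt n.+2%:R)^-1) :> R.
Proof.
set x := Num.sqrt n.+1%:R; set y := Num.sqrt n.+2%:R.
have x0 : 0 < x by rewrite sqrtr_gt0 ltr0n.
have y0 : 0 < y by rewrite sqrtr_gt0 ltr0n.
have xy : x <= y by rewrite ler_wsqrtr// ler_nat.
have xy1 : y ^+ 2 - x ^+ 2 = 1.
  by rewrite !sqr_sqrtr ?ler0n// -natrB// subSnn.
have -> : x^-1 - y^-1 = (y - x) / (x * y) by field; rewrite !gt_eqF //.
have e : y - x = (x + y)^-1.
  apply: (@mulIf _ (x + y)); first by rewrite gt_eqF// addr_gt0.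
  by rewrite mulVf ?gt_eqF// ?addr_gt0// -xy1; ring.
rewrite e -[_ / (x * y)]invfM.
rewrite -[leLHS]mul1r ler_pdivrMr ?exprn_gt0// -mulrA mulrC -mulrA.
rewrite ler_pdivlMl ?mulr_gt0 ?addr_gt0// mulr1.
have -> : y ^+ 3 * 2 = (y + y) * (y * y) by ring.
apply: ler_pM; rewrite ?mulr_ge0 ?addr_ge0 ?ltW//.
  by rewrite ltrD2r lt_neqAle xy andbT; apply/eqP => xye; move: xy1; rewrite xye; lra.
by rewrite ltr_pM2r// lt_neqAle xy andbT; apply/eqP => xye; move: xy1; rewrite xye; lra.
Qed.

Lemma sum_inv_sqrt3 (n : nat) :
  \sum_(j < n) (Num.sqrt j.+1%:R ^+ 3)^-1 <= 3 :> R.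
Proof.
suff H : \sum_(j < n.+1) (Num.sqrt j.+1%:R ^+ 3)^-1 <= 3 - 2 / Num.sqrt n.+1%:R :> R.
  case: n H => [|n] H; first by rewrite big_ord0; lra.
  apply: le_trans (_ : 3 - 2 / Num.sqrt n.+2%:R <= 3).
    by apply: le_trans H; rewrite [leRHS]big_ord_recr/= lerDl invr_ge0 exprn_ge0// sqrtr_ge0.
  by rewrite gerBl divr_ge0// sqrtr_ge0.
elim: n => [|n IH]; first by rewrite big_ord1 sqrtr1 expr1n invr1; lra.
by rewrite big_ord_recr/=; have := psqrtS n; lra.
Qed.

End pseries.

Section entropy.
Variable R : realType.

(** Relative entropy of the Poisson law of mean [y] with respect to that of mean [z]. *)
Definition ent (y z : R) : R := y * ln (y / z) - y + z.

Lemma ent_gt0 y z : 0 <= y -> 0 < z -> y != z -> 0 < ent y z.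
Proof.
rewrite /ent le_eqVlt => /predU1P[<- z0 _|y0 z0 yz]; first by rewrite mul0r; lra.
have : ln (z / y) < z / y - 1.
  rewrite -ltr_expR lnK ?posrE ?divr_gt0//.
  have : z / y - 1 != 0.
    rewrite subr_eq0; apply: contra_neq yz => zy.
    by rewrite -(mul1r y) -zy divfK// gt_eqF.
  by move=> /expR_gt1Dx; apply: le_lt_trans; lra.
have -> : ln (z / y) = - ln (y / z) by rewrite -lnV ?posrE ?divr_gt0// invf_div.
rewrite -(ltr_pM2l y0) mulrBr mulrCA divff ?gt_eqF//; lra.
Qed.

Lemma entxx z : 0 < z -> ent z z = 0.
Proof. by move=> z0; rewrite /ent divff ?gt_eqF// ln1; ring. Qed.

Lemma ent_ge0 y z : 0 <= y -> 0 < z -> 0 <= ent y z.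
Proof.
move=> y0 z0; have [->|yz] := eqVneq y z; first by rewrite entxx.
exact/ltW/ent_gt0.
Qed.

(** Tilting the reference weight costs a term linear in [y]. With [b] proportional to the cycle
    length these terms add up to a multiple of the density, which can be traded against the
    energy. *)
Lemma ent_tilt y q b : 0 <= y -> 0 < q ->
  y * (ln (y / q) - 1) = ent y (q * expR (- b)) - b * y - q * expR (- b).
Proof.
rewrite /ent le_eqVlt => /predU1P[<- q0|y0 q0]; first by rewrite !mul0r; ring.
rewrite invfM mulrA expRN invrK lnM ?posrE ?divr_gt0 ?expR_gt0// expRK; ring.
Qed.

End entropy.

Section tilted.
Variables (R : realType) (d : nat) (beta : R).
Hypotheses (d0 : (0 < d)%N) (beta0 : 0 < beta).
Notation q := (qfree d beta 0).

Definition xi (lam : R) (j : nat) : R := q j * expR (- (beta * lam * j.+1%:R)).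

Let peak_gt0 : 0 < (4 * pi * beta) `^ (d%:R / 2) :> R.
Proof. by rewrite powR_gt0// !mulr_gt0// ?pi_gt0. Qed.

Lemma qfreeE alpha j : qfree d beta alpha j = q j * expR (beta * alpha * j.+1%:R).
Proof. by rewrite /qfree mulr0 mul0r expR0 mul1r mulrC. Qed.

Lemma qfree_gt0 alpha j : 0 < qfree d beta alpha j.
Proof.
by rewrite /qfree mulr_gt0 ?expR_gt0// invr_gt0 mulr_gt0// powR_gt0.
Qed.

Lemma xi_gt0 lam j : 0 < xi lam j.
Proof. by rewrite mulr_gt0 ?expR_gt0// qfree_gt0. Qed.

Lemma kxi_ge0 lam j : 0 <= j.+1%:R * xi lam j.
Proof. by rewrite mulr_ge0// ltW// xi_gt0. Qed.

(** The exponent [1 + d / 2] is at least [3 / 2], so the case [d = 1] dominates all dimensions. *)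
Lemma qfree_le_pseries j :
  q j <= ((4 * pi * beta) `^ (d%:R / 2))^-1 * (Num.sqrt j.+1%:R ^+ 3)^-1.
Proof.
rewrite /qfree mulr0 mul0r expR0 mul1r invfM ler_pM2l ?invr_gt0//.
rewrite lef_pV2 ?posrE ?exprn_gt0 ?sqrtr_gt0 ?powR_gt0//.
rewrite -(powR12_sqrt (ler0n _ _)) -powR_mulrn ?powR_ge0// -powRrM.
apply: ler_powR; first by rewrite ler1n.
have : 1 <= d%:R :> R by rewrite ler1n.
lra.
Qed.

Lemma qbar_fin : qbar d beta 0 \is a fin_num.
Proof.
apply: nnseries_fin => [j|]; first exact/ltW/qfree_gt0.
apply: le_lt_trans (ltry (((4 * pi * beta) `^ (d%:R / 2))^-1 * 3)).
apply: nnseries_le => [j|n]; first exact/ltW/qfree_gt0.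
apply: le_trans (_ : \sum_(j < n) ((4 * pi * beta) `^ (d%:R / 2))^-1 *
  (Num.sqrt j.+1%:R ^+ 3)^-1 <= _).
  by apply: ler_sum => j _; exact: qfree_le_pseries.
by rewrite -mulr_sumr ler_pM2l ?invr_gt0// sum_inv_sqrt3.
Qed.

Lemma xi_decr lam lam' j : lam <= lam' -> xi lam' j <= xi lam j.
Proof.
move=> ll; by rewrite ler_pM2l ?qfree_gt0// ler_expR lerN2 ler_wpM2r// ler_pM2l.
Qed.

Lemma xi0 j : xi 0 j = q j.
Proof. by rewrite /xi mulr0 mul0r oppr0 expR0 mulr1. Qed.

Lemma xi_lipschitz lam lam' j : lam' <= lam ->
  xi lam' j <= xi lam j + beta * j.+1%:R * (lam - lam') * xi lam' j.
Proof.
move=> ll; rewrite -lerBlDl; set x := beta * _ * _.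
have -> : xi lam j = xi lam' j * expR (- x).
  by rewrite /xi -[RHS]mulrA -expRD /x; congr (_ * expR _); ring.
rewrite -[X in X - _]mulr1 -mulrBr mulrC ler_pM2r ?xi_gt0//.
by have := expR_ge1Dx (- x); lra.
Qed.

Definition W (lam : R) : R := fine (\sum_(j <oo) (xi lam j)%:E)%E.

Lemma W_EFin lam : 0 <= lam -> (\sum_(j <oo) (xi lam j)%:E)%E = (W lam)%:E.
Proof.
move=> l0; rewrite /W fineK//; apply: nnseries_fin => [j|].
  exact/ltW/xi_gt0.
apply: le_lt_trans (_ : qbar d beta 0 < +oo)%E; last first.
  by rewrite ltey_eq qbar_fin.
apply: lee_nneseries => [j _ _|j _]; rewrite lee_fin; first exact/ltW/xi_gt0.
by rewrite -(xi0 j) xi_decr.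
Qed.

Lemma qbarE : qbar d beta 0 = (W 0)%:E.
Proof. by rewrite -W_EFin//; apply: eq_eseriesr => j _; rewrite xi0. Qed.

Lemma sum_q_le n : \sum_(j < n) q j <= W 0.
Proof.
rewrite -lee_fin -qbarE; apply: nnseries_ge => j; exact/ltW/qfree_gt0.
Qed.

(** By [x <= exp x] at [x = beta lam (j + 1)], a positive tilt pays for a factor [j + 1]; the
    constant blows up as [lam] tends to 0. *)
Lemma kxi_bound lam j : 0 < lam -> j.+1%:R * xi lam j <= (beta * lam)^-1 * q j.
Proof.
move=> l0; rewrite /xi mulrCA mulrC ler_pM2r ?qfree_gt0//.
rewrite expRN ler_pdivrMr ?expR_gt0// ler_pdivlMl ?mulr_gt0//.
by have := expR_ge1Dx (beta * lam * j.+1%:R); lra.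
Qed.

Lemma k2xi_bound lam j : 0 < lam ->
  j.+1%:R ^+ 2 * xi lam j <= 2 / (beta * lam) ^+ 2 * q j.
Proof.
move=> l0; rewrite /xi mulrCA mulrC ler_pM2r ?qfree_gt0//.
rewrite expRN ler_pdivrMr ?expR_gt0// mulrAC ler_pdivlMr ?exprn_gt0 ?mulr_gt0//.
have x0 : 0 <= beta * lam * j.+1%:R by rewrite !mulr_ge0// ltW.
have := expR_ge1Dxn 1 x0; rewrite exprMn (_ : 2`! = 2)%N//; lra.
Qed.

Definition Dxi (lam : R) : \bar R := (\sum_(j <oo) (j.+1%:R * xi lam j)%:E)%E.

Lemma Dxi_le lam : 0 < lam -> (Dxi lam <= (W 0 / (beta * lam))%:E)%E.
Proof.
move=> l0; apply: nnseries_le => [j|n]; first exact: kxi_ge0.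
apply: le_trans (_ : \sum_(j < n) (beta * lam)^-1 * q j <= _).
  by apply: ler_sum => j _; exact: kxi_bound.
by rewrite -mulr_sumr mulrC ler_pM2r ?invr_gt0 ?mulr_gt0// sum_q_le.
Qed.

Lemma Dxi_ge lam n : ((\sum_(j < n) j.+1%:R * xi lam j)%:E <= Dxi lam)%E.
Proof. by apply: nnseries_ge => j; exact: kxi_ge0. Qed.

Lemma Dxi_fin lam : (Dxi lam < +oo)%E -> Dxi lam \is a fin_num.
Proof. by move=> ?; apply: nnseries_fin => // j; exact: kxi_ge0. Qed.

(** The Lipschitz constant is a second moment of the weights. It is controlled only away from
    [lam = 0], where that moment can be infinite. *)
Lemma Dxi_lipschitz lam0 lam lam' : 0 < lam0 -> lam0 <= lam' -> lam' <= lam ->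
  (Dxi lam' <=
   Dxi lam + ((lam - lam') * (beta * (2 / (beta * lam0) ^+ 2) * W 0))%:E)%E.
Proof.
move=> l0 l0l ll; have fl : Dxi lam \is a fin_num.
  apply: Dxi_fin; apply: le_lt_trans (Dxi_le _) (ltry _).
  by rewrite (lt_le_trans l0)// (le_trans l0l).
rewrite -(fineK fl) -EFinD; apply: nnseries_le => [j|n]; first exact: kxi_ge0.
apply: le_trans (_ : \sum_(j < n) (j.+1%:R * xi lam j +
   (lam - lam') * (beta * (2 / (beta * lam0) ^+ 2) * q j)) <= _).
  apply: ler_sum => j _.
  have /(ler_wpM2l (ler0n R j.+1)) /le_trans-> // := xi_lipschitz j ll.
  rewrite mulrDr lerD2l.
  have -> : j.+1%:R * (beta * j.+1%:R * (lam - lam') * xi lam' j) =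
    (lam - lam') * (beta * (j.+1%:R ^+ 2 * xi lam' j)) by ring.
  rewrite ler_wpM2l ?subr_ge0// -mulrA ler_pM2l//.
  apply: le_trans (k2xi_bound j l0); rewrite ler_wpM2l// ?sqr_ge0//.
  exact: xi_decr.
rewrite big_split/= lerD//; first by rewrite -lee_fin fineK//; exact: Dxi_ge.
rewrite -mulr_sumr ler_wpM2l ?subr_ge0// -mulr_sumr ler_wpM2l ?sum_q_le//.
by rewrite mulr_ge0 ?divr_ge0 ?sqr_ge0// ltW.
Qed.

Variable a : R.
Hypothesis a0 : 0 < a.

(* The condensate branch is [a c = m] and the normal one [s = c]: [c] is the
   total density, [s] the density carried by the finite cycles, and
   [a c - m] the Lagrange multiplier of the finite part. *)
Definition crit (m c s : R) : Prop :=
  [/\ m <= a * c, Dxi (a * c - m) = s%:E, s <= c & (a * c - m) * (c - s) = 0].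

(** As [c] grows, [Dxi (a c - m)] decreases, so the inequality [Dxi (a c - m) <= c] holds from some
    point on. The infimum of the admissible [c] is critical: if the multiplier were positive and the
    inequality strict, [c] could still be lowered. *)
Lemma crit_exists m : exists c s, crit m c s.
Proof.
pose S := [set c | m < a * c /\ (Dxi (a * c - m) <= c%:E)%E].
have W0 : 0 <= W 0 by have := sum_q_le 0; rewrite big_ord0.
have lbS c : S c -> m / a <= c.
  by move=> [/ltW mac _]; rewrite ler_pdivrMr// mulrC.
have [c1 Sc1] : S !=set0.
  (* The first entry makes the multiplier at least 1, and then [Dxi_le] bounds the density by the
     second entry. *)
  pose c := Num.max ((m + 1) / a) (W 0 / beta).
  have l1 : 1 <= a * c - m.
    have : (m + 1) / a <= c by rewrite le_max lexx.
    by rewrite ler_pdivrMr// mulrC; lra.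
  exists c; split; first by lra.
  apply: le_trans (Dxi_le _) _; first by lra.
  rewrite lee_fin; apply: le_trans (_ : W 0 / beta <= _); last first.
    by rewrite le_max lexx orbT.
  rewrite ler_wpM2l// lef_pV2 ?posrE ?mulr_gt0//; last by lra.
  by rewrite ler_peMr// ltW.
have iS : has_inf S by split; [exists c1|exists (m / a)].
pose c := inf S.
have Sc e : S e -> c <= e by move=> Se; apply: ge_inf => //; case: iS.
have mc : m <= a * c.
  by rewrite mulrC -ler_pdivrMr//; apply: lb_le_inf => //; case: iS.
have Dc : (Dxi (a * c - m) <= c%:E)%E.
  apply: nnseries_le => [j|n]; first exact: kxi_ge0.
  pose C := \sum_(j < n) beta * j.+1%:R ^+ 2 * q j.
  have C0 : 0 <= C.
    apply: sumr_ge0 => j _; apply: mulr_ge0; last exact/ltW/qfree_gt0.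
    by apply: mulr_ge0; [exact: ltW|exact: sqr_ge0].
  apply/ler_addgt0Pr => e e0.
  have [e' [me' De'] e'c] := @inf_adherent _ S (e / (1 + a * C))
    (divr_gt0 e0 (ltr_pwDl ltr01 (mulr_ge0 (ltW a0) C0))) iS.
  have ce' : c <= e' by exact: Sc.
  apply: le_trans (_ : \sum_(j < n) (j.+1%:R * xi (a * e' - m) j +
     a * (e' - c) * (beta * j.+1%:R ^+ 2 * q j)) <= _).
    apply: ler_sum => j _.
    have ll : a * c - m <= a * e' - m by rewrite lerD2r ler_pM2l.
    have /(ler_wpM2l (ler0n R j.+1)) /le_trans-> // := xi_lipschitz j ll.
    rewrite mulrDr lerD2l.
    have -> : j.+1%:R * (beta * j.+1%:R * (a * e' - m - (a * c - m)) * xi (a * c - m) j)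
      = a * (e' - c) * (beta * j.+1%:R ^+ 2 * xi (a * c - m) j) by ring.
    rewrite ler_wpM2l// ?mulr_ge0 ?subr_ge0 ?(ltW a0)//.
    rewrite ler_wpM2l ?mulr_ge0 ?sqr_ge0 ?(ltW beta0)//.
    by rewrite -(xi0 j) xi_decr// subr_ge0.
  rewrite big_split/= -mulr_sumr -/C.
  have /le_trans/(_ De') := Dxi_ge (a * e' - m) n; rewrite lee_fin => Hn.
  have : e' - c < e / (1 + a * C) by rewrite ltrBlDl.
  rewrite ltr_pdivlMr ?ltr_pwDl ?mulr_ge0 ?(ltW a0)//.
  move=> Hl; apply: le_trans (lerD Hn (lexx _)) _; nra.
have [s Ds] : exists s, Dxi (a * c - m) = s%:E.
  exists (fine (Dxi (a * c - m))); rewrite fineK// Dxi_fin//.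
  exact: le_lt_trans Dc (ltry _).
have sc : s <= c by rewrite -lee_fin -Ds.
exists c, s; split => //.
have [->|] := eqVneq (a * c) m; first by rewrite subrr mul0r.
rewrite -subr_eq0 => l0; have l0' : 0 < a * c - m by rewrite lt_neqAle eq_sym l0 subr_ge0.
have [->|sc'] := eqVneq s c; first by rewrite subrr mulr0.
exfalso; have {sc'} sc' : 0 < c - s by rewrite subr_gt0 lt_neqAle sc' sc.
set l := a * c - m in l0' Ds.
pose K := beta * (2 / (beta * (l / 2)) ^+ 2) * W 0.
have K0 : 0 <= K.
  by rewrite !mulr_ge0 ?invr_ge0 ?sqr_ge0// ltW.
(* The first entry ensures [s + a e K <= c - e], so the density bound survives at [c - e]; the
   second keeps the multiplier above [l / 2], where [K] is a Lipschitz constant. *)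
pose e := Num.min ((c - s) / (1 + a * K)) (l / 2 / a).
have aK : 0 < 1 + a * K by rewrite ltr_pwDl// mulr_ge0// ltW.
have e0 : 0 < e by rewrite lt_min !divr_gt0.
have e1 : e * (1 + a * K) <= c - s by rewrite -ler_pdivlMr// ge_min lexx.
have e2 : a * e <= l / 2.
  by rewrite mulrC -ler_pdivlMr// ge_min lexx orbT.
have : S (c - e).
  split; first by rewrite /l in l0' e2; lra.
  have -> : a * (c - e) - m = l - a * e by rewrite /l; ring.
  apply: le_trans (@Dxi_lipschitz (l / 2) l _ _ _ _) _; [lra|lra| |].
    by rewrite gerBl mulr_ge0// ltW.
  rewrite Ds -EFinD lee_fin -/K; lra.
by move/Sc; lra.
Qed.

End tilted.

(** * The rate function and the pressure *)

Section rate_function.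
Variables (R : realType) (d : nat) (beta a : R).
Hypotheses (d0 : (0 < d)%N) (beta0 : 0 < beta) (a0 : 0 < a).
Notation q := (qfree d beta 0).
Notation xi := (xi d beta).
Notation W := (W d beta).
Notation crit := (crit d beta a).

Definition entsum (lam : R) (y : nat -> R) : \bar R :=
  (\sum_(j <oo) (ent (y j) (xi lam j))%:E)%E.

Lemma entsum_ge0 lam y : (forall j, 0 <= y j) -> (0 <= entsum lam y)%E.
Proof.
move=> y0; apply: nneseries_ge0 => j _ _; rewrite lee_fin ent_ge0//.
exact: xi_gt0.
Qed.

Lemma entsum_eq0 lam y : (forall j, 0 <= y j) -> entsum lam y = 0%E -> y = xi lam.
Proof.
move=> y0 e0; apply/funext => j; apply/eqP/negPn/negP => yx.
have e := ent_gt0 (y0 j) (xi_gt0 d beta0 lam j) yx.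
have : (0 < entsum lam y)%E.
  apply: (@lt_le_trans _ _ (ent (y j) (xi lam j))%:E); first by rewrite lte_fin.
  apply: le_trans (nnseries_ge j.+1 _); last first.
    by move=> i; apply: ent_ge0 => //; exact: xi_gt0.
  rewrite lee_fin big_ord_recr/= lerDr; apply: sumr_ge0 => i _.
  by apply: ent_ge0 => //; exact: xi_gt0.
by rewrite e0 ltxx.
Qed.

Lemma entsum_xi lam : entsum lam (xi lam) = 0%E.
Proof. by apply: eseries0 => j _ _; rewrite entxx//; exact: xi_gt0. Qed.

Definition hlsc (m s : R) : R :=
  - m * s + a / 2 * s ^+ 2 - (2 * a)^-1 * (Num.max 0 (m - a * s)) ^+ 2.

Lemma Dtot_ge0 (y : nat -> R) : (forall j, 0 <= y j) -> (0 <= Dtot y)%E.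
Proof.
by move=> y0; apply: nneseries_ge0 => j _ _; rewrite lee_fin mulr_ge0.
Qed.

Lemma Hpmf_fin m y s : ell1_pos y -> Dtot y = s%:E ->
  Hpmf a m y = (- m * s + a / 2 * s ^+ 2)%:E.
Proof. by move=> yp Dy; rewrite /Hpmf mem_set// Dy/= ltry. Qed.

Lemma Hlsc_fin m y s : ell1_pos y -> Dtot y = s%:E -> Hlsc a m y = (hlsc m s)%:E.
Proof.
move=> yp Dy; rewrite /Hlsc mem_set// (Hpmf_fin _ yp Dy) Dy.
by rewrite -EFinM -EFinB -EFin_max -EFin_expe -EFinM -EFinB.
Qed.

Lemma Hlsc_pinfty m y : ell1_pos y -> Dtot y = +oo%E -> Hlsc a m y = +oo%E.
Proof.
move=> yp Dy; rewrite /Hlsc /Hpmf mem_set// Dy ltxx/=.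
by rewrite gt0_muley ?lte_fin//= addeNy maxEge/= leNye /=.
Qed.

(** The linear term enters through the limit of [beta lam D_n] and not through [Dtot y]: for
    [lam = 0] this limit is 0 even when the density is infinite. *)
Lemma Irate_tilt lam y t : 0 <= lam -> ell1_pos y ->
  (fun n => beta * lam * \sum_(j < n) j.+1%:R * y j) @ \oo --> t ->
  Irate d beta y = (entsum lam y + (W 0 - W lam - t)%:E)%E.
Proof.
move=> l0 yp yt; have [_ y0] := yp.
rewrite /Irate mem_set// (qbarE d0 beta0).
have -> : (\sum_(j <oo) (y j * (ln (y j / q j) - 1))%:E = entsum lam y + (- W lam - t)%:E)%E.
  apply/cvg_lim => //.
  have e n : (\sum_(0 <= j < n) (y j * (ln (y j / q j) - 1))%:E =
     \sum_(0 <= j < n) (ent (y j) (xi lam j))%:E +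
     (- \sum_(j < n) xi lam j - beta * lam * \sum_(j < n) j.+1%:R * y j)%:E)%E.
    rewrite !sumEFin -EFinD; congr (_%:E); rewrite !big_mkord mulr_sumr -!sumrN.
    rewrite -!big_split/=; apply: eq_bigr => j _.
    rewrite (@ent_tilt _ _ _ (beta * lam * j.+1%:R))//; last exact: qfree_gt0.
    by rewrite -/(xi lam j); ring.
  under eq_fun do rewrite e.
  apply: cvgeD.
  - by rewrite fin_num_adde_defl.
  - apply: is_cvg_nneseries => j _ _; rewrite lee_fin ent_ge0//; exact: xi_gt0.
  - apply: cvg_EFin; first exact: nearW.
    apply: cvgB => //; apply: cvgN; apply: nnseries_cvg.
      by move=> j; apply/ltW/xi_gt0.
    exact: W_EFin.
by rewrite -addeA -EFinD; congr (_ + _%:E)%E; ring.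
Qed.

(** Lagrange dual function of the minimisation of [Fpmf]. It is concave in [c], with formal
    derivative [beta a (Dxi (a c - m) - c)], and [crit] is the Karush-Kuhn-Tucker system for
    maximising it subject to [m <= a c]. *)
Definition fbase (m c : R) : R := W 0 - W (a * c - m) - beta * (a / 2 * c ^+ 2).

(** In [s], [hlsc m] is convex: the parabola to the right of [m / a], the constant [- m ^ 2 / (2 a)]
    to the left. The left side is its tangent at [c >= m / a]. *)
Lemma hlsc_ge m c s : m <= a * c -> (a * c - m) * s - a / 2 * c ^+ 2 <= hlsc m s.
Proof.
move=> mc; rewrite /hlsc; case: (leP 0 (m - a * s)) => ms; last first.
  by rewrite expr0n/= mulr0; have := mulr_ge0 (ltW a0) (sqr_ge0 (s - c)); lra.
have -> : (2 * a)^-1 * (m - a * s) ^+ 2 = m ^+ 2 / (2 * a) - m * s + a / 2 * s ^+ 2.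
  by field; rewrite gt_eqF.
have -> : a / 2 * c ^+ 2 = (a * c) ^+ 2 / (2 * a) by field; rewrite gt_eqF.
have asm : (a * c - m) * s <= (a * c - m) * (m / a).
  by rewrite ler_wpM2l ?subr_ge0// ler_pdivlMr// mulrC -subr_ge0.
have : (a * c - m) * (m / a) - (a * c) ^+ 2 / (2 * a) + m ^+ 2 / (2 * a) =
  - ((a * c - m) ^+ 2 / (2 * a)) by field; rewrite gt_eqF.
have : 0 <= (a * c - m) ^+ 2 / (2 * a).
  by rewrite divr_ge0 ?sqr_ge0// mulr_ge0// ltW.
lra.
Qed.

Lemma Fpmf_ge m c y : m <= a * c -> ell1_pos y ->
  (entsum (a * c - m) y + (fbase m c)%:E <= Fpmf d a beta m y)%E.
Proof.
move=> mc yp; have l0 : 0 <= a * c - m by rewrite subr_ge0.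
have y0 := yp.2; have := Dtot_ge0 y0; case Dy: (Dtot y) => [s| |]// _; last first.
  rewrite /Fpmf (Hlsc_pinfty _ yp Dy) gt0_muley ?lte_fin//.
  (* At infinite density the energy is [+oo]; it only has to be excluded that the entropy is [-oo],
     which the untilted form shows. *)
  rewrite (@Irate_tilt 0 _ 0)//; last first.
    by under eq_fun do rewrite mulr0 mul0r; exact: cvg_cst.
  rewrite addye ?leey// -ltNye (@lt_le_trans _ _ (W 0 - W 0 - 0)%:E) ?ltNyr//.
  by rewrite leeDr// entsum_ge0.
rewrite /Fpmf (Hlsc_fin _ yp Dy) (@Irate_tilt (a * c - m) _ (beta * (a * c - m) * s))//.
  rewrite addeCA leeD2l// -EFinM -EFinD lee_fin /fbase.
  have := ler_wpM2l (ltW beta0) (hlsc_ge s mc); lra.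
apply: cvgMr; apply: nnseries_cvg Dy => j; by rewrite mulr_ge0.
Qed.

Lemma Fpmf_notin m y : ~ ell1_pos y -> Fpmf d a beta m y = +oo%E.
Proof.
move=> yp; rewrite /Fpmf /Hlsc /Irate memNset//.
by rewrite gt0_muley ?lte_fin.
Qed.

Lemma hlsc_crit m c s : crit m c s ->
  hlsc m s = (a * c - m) * s - a / 2 * c ^+ 2.
Proof.
move=> [mc _ sc /eqP]; rewrite mulf_eq0 => /orP[|] /eqP h; rewrite /hlsc.
  have -> : m = a * c by lra.
  rewrite -mulrBr max_r ?mulr_ge0 ?subr_ge0// ?(ltW a0)//; field.
  by rewrite gt_eqF.
have <- : c = s by lra.
by rewrite max_l; [rewrite expr0n/= mulr0; field|lra].
Qed.

Lemma xi_ell1_pos lam : 0 <= lam -> ell1_pos (xi lam).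
Proof.
move=> l0; split; last by move=> j; apply/ltW/xi_gt0.
rewrite /ell1/=; under eq_eseriesr => j _ do rewrite gtr0_norm ?xi_gt0//.
by rewrite (W_EFin d0 beta0 l0) ltry.
Qed.

(** The energy parameter [m'] is separate from the [m] that fixes the multiplier, because the
    minimiser at [m] serves as a trial sequence at neighbouring parameters. *)
Lemma Fpmf_xi m' m c s : crit m c s ->
  Fpmf d a beta m' (xi (a * c - m)) =
  (beta * hlsc m' s + W 0 - W (a * c - m) - beta * (a * c - m) * s)%:E.
Proof.
move=> [mc Ds sc _]; have l0 : 0 <= a * c - m by rewrite subr_ge0.
have yp := xi_ell1_pos l0.
rewrite /Fpmf (Hlsc_fin _ yp Ds) (@Irate_tilt (a * c - m) _ (beta * (a * c - m) * s))//.
  by rewrite entsum_xi add0e -EFinM -EFinD; congr (_%:E); ring.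
apply: cvgMr; apply: nnseries_cvg Ds => j; exact: kxi_ge0.
Qed.

Lemma Fpmf_crit m c s : crit m c s ->
  Fpmf d a beta m (xi (a * c - m)) = (fbase m c)%:E.
Proof.
by move=> h; rewrite (Fpmf_xi _ h) (hlsc_crit h) /fbase; congr (_%:E); ring.
Qed.

Lemma ell1_xi lam : 0 <= lam -> ell1 (xi lam).
Proof. by move=> /xi_ell1_pos[]. Qed.

Lemma inf_Fpmf_ge m c : m <= a * c -> ((fbase m c)%:E <= inf_Fpmf d a beta m)%E.
Proof.
move=> mc; apply: le_ereal_inf_tmp => _ [y _ <-].
have [yp|yp] := pselect (ell1_pos y); last by rewrite Fpmf_notin ?leey.
by apply: le_trans (Fpmf_ge mc yp); rewrite leeDr// entsum_ge0//; case: yp.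
Qed.

Lemma inf_Fpmf_crit m c s : crit m c s -> inf_Fpmf d a beta m = (fbase m c)%:E.
Proof.
move=> h; have [mc _ _ _] := h; apply/eqP; rewrite eq_le inf_Fpmf_ge// andbT.
apply: ereal_inf_lbound; exists (xi (a * c - m)); last exact: (Fpmf_crit h).
by apply: ell1_xi; rewrite subr_ge0.
Qed.

Lemma Fpmf_min_unique m c s y : crit m c s ->
  (Fpmf d a beta m y <= (fbase m c)%:E)%E -> y = xi (a * c - m).
Proof.
move=> [mc _ _ _]; have [yp|yp] := pselect (ell1_pos y); last first.
  by rewrite Fpmf_notin.
move=> /(le_trans (Fpmf_ge mc yp)).
rewrite -[leRHS]add0e leeD2rE// => e0; apply: entsum_eq0; first by case: yp.
by apply/eqP; rewrite eq_le e0 entsum_ge0//; case: yp.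
Qed.

End rate_function.

(** Suited to convex functions given by a variational formula: the supporting line comes from a
    trial state, the quadratic bound from a dual point. *)
Lemma is_derive_sandwich (R : realType) (f : R -> R) (x l C : R) :
  (forall h, l * h <= f (x + h) - f x <= l * h + C * h ^+ 2) ->
  is_derive x 1 f l.
Proof.
move=> fh; have : (fun h => h^-1 *: ((f \o shift x) (h *: 1) - f x)) @ 0^' --> l.
  apply/cvgrPdist_le => e e0; near=> h.
  have h0 : h != 0 by near: h; exact: nbhs_dnbhs_neq.
  rewrite /= -[h *: 1]/(h * 1) mulr1 [h + x]addrC -[_ *: _]/(_ * _).
  have -> : l - h^-1 * (f (x + h) - f x) = - (h^-1 * (f (x + h) - f x - l * h)).
    by field.
  rewrite normrN normrM normfV ler_pdivrMl ?normr_gt0//.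
  have /andP[fl fu] := fh h.
  rewrite ger0_norm ?subr_ge0//.
  apply: le_trans (_ : C * h ^+ 2 <= _); first by rewrite lerBlDl.
  rewrite -(@real_normK _ h) ?num_real//.
  have hC : `|h| * (1 + `|C|) <= e.
    rewrite -ler_pdivlMr ?ltr_pwDl//; apply: ltW.
    near: h; apply: dnbhs0_lt; rewrite divr_gt0// ltr_pwDl//.
  apply: le_trans (_ : `|h| ^+ 2 * (1 + `|C|) <= _).
    by rewrite mulrC ler_wpM2l ?sqr_ge0// (le_trans (ler_norm C))// lerDr.
  by rewrite expr2 -mulrA ler_wpM2l.
move=> cl; apply: DeriveDef; first by apply/cvg_ex; exists l.
exact/cvg_lim.
Unshelve. all: by end_near. Qed.

(** * Derivatives of the pressure and of the energy gap; the critical density *)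

Section pressure.
Variables (R : realType) (d : nat) (beta a : R).
Hypotheses (d0 : (0 < d)%N) (beta0 : 0 < beta) (a0 : 0 < a).
Notation W := (W d beta).
Notation xi := (xi d beta).
Notation crit := (crit d beta a).

(** For fixed [s], [hlsc] is concave in [m] with slope [- max (s, m / a)], and in both branches of
    [crit] this maximum is [c]. *)
Lemma hlsc_concave m c s h : crit m c s -> hlsc a (m + h) s <= hlsc a m s - c * h.
Proof.
move=> hc; rewrite (hlsc_crit a0 hc) /hlsc; have [mc _ sc /eqP] := hc.
have a2 : 0 <= (2 * a)^-1 by rewrite invr_ge0 mulr_ge0// ltW.
rewrite mulf_eq0 => /orP[|] /eqP e; last first.
  have <- : c = s by lra.
  have : 0 <= (2 * a)^-1 * Num.max 0 (m + h - a * c) ^+ 2.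
    by rewrite mulr_ge0 ?sqr_ge0.
  lra.
have -> : m = a * c by lra.
have as0 : 0 <= a * (c - s) by rewrite mulr_ge0 ?subr_ge0// ltW.
case: (leP 0 (a * c + h - a * s)) => ms.
  have : 0 <= (2 * a)^-1 * h ^+ 2 by rewrite mulr_ge0 ?sqr_ge0.
  have -> : (2 * a)^-1 * (a * c + h - a * s) ^+ 2 =
    (2 * a)^-1 * h ^+ 2 + a / 2 * (c - s) ^+ 2 + h * (c - s).
    by field; rewrite gt_eqF.
  lra.
rewrite expr0n/= mulr0.
have : 0 <= (c - s) * - (a * (c - s) + 2 * h).
  by rewrite mulr_ge0 ?subr_ge0//; lra.
lra.
Qed.

Lemma inf_Fpmf_fin m : inf_Fpmf d a beta m \is a fin_num.
Proof.
by have [c [s h]] := crit_exists d0 beta0 a0 m; rewrite (inf_Fpmf_crit d0 beta0 a0 h).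
Qed.

Lemma pressureE m alpha : pressure d a beta m alpha =
  (beta^-1 * W 0 - beta^-1 * fine (inf_Fpmf d a beta (m + alpha)))%:E.
Proof.
rewrite /pressure (qbarE d0 beta0) -(fineK (inf_Fpmf_fin (m + alpha))).
by rewrite -!EFinM -EFinB.
Qed.

Lemma derive_pressure mu alpha c s : crit (mu + alpha) c s ->
  is_derive mu 1 (fun m : R => fine (pressure d a beta m alpha)) c.
Proof.
move=> hc; apply: (@is_derive_sandwich _ _ _ _ (2 * a)^-1) => h.
rewrite !pressureE/= (inf_Fpmf_crit d0 beta0 a0 hc)/=.
set F := fine _; have [mc _ _ _] := hc.
(* The minimiser at [mu + alpha] is the trial sequence at [mu + h + alpha]. *)
have upp : F <= fbase d beta a (mu + alpha) c - beta * c * h.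
  rewrite -lee_fin fineK ?inf_Fpmf_fin//.
  apply: le_trans (_ : Fpmf d a beta (mu + h + alpha) (xi (a * c - (mu + alpha))) <= _)%E.
    apply: ereal_inf_lbound; eexists; last by [].
    by apply: ell1_xi => //; rewrite subr_ge0.
  rewrite (Fpmf_xi d0 beta0 _ hc) lee_fin.
  have -> : mu + h + alpha = mu + alpha + h by ring.
  have := ler_wpM2l (ltW beta0) (hlsc_concave h hc).
  rewrite (hlsc_crit a0 hc) /fbase; lra.
(* Moving the tangent point by [h / a] leaves the multiplier unchanged, so the values of [W] cancel
   and the dual bound is an explicit quadratic in [h]. *)
have low : fbase d beta a (mu + h + alpha) (c + h / a) <= F.
  rewrite -lee_fin fineK ?inf_Fpmf_fin//; apply: inf_Fpmf_ge => //.
  by rewrite mulrDr mulrC [h / a]mulrC mulVKf ?gt_eqF//; lra.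
have e : fbase d beta a (mu + h + alpha) (c + h / a) =
    fbase d beta a (mu + alpha) c - beta * (c * h + (2 * a)^-1 * h ^+ 2).
  rewrite /fbase; have -> : a * (c + h / a) - (mu + h + alpha) = a * c - (mu + alpha).
    by field; rewrite gt_eqF.
  by field; rewrite gt_eqF.
rewrite e in low.
set B := fbase _ _ _ _ _ in upp low *.
have -> : beta^-1 * W 0 - beta^-1 * F - (beta^-1 * W 0 - beta^-1 * B) = (B - F) / beta.
  by field; rewrite gt_eqF.
rewrite ler_pdivlMr// ler_pdivrMr//; apply/andP; split; lra.
Qed.

Lemma HgapE (alpha : R) (y : nat -> R) (s m : R) : ell1_pos y -> Dtot y = s%:E ->
  Hgap a alpha y m = ((2 * a)^-1 * Num.max 0 (m + alpha - a * s) ^+ 2)%:E.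
Proof.
move=> yp Dy; rewrite /Hgap (Hpmf_fin _ _ yp Dy) (Hlsc_fin _ _ yp Dy) -EFinB /hlsc.
by congr (_%:E); ring.
Qed.

Lemma derive_Hgap (alpha : R) (y : nat -> R) (s mu : R) : ell1_pos y -> Dtot y = s%:E ->
  is_derive mu 1 (fun m : R => fine (Hgap a alpha y m))
    (Num.max 0 (mu + alpha - a * s) / a).
Proof.
move=> yp Dy; apply: (@is_derive_sandwich _ _ _ _ (2 * a)^-1) => h.
rewrite !(HgapE _ _ yp Dy)/=.
have -> : mu + h + alpha - a * s = mu + alpha - a * s + h by ring.
set t := mu + alpha - a * s.
have -> : Num.max 0 t / a * h = (2 * a)^-1 * (2 * Num.max 0 t * h).
  by field; rewrite gt_eqF.
rewrite -mulrBr -mulrDr !ler_pM2l ?invr_gt0 ?mulr_gt0//.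
have := sqr_ge0 h; have := sqr_ge0 t; have := sqr_ge0 (t + h).
by case: (leP 0 t) => ?; case: (leP 0 (t + h)) => ? *; apply/andP; split; nra.
Qed.

(** The critical density is the density of the untilted weights. For [d <= 2] it is a Riemann series
    of exponent [d / 2 <= 1], whose divergence matches the value [+oo]. *)
Lemma rho_cE : rho_c d beta = Dxi d beta 0.
Proof.
have e j : j.+1%:R * xi 0 j =
    (4 * pi * beta) `^ (- (d%:R / 2)) * j.+1%:R `^ (- (d%:R / 2)).
  rewrite xi0 /qfree mulr0 mul0r expR0 mul1r powRD; last by apply/implyP.
  rewrite powRr1// !powRN; field.
  by rewrite !gt_eqF ?powR_gt0// !mulr_gt0// ?pi_gt0.
have c0 : 0 < (4 * pi * beta) `^ (- (d%:R / 2)) :> R.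
  by rewrite powR_gt0// !mulr_gt0// ?pi_gt0.
have De : Dxi d beta 0 = (((4 * pi * beta) `^ (- (d%:R / 2)))%:E * zeta (d%:R / 2))%E.
  rewrite /Dxi /zeta -nneseriesZl; last by move=> j _; rewrite lee_fin powR_ge0.
  by apply: eq_eseriesr => j _; rewrite e EFinM.
rewrite /rho_c; case: ifPn => // d3; rewrite De.
suff -> : zeta (d%:R / 2) = +oo%E :> \bar R by rewrite gt0_muley// lte_fin.
apply/eqP/negPn/negP; rewrite -ltey => zoo.
apply: (@dvg_riemannR R (d%:R / 2)).
  rewrite divr_ge0//= ler_pdivrMr// mul1r ler_nat; move: d3.
  by rewrite -ltnNge.
have := nnseries_is_cvg _ zoo; under [X in cvgn (series X)]eq_fun do rewrite powRN.
by apply => j; exact: powR_ge0.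
Qed.

(** On the condensate branch the multiplier is 0, so [s] is the critical density and [c = m / a]. On
    the normal branch [c = s] lies below the critical density by monotonicity in the multiplier, and
    everything vanishes. *)
Lemma crit_excess m c s : crit m c s ->
  [/\ pos_part (c%:E - rho_c d beta) = (c - s)%:E,
      pos_part ((m / a)%:E - rho_c d beta) = (c - s)%:E
    & Num.max 0 (m - a * s) / a = c - s].
Proof.
move=> [mc Ds sc /eqP]; rewrite mulf_eq0 => /orP[|] /eqP e.
  have em : m = a * c by lra.
  have cs : 0 <= c - s by rewrite subr_ge0.
  have em' : m / a = c by rewrite em mulrC mulKf ?gt_eqF.
  have D0 : Dxi d beta 0 = s%:E by rewrite -e.
  rewrite rho_cE D0 em' -EFinB /pos_part -EFin_max max_l//; split => //.
  have ac : 0 <= a * (c - s) by rewrite mulr_ge0 ?(ltW a0).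
  have -> : m - a * s = a * (c - s) by rewrite em; ring.
  rewrite max_r//.
  by field; rewrite gt_eqF.
have ec : s = c by lra.
have rc : (c%:E <= rho_c d beta)%E.
  rewrite rho_cE -ec -Ds; apply: lee_nneseries => j *; rewrite lee_fin ?kxi_ge0//.
  by rewrite ler_wpM2l// xi_decr// subr_ge0.
have pp x : x <= c -> pos_part (x%:E - rho_c d beta) = 0%E.
  move=> xc; rewrite /pos_part; apply/max_idPr; rewrite sube_le0.
  by rewrite (le_trans _ rc)// lee_fin.
rewrite ec subrr !pp//; last by rewrite ler_pdivrMr// mulrC.
split => //; rewrite max_l ?mul0r//; lra.
Qed.

End pressure.

(** * Poisson laws and the PMF measure *)

Section density_integral.
Context (d : measure_display) (T : measurableType d) (R : realType).
Variables (m : {measure set T -> \bar R}) (w : T -> \bar R).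
Hypotheses (mw : measurable_fun [set: T] w) (w0 : forall x, (0 <= w x)%E).
Hypothesis wfin : forall x, w x \is a fin_num.

Import HBNNSimple.
Local Open Scope ereal_scope.

Let density_nnsfun (E : set T) (h : {nnsfun T >-> R}) : measurable E ->
  \int[density m mw w0]_(x in E) (h x)%:E = \int[m]_(x in E) ((h x)%:E * w x).
Proof.
move=> mE.
have mw' : measurable_fun E w by exact: measurable_funTS.
transitivity (\int[density m mw w0]_(x in E)
   (\sum_(y \in range h) (y * \1_(h @^-1` [set y]) x)%:E)).
  by apply: eq_integral => t tE; rewrite fimfunE -fsumEFin.
have indich r : measurable_fun E (fun x => (r * \1_(h @^-1` [set r]) x)%:E).
  by apply: (measurable_comp measurableT) => //; exact: measurable_funM.
rewrite ge0_integral_fsum//; last by move=> r y Ey; exact: nnfun_muleindic_ge0.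
transitivity (\int[m]_(x in E) (\sum_(y \in range h)
    (y * \1_(h @^-1` [set y]) x)%:E * w x)); last first.
  apply: eq_integral => x xE.
  rewrite -ge0_mule_fsuml => [|y]; last exact: nnfun_muleindic_ge0.
  by rewrite fsumEFin // -(fimfunE _ x).
rewrite ge0_integral_fsum//; last 2 first.
  - by move=> y; exact: emeasurable_funM.
  - by move=> ? y Ey; rewrite mule_ge0 ?w0// nnfun_muleindic_ge0.
apply: eq_fsbigr => r rhn.
under eq_integral do rewrite EFinM.
rewrite integralZl_indic_nnsfun => //.
under [RHS]eq_integral do rewrite EFinM -muleA.
rewrite ge0_integralZl//.
- under [in RHS]eq_integral do rewrite muleC.
  rewrite [in RHS](eq_integral (w \_ (h @^-1` [set r]))); last first.
    by move=> x xE; rewrite epatch_indic.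
  by rewrite -integral_mkcondr integral_indic// setIC.
- by apply: emeasurable_funM => //; exact/measurable_EFinP.
- by move=> x _; rewrite mule_ge0.
- by move: rhn; rewrite inE => -[x _ <-]; rewrite lee_fin.
Qed.

Lemma ge0_integral_density (E : set T) (f : T -> \bar R) : measurable E ->
  measurable_fun E f -> (forall x, E x -> 0 <= f x) ->
  \int[density m mw w0]_(x in E) f x = \int[m]_(x in E) (f x * w x).
Proof.
move=> mE mf f0.
pose h := nnsfun_approx mE mf.
have mh n : measurable_fun E (EFin \o h n).
  by apply/measurable_EFinP; apply: (measurable_funS measurableT).
have -> : \int[density m mw w0]_(x in E) f x =
    lim (\int[density m mw w0]_(x in E) (EFin \o h n) x @[n --> \oo]).
  have fE x : E x -> f x = lim ((EFin \o h n) x @[n --> \oo]).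
    by move=> Ex; apply/esym/cvg_lim => //; exact: cvg_nnsfun_approx.
  under eq_integral => x /[!inE] /fE -> //.
  apply: monotone_convergence => //.
  - by move=> n x Ex //=; rewrite lee_fin.
  - by move=> x Ex a b ab; rewrite lee_fin; exact/lefP/nd_nnsfun_approx.
have -> : \int[m]_(x in E) (f x * w x) =
    lim (\int[m]_(x in E) ((EFin \o h n) \* w) x @[n --> \oo]).
  have fg x : E x -> f x * w x = lim (((EFin \o h n) \* w) x @[n --> \oo]).
    by move=> Ex; apply/esym/cvg_lim => //; apply: cvgeZr;
      [exact: wfin|exact: cvg_nnsfun_approx].
  under eq_integral => x /[!inE] /fg -> //.
  apply: monotone_convergence => [//| | |].
  - by move=> n; apply/emeasurable_funM => //; exact/measurable_funTS.
  - by move=> n x Ex /=; rewrite mule_ge0 ?lee_fin.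
  - by move=> x Ex a b ab/=; rewrite lee_wpmul2r ?lee_fin//; exact/lefP/nd_nnsfun_approx.
by apply/congr_lim/funext => n; exact: density_nnsfun.
Qed.

End density_integral.

Section poisson_point_probabilities.
Variables (R : realType) (rate : nat -> R) (V : R) (nu : probability (seqs R) R).
Hypotheses (V0 : 0 < V) (rate0 : forall j, 0 <= rate j).
Hypothesis nuP : poisson_law rate V nu.

Definition ppmf (r : R) (k : nat) : R := r ^+ k / k`!%:R * expR (- r).

Lemma ppmf_ge0 r k : 0 <= r -> 0 <= ppmf r k.
Proof. by move=> r0; rewrite !mulr_ge0// exprn_ge0. Qed.

(** The rate 0 occurs for cycle lengths beyond [N]; the law is then the Dirac mass at 0, in
    agreement with [ppmf 0]. *)
Lemma poisson_prob_set1 r k : 0 <= r -> poisson_prob r 0 [set k] = (ppmf r k)%:E.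
Proof.
rewrite /poisson_prob le_eqVlt => /predU1P[<-|r0].
  rewrite ltxx /= diracE /ppmf oppr0 expR0 mulr1; case: k => [|k].
    by rewrite fact0 expr0 divr1 mem_set.
  by rewrite expr0n/= mul0r memNset.
rewrite r0 esum_set1; last by rewrite lee_fin poisson_pmf_ge0.
by rewrite /poisson_pmf r0.
Qed.

Lemma sum_ppmf_expR r s M : 0 <= r ->
  \sum_(k < M) expR (s * k%:R) * ppmf r k <= expR (r * expR s - r).
Proof.
move=> r0; rewrite expRD.
have -> : \sum_(k < M) expR (s * k%:R) * ppmf r k =
   (\sum_(k < M) (r * expR s) ^+ k / k`!%:R) * expR (- r).
  rewrite mulr_suml; apply: eq_bigr => k _.
  by rewrite /ppmf expRM_natr exprMn; ring.
rewrite ler_pM2r ?expR_gt0//.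
rewrite -lee_fin; have z0 : 0 <= r * expR s by rewrite mulr_ge0// expR_ge0.
have -> : (expR (r * expR s))%:E = (\sum_(k <oo) ((r * expR s) ^+ k / k`!%:R)%:E)%E.
  apply/esym/cvg_nnseries.
  rewrite (_ : (fun n => _) = series (exp_coeff (r * expR s))).
    exact: is_cvg_series_exp_coeff.
  by apply/funext => n; rewrite /series/= big_mkord.
by apply: nnseries_ge => k; rewrite divr_ge0// exprn_ge0.
Qed.

Definition cyl (M : nat) (n : nat -> nat) : set (seqs R) :=
  [set x | forall j, (j < M)%N -> (x : nat -> R) j = (n j)%:R / V].

Lemma measurable_coord_eq j (c : R) :
  measurable ([set x | (x : nat -> R) j = c] : set (seqs R)).
Proof.
have := @measurable_coord R j measurableT [set c] (measurable_set1 c).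
by rewrite setTI.
Qed.

Lemma measurable_cyl M n : measurable (cyl M n).
Proof.
have -> : cyl M n = \bigcap_(j in [set j | (j < M)%N])
    [set x : seqs R | (x : nat -> R) j = (n j)%:R / V].
  by apply/seteqP; split => x /= h j /h.
by apply: bigcap_measurableType => j _; exact: measurable_coord_eq.
Qed.

Lemma nu_cyl M n : nu (cyl M n) = (\prod_(j < M) ppmf (rate j) (n j))%:E.
Proof.
have [dW [W [P [Nk [ind dist nuE]]]]] := nuP.
rewrite nuE; last exact: measurable_cyl.
have -> : [set w | cyl M n (fun j => (Nk j w)%:R / V)] =
    \bigcap_(j in [set` iota 0 M]) ((fun w => Nk j w) @^-1` [set n j]).
  apply/seteqP; split => w /= h j.
    rewrite /= mem_iota add0n => /= /h /(divIf _) e; apply/eqP; rewrite -(eqr_nat R).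
    by apply/eqP/e; rewrite gt_eqF.
  by move=> jM; rewrite (h j)//= mem_iota add0n.
rewrite (ind _ (fun j => [set n j]))//; last by rewrite iota_uniq.
rewrite -prodEFin -(big_mkord xpredT (fun j => (ppmf (rate j) (n j))%:E)).
rewrite /index_iota subn0; apply: eq_bigr => j _.
by rewrite -poisson_prob_set1// -dist.
Qed.

Definition lattice : set (seqs R) :=
  [set x | forall j, exists n : nat, (x : nat -> R) j = n%:R / V].

Lemma measurable_lattice : measurable lattice.
Proof.
have -> : lattice = \bigcap_j \bigcup_(n : nat) [set x : seqs R | (x : nat -> R) j = n%:R / V].
  apply/seteqP; split => x h j; first by move=> _; have [n hn] := h j; exists n.
  by have [n _ hn] := h j Logic.I; exists n.
apply: bigcap_measurableType => j _; apply: bigcup_measurable => n _.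
exact: measurable_coord_eq.
Qed.

Lemma nu_latticeC : nu (~` lattice) = 0%E.
Proof.
have [dW [W [P [Nk [ind dist nuE]]]]] := nuP.
rewrite nuE; last exact: measurableC measurable_lattice.
rewrite (_ : [set w | _] = set0) ?measure0//; apply/seteqP; split => // w h.
by apply: h => j; exists (Nk j w).
Qed.

Lemma integral_lattice (f : seqs R -> \bar R) : measurable_fun [set: seqs R] f ->
  (forall x, 0 <= f x)%E -> (\int[nu]_x f x = \int[nu]_(x in lattice) f x)%E.
Proof.
move=> mf f0.
have mL := measurable_lattice.
have -> : (\int[nu]_(x in lattice) f x = \int[nu]_(x in setT `\` ~` lattice) f x)%E.
  by rewrite setTD setCK.
by apply: ge0_negligible_integral => //; [exact: measurableC|exact: nu_latticeC].
Qed.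

Definition atom (n : nat -> nat) : set (seqs R) :=
  [set x | forall j, (x : nat -> R) j = (n j)%:R / V].

Lemma measurable_atom n : measurable (atom n).
Proof.
have -> : atom n = \bigcap_j [set x : seqs R | (x : nat -> R) j = (n j)%:R / V].
  by apply/seteqP; split => x /= h j; [move=> _|have := h j Logic.I].
by apply: bigcap_measurableType => j _; exact: measurable_coord_eq.
Qed.

(** The atom is a decreasing limit of cylinders. Coordinates from [M] on are 0 and contribute only
    [exp (- rate j)], which is absorbed in [exp (- rinf)]. *)
Lemma nu_atom_ge n M rinf : (forall j, (M <= j)%N -> n j = 0%N) ->
  (forall m, \sum_(j < m) rate j <= rinf) ->
  ((expR (- rinf) * \prod_(j < M) (rate j ^+ n j / (n j)`!%:R))%:E <= nu (atom n))%E.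
Proof.
move=> nM rle.
have capE : \bigcap_m cyl m n = atom n.
  apply/seteqP; split => x h.
    by move=> j; apply: (h j.+1 Logic.I).
  by move=> m _ j _; exact: h.
have cv : (nu \o (fun m => cyl m n)) @ \oo --> nu (\bigcap_m cyl m n).
  apply: nonincreasing_cvg_mu.
  - by rewrite (le_lt_trans (probability_le1 _ _)) ?ltry//; exact: measurable_cyl.
  - by move=> m; exact: measurable_cyl.
  - by rewrite capE; exact: measurable_atom.
  - move=> m m' mm'; apply/subsetPset => x h j jm; apply: h.
    exact: leq_trans jm mm'.
rewrite -capE -(cvg_lim _ cv)//; apply: lime_ge; first by apply/cvg_ex; eexists; exact: cv.
near=> m; rewrite /= nu_cyl lee_fin.
have Mm : (M <= m)%N by near: m; exact: nbhs_infty_ge.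
rewrite /ppmf [leRHS]big_split/= [leLHS]mulrC; apply: ler_pM => //.
- by apply: prodr_ge0 => j _; rewrite divr_ge0// exprn_ge0.
- by rewrite -(subnKC Mm) big_split_ord/= [X in _ * X]big1 ?mulr1// => j _;
    rewrite nM ?leq_addr// expr0 divr1.
- by rewrite -expR_sum ler_expR sumrN lerN2; exact: rle.
Unshelve. all: by end_near. Qed.

End poisson_point_probabilities.

Lemma le_limn_einf (R : realType) (u v : (\bar R)^nat) :
  (\forall n \near \oo, (u n <= v n)%E) -> (limn_einf u <= limn_einf v)%E.
Proof.
move=> [N _ uv]; rewrite !limn_einf_lim.
apply: lee_lim; [exact: is_cvg_einfs|exact: is_cvg_einfs|].
near=> n; apply: le_ereal_inf_tmp => _ [k /= nk <-].
apply: (@le_trans _ _ (u k)); first by apply: ereal_inf_lbound; exists k.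
apply: uv => /=; apply: leq_trans nk; near: n; exact: nbhs_infty_ge.
Unshelve. all: by end_near. Qed.

(** * Exponential moments of Poisson sequences *)

Section exponential_moment.
Variables (R : realType) (rate : nat -> R) (V : R) (nu : probability (seqs R) R).
Hypotheses (V0 : 0 < V) (rate0 : forall j, 0 <= rate j).
Hypothesis nuP : poisson_law rate V nu.
Variables (s : nat -> R) (kap : R).

Definition ord_ext (M K : nat) (phi : {ffun 'I_M -> 'I_K}) (j : nat) : nat :=
  if insub j is Some i then phi i else 0%N.

Lemma ord_extE M K (phi : {ffun 'I_M -> 'I_K}) (i : 'I_M) : ord_ext phi i = phi i.
Proof. by rewrite /ord_ext valK. Qed.

(* Truncating both the number of coordinates and their values makes the
   moment a finite sum over cylinders. *)
Definition trunc_exp (M : nat) (x : seqs R) : \bar R :=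
  (\sum_(phi : {ffun 'I_M -> 'I_M.+1})
     (expR (kap + \sum_(j < M) s j * (phi j)%:R))%:E *
     (\1_(cyl V M (ord_ext phi)) x)%:E)%E.

Let mindic M (phi : {ffun 'I_M -> 'I_M.+1}) (D : set (seqs R)) :
  measurable_fun D (fun x => (\1_(cyl V M (ord_ext phi)) x)%:E : \bar R).
Proof.
apply: measurable_funTS; apply/measurable_EFinP.
exact: measurable_indic (measurable_cyl _ _ _).
Qed.

Lemma trunc_exp_ge0 M x : (0 <= trunc_exp M x)%E.
Proof.
by apply: sume_ge0 => phi _; rewrite mule_ge0// lee_fin ?expR_ge0.
Qed.

Lemma measurable_trunc_exp M D : measurable_fun D (trunc_exp M).
Proof.
apply: emeasurable_sum => phi; apply: emeasurable_funM => //; exact: mindic.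
Qed.

Lemma integral_trunc_exp_le M :
  (\int[nu]_(x in lattice V) trunc_exp M x <=
   (expR (kap + \sum_(j < M) rate j * expR (s j) - \sum_(j < M) rate j))%:E)%E.
Proof.
have mL := @measurable_lattice R V.
rewrite ge0_integral_sum//; last first.
  by move=> phi; apply: emeasurable_funM => //; exact: mindic.
apply: (@le_trans _ _ (\sum_(phi : {ffun 'I_M -> 'I_M.+1})
     (expR kap * \prod_(j < M) (expR (s j * (phi j)%:R) * ppmf (rate j) (phi j)))%:E)%E).
  apply: lee_sum => phi _.
  rewrite ge0_integralZl_EFin//.
  rewrite integral_indic//; last exact: measurable_cyl.
  rewrite big_split/= -expR_sum mulrA -expRD EFinM lee_pmul2l ?lte_fin ?expR_gt0//.
  apply: (@le_trans _ _ (nu (cyl V M (ord_ext phi)))).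
    by apply: le_measure; rewrite ?inE//; [apply: measurableI => //|];
      exact: measurable_cyl.
  rewrite (nu_cyl V0 rate0 nuP) lee_fin; apply: ler_prod => j _.
  by rewrite ord_extE lexx ppmf_ge0.
rewrite sumEFin lee_fin -mulr_sumr -(bigA_distr_bigA
  (fun (j : 'I_M) (k : 'I_M.+1) => expR (s j * k%:R) * ppmf (rate j) k)).
rewrite -addrA expRD ler_pM2l ?expR_gt0// -sumrB expR_sum; apply: ler_prod => j _.
rewrite sum_ppmf_expR// andbT; apply: sumr_ge0 => k _.
by rewrite mulr_ge0 ?expR_ge0// ppmf_ge0.
Qed.

Lemma trunc_exp_ge (x : nat -> R) (L : nat) M : lattice V x ->
  (forall j, V * x j <= L%:R) -> (L <= M)%N ->
  ((expR (kap + \sum_(j < M) s j * (V * x j)))%:E <= trunc_exp M x)%E.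
Proof.
move=> /choice[n xn] xL LM.
have nE j : (n j)%:R = V * x j by rewrite xn mulrC divfK// gt_eqF.
have nM j : (n j < M.+1)%N.
  by rewrite ltnS -(ler_nat R) nE (le_trans (xL j))// ler_nat.
pose phi := [ffun j : 'I_M => Ordinal (nM j)].
rewrite /trunc_exp (bigD1 phi)//=; apply: (@le_trans _ _
  ((expR (kap + \sum_(j < M) s j * (phi j)%:R))%:E *
     (\1_(cyl V M (ord_ext phi)) x)%:E)%E); last first.
  rewrite leeDl//; apply: sume_ge0 => psi _.
  by rewrite mule_ge0// lee_fin ?expR_ge0.
rewrite indicE mem_set ?mule1; last first.
  by move=> j jM; rewrite (_ : j = Ordinal jM)// ord_extE ffunE/= xn.
rewrite lee_fin ler_expR lerD2l; apply: ler_sum => j _.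
by rewrite ffunE/= nE.
Qed.

(** Fatou's lemma replaces an infinite product: [G] lies below the lower limit of the truncations,
    whose integrals factor over coordinates. The bound [L] on the counts makes the truncation of
    their values harmless once [M >= L]. *)
Lemma exp_moment (B rinf : R) (G : seqs R -> \bar R) :
  measurable_fun [set: seqs R] G -> (forall x, 0 <= G x)%E ->
  (forall x : seqs R, lattice V x -> G x = 0%E \/
     exists (L : nat) (l : R), [/\ forall j, V * (x : nat -> R) j <= L%:R,
      (fun M => \sum_(j < M) s j * (V * (x : nat -> R) j)) @ \oo --> l
      & (G x <= (expR (kap + l))%:E)%E]) ->
  (forall M, \sum_(j < M) rate j * expR (s j) <= B) ->
  (fun M => \sum_(j < M) rate j) @ \oo --> rinf ->
  (\int[nu]_x G x <= (expR (kap + B - rinf))%:E)%E.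
Proof.
move=> mG G0 HG HB Hr; rewrite (integral_lattice nuP)//.
have mL := @measurable_lattice R V.
apply: (@le_trans _ _ (\int[nu]_(x in lattice V) limn_einf (trunc_exp ^~ x))%E).
  apply: ge0_le_integral => //.
  - exact: measurable_funTS.
  - rewrite /limn_einf; apply: measurableT_comp => //.
    apply: measurable_fun_limn_esup => n; apply: measurableT_comp => //.
    exact: measurable_trunc_exp.
  - move=> x Lx; have [->|[L [l [xL xl Gx]]]] := HG x Lx.
      rewrite -(cvg_limn_einf_sup (cvg_cst (0 : \bar R)%E)).1.
      by apply: le_limn_einf; apply: nearW => n; exact: trunc_exp_ge0.
    apply: (le_trans Gx).
    have cv : (fun M => (expR (kap + \sum_(j < M) s j * (V * (x : nat -> R) j)))%:E)
        @ \oo --> (expR (kap + l))%:E.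
      apply: cvg_EFin; first exact: nearW.
      apply: (@cvg_comp _ _ _ _ expR); last exact: continuous_expR.
      by apply: cvgD => //; exact: cvg_cst.
    rewrite -(cvg_limn_einf_sup cv).1; apply: le_limn_einf; near=> M.
    by apply: (trunc_exp_ge Lx xL); near: M; exact: nbhs_infty_ge.
apply: le_trans (fatou _ mL _ _) _.
- by move=> n; exact: measurable_trunc_exp.
- by move=> n x _; exact: trunc_exp_ge0.
have cv : (fun M => (expR (kap + B - \sum_(j < M) rate j))%:E)
    @ \oo --> (expR (kap + B - rinf))%:E.
  apply: cvg_EFin; first exact: nearW.
  apply: (@cvg_comp _ _ _ _ expR); last exact: continuous_expR.
  by apply: cvgB => //; exact: cvg_cst.
rewrite -(cvg_limn_einf_sup cv).1; apply: le_limn_einf; apply: nearW => M.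
apply: (le_trans (integral_trunc_exp_le M)).
by rewrite lee_fin ler_expR lerD2r lerD2l.
Unshelve. all: by end_near. Qed.

End exponential_moment.

Lemma measurable_expeR (R : realType) : measurable_fun [set: \bar R] (@expeR R).
Proof.
have -> : @expeR R = (fun x : \bar R => if (x < +oo)%E then
    if (-oo < x)%E then (expR (fine x))%:E else 0%E else +oo%E).
  by apply/funext => -[r| |] //=; rewrite ?ltry ?ltNyr ?ltxx// ltNyy.
apply: measurable_fun_ifT => //; first exact: measurable_fun_lte.
apply: measurable_fun_ifT => //; first exact: measurable_fun_lte.
by apply/measurable_EFinP; apply: measurableT_comp => //; exact: measurableT_comp.
Qed.

(* Jensen's inequality for the tilted measure [w dm], obtained from
   [1 + y <= exp y] so that only integrals of nonnegative functions occur. *)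
Section exponential_jensen.
Context (d : measure_display) (T : measurableType d) (R : realType).
Variables (m : {measure set T -> \bar R}) (w X : T -> \bar R) (Z : R).
Hypotheses (mw : measurable_fun [set: T] w) (w0 : forall x, (0 <= w x)%E).
Hypotheses (mX : measurable_fun [set: T] X) (X0 : forall x, (0 <= X x)%E).
Hypothesis wfin : forall x, w x \is a fin_num.
Hypothesis wX : forall x, w x = 0%E \/ X x \is a fin_num.
Hypotheses (Z0 : 0 < Z) (wZ : (\int[m]_x w x = Z%:E)%E).

Let mG tau : measurable_fun [set: T] (fun x => w x * expeR (tau%:E * X x))%E.
Proof.
apply: emeasurable_funM => //; apply: measurableT_comp; first exact: measurable_expeR.
exact: measurable_funeM.
Qed.

Let G0 tau x : (0 <= w x * expeR (tau%:E * X x))%E.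
Proof. by rewrite mule_ge0// expeR_ge0. Qed.

Let mWX : measurable_fun [set: T] (fun x => w x * X x)%E.
Proof. exact: emeasurable_funM. Qed.

Let WX0 x : (0 <= w x * X x)%E.
Proof. exact: mule_ge0. Qed.

Lemma exp_jensen_upper tau kap : 0 < tau ->
  (\int[m]_x (w x * expeR (tau%:E * X x)) <= (expR kap * Z)%:E)%E ->
  (\int[m]_x (w x * X x) <= (kap * Z / tau)%:E)%E.
Proof.
move=> tau0 GZ.
(* Since [tau X >= 0], the left side of the hypothesis is at least [Z]. *)
have kap0 : 0 <= kap.
  rewrite leNgt -expR_lt1 -leNgt -(ler_pM2r Z0) mul1r -lee_fin; apply: le_trans GZ.
  rewrite -wZ; apply: ge0_le_integral => // x _.
  rewrite -[leLHS]mule1 lee_wpmul2l// -expeR0 lee_expeR ?mule_ge0//.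
  by rewrite lee_fin ltW.
(* This is [1 + y <= exp y] at [y = tau X - kap], multiplied by [w], with the negative term moved to
   the other side. *)
have : (\int[m]_x (w x + tau%:E * (w x * X x)) <=
        \int[m]_x ((expR (- kap))%:E * (w x * expeR (tau%:E * X x)) + kap%:E * w x))%E.
  apply: ge0_le_integral => //.
  - by move=> x _; rewrite adde_ge0// mule_ge0 ?lee_fin ?(ltW tau0).
  - by apply: emeasurable_funD => //; exact: measurable_funeM.
  - by apply: emeasurable_funD; exact: measurable_funeM.
  - move=> x _; have [->|Xf] := wX x; first by rewrite !mul0e !mule0 adde0.
    rewrite -(fineK Xf) -(fineK (wfin x)) -!EFinM -?EFinD lee_fin.
    have w0' : 0 <= fine (w x) by rewrite fine_ge0.
    have := expR_ge1Dx (tau * fine (X x) - kap); rewrite expRD.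
    move/(ler_wpM2l w0'); lra.
rewrite ge0_integralD//; last 2 first.
  - by move=> x _; rewrite mule_ge0 ?lee_fin ?(ltW tau0).
  - exact: measurable_funeM.
rewrite ge0_integralZl_EFin ?(ltW tau0)//.
rewrite [leRHS]ge0_integralD//; last 4 first.
  - by move=> x _; rewrite mule_ge0// lee_fin expR_ge0.
  - exact: measurable_funeM.
  - by move=> x _; rewrite mule_ge0.
  - exact: measurable_funeM.
rewrite !ge0_integralZl_EFin ?expR_ge0// wZ -EFinM.
move=> H; have {H} : (Z%:E + tau%:E * \int[m]_x (w x * X x) <= Z%:E + (kap * Z)%:E)%E.
  apply: (le_trans H); rewrite leeD2r//.
  apply: (@le_trans _ _ ((expR (- kap))%:E * (expR kap * Z)%:E)%E).
    by rewrite lee_wpmul2l// lee_fin expR_ge0.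
  by rewrite -EFinM mulrA -expRD addNr expR0 mul1r.
rewrite leeD2lE// => H.
by rewrite mulrC EFinM lee_pdivlMl.
Qed.

Lemma exp_jensen_lower tau kap : 0 < tau ->
  (\int[m]_x (w x * expeR ((- tau)%:E * X x)) <= (expR (- kap) * Z)%:E)%E ->
  ((kap * Z / tau)%:E <= \int[m]_x (w x * X x))%E.
Proof.
move=> tau0 GZ; have [kap0|kap0] := ltP kap 0.
  apply: (@le_trans _ _ 0%E); last exact: integral_ge0.
  by rewrite lee_fin pmulr_lle0 ?invr_gt0// pmulr_lle0// ltW.
have : (\int[m]_x (w x + kap%:E * w x) <=
        \int[m]_x ((expR kap)%:E * (w x * expeR ((- tau)%:E * X x)) + tau%:E * (w x * X x)))%E.
  apply: ge0_le_integral => //.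
  - by move=> x _; rewrite adde_ge0// mule_ge0.
  - by apply: emeasurable_funD => //; exact: measurable_funeM.
  - by apply: emeasurable_funD; exact: measurable_funeM.
  - move=> x _; have [->|Xf] := wX x; first by rewrite !mul0e !mule0 adde0.
    rewrite -(fineK Xf) -(fineK (wfin x)) -!EFinM -?EFinD lee_fin.
    have w0' : 0 <= fine (w x) by rewrite fine_ge0.
    have := expR_ge1Dx (- tau * fine (X x) + kap); rewrite expRD.
    move/(ler_wpM2l w0'); lra.
rewrite ge0_integralD//; last 2 first.
  - by move=> x _; rewrite mule_ge0.
  - exact: measurable_funeM.
rewrite ge0_integralZl_EFin// wZ.
rewrite [leRHS]ge0_integralD//; last 4 first.
  - by move=> x _; rewrite mule_ge0// lee_fin expR_ge0.
  - exact: measurable_funeM.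
  - by move=> x _; rewrite mule_ge0// lee_fin ltW.
  - exact: measurable_funeM.
rewrite !ge0_integralZl_EFin ?expR_ge0 ?(ltW tau0)// -EFinM.
move=> H; have {H} : (Z%:E + (kap * Z)%:E <= Z%:E + tau%:E * \int[m]_x (w x * X x))%E.
  apply: (le_trans H); rewrite leeD2r//.
  apply: (@le_trans _ _ ((expR kap)%:E * (expR (- kap) * Z)%:E)%E).
    by rewrite lee_wpmul2l// lee_fin expR_ge0.
  by rewrite -EFinM mulrA -expRD subrr expR0 mul1r.
rewrite leeD2lE// => H.
by rewrite mulrC EFinM lee_pdivrMl.
Qed.

End exponential_jensen.

(** * Bounds for the weighted Poisson law in finite volume *)

Section pmf_bounds.
Variables (R : realType) (d : nat) (a beta mu : R) (N : nat).
Hypotheses (a0 : 0 < a) (beta0 : 0 < beta).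
Notation V := (vol R d N).
Hypothesis V0 : 0 < V.
Notation w := (boltzmann d a beta mu N).

Lemma boltzmann_in (x : seqs R) (s : R) : ell1_pos x -> Dtot x = s%:E ->
  w x = (expR (V * beta * (mu * s - a / 2 * s ^+ 2)))%:E.
Proof.
move=> xp Dx; rewrite /boltzmann (Hpmf_fin _ _ xp Dx)/=.
by congr (expR _)%:E; ring.
Qed.

Lemma boltzmann_out (x : seqs R) : ~ (ell1_pos x /\ (Dtot x < +oo)%E) -> w x = 0%E.
Proof.
move=> nx; rewrite /boltzmann /Hpmf; case: ifPn => [/andP[/set_mem xp Dx]|_].
  by case: nx.
by rewrite gt0_muley ?lte_fin ?mulr_gt0.
Qed.

Lemma ell1_pos_Dtot (x : nat -> R) : ell1_pos x -> (Dtot x < +oo)%E ->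
  exists s, [/\ Dtot x = s%:E, 0 <= s & (fun n => \sum_(j < n) j.+1%:R * x j) @ \oo --> s].
Proof.
move=> [_ x0] Dx; have Df : Dtot x \is a fin_num.
  by apply: nnseries_fin => // j; rewrite mulr_ge0.
exists (fine (Dtot x)); split; first by rewrite fineK.
  by apply: fine_ge0; exact: Dtot_ge0.
by apply: (@nnseries_cvg _ (fun j => j.+1%:R * x j)) => [j|];
  [rewrite mulr_ge0|rewrite fineK].
Qed.

Lemma boltzmann_cases (x : seqs R) : w x = 0%E \/
  exists s, [/\ ell1_pos x, Dtot x = s%:E, 0 <= s,
     (fun n => \sum_(j < n) j.+1%:R * (x : nat -> R) j) @ \oo --> s
     & w x = (expR (V * beta * (mu * s - a / 2 * s ^+ 2)))%:E].
Proof.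
have [[xp Dx]|/boltzmann_out] := pselect (ell1_pos x /\ (Dtot x < +oo)%E); last by left.
right; have [s [Ds s0 cs]] := ell1_pos_Dtot xp Dx.
by exists s; split => //; exact: boltzmann_in.
Qed.

Lemma boltzmann_fin x : w x \is a fin_num.
Proof. by have [->|[s [_ _ _ _ ->]]] := boltzmann_cases x. Qed.

Definition excess_coef (K j : nat) : R := if (j < K)%N then 0 else j.+1%:R.

Lemma excess_coef_ge0 K j : 0 <= excess_coef K j.
Proof. by rewrite /excess_coef; case: ifP. Qed.

(** The absolute values make the functional nonnegative and measurable on all sequences; on the cone
    it agrees with [Dtot - Dcut K]. *)
Definition excess (K : nat) (x : seqs R) : \bar R :=
  (\sum_(j <oo) (excess_coef K j * `|(x : nat -> R) j|)%:E)%E.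

Lemma measurable_excess K : measurable_fun [set: seqs R] (excess K).
Proof. by apply: measurable_pos_sum => j; exact: excess_coef_ge0. Qed.

Lemma excess_ge0 K x : (0 <= excess K x)%E.
Proof.
by apply: nneseries_ge0 => j _ _; rewrite lee_fin mulr_ge0// excess_coef_ge0.
Qed.

Lemma excessE K (x : seqs R) : ell1_pos x ->
  (Dtot x - (Dcut K x)%:E)%E = excess K x.
Proof.
move=> [_ x0]; rewrite /Dtot (nneseries_split 0%N K); last first.
  by move=> k _; rewrite lee_fin mulr_ge0.
rewrite add0n big_mkord sumEFin addeAC -EFinB subrr add0e.
rewrite ereal_series eseries_mkcond; apply: eq_eseriesr => j _.
by rewrite /excess_coef ltnNge; case: ifP => _ /=; rewrite ?mul0r// ger0_norm.
Qed.

Lemma mean_excessE (nu : nat -> probability (seqs R) R) (K : nat) (Z : R) :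
  0 < Z -> (\int[nu N]_x w x = Z%:E)%E ->
  mean_excess d a beta mu nu K N = (Z^-1%:E * \int[nu N]_x (w x * excess K x))%E.
Proof.
move=> Z0 wZ; rewrite /mean_excess.
have mE := @measurable_ell1_pos R.
pose dens := density (nu N) (measurable_boltzmann d a beta mu N) (boltzmann_ge0 d a beta mu N).
have densT : dens setT = Z%:E by rewrite -wZ.
have Zi : 0 <= Z^-1 by rewrite invr_ge0 ltW.
pose sdens : {measure set (seqs R) -> \bar R} := mscale (NngNum Zi) dens.
rewrite (eq_measure_integral sdens); last first.
  (* The mass [Z] is neither 0 nor infinite, so the fallback of [mnormalize] does not occur. *)
  move=> A mA _; have e : nu_pmf d a beta mu N (nu N) A =
      (if (Z%:E == 0)%E || (Z%:E == +oo)%E then nu N A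
       else dens A * (fine Z%:E)^-1%:E)%E.
    by rewrite -densT /nu_pmf/= /mnormalize; case: ifP.
  by apply: (etrans e); rewrite /= eqe gt_eqF//= muleC.
transitivity (\int[sdens]_(x in @ell1_pos R) excess K x)%E.
  apply: (@eq_integral _ _ _ _ (@ell1_pos R : set (seqs R)) (excess K)) => x.
  by move=> /set_mem xp; exact: excessE.
have mex : measurable_fun (@ell1_pos R : set (seqs R)) (excess K).
  by apply: measurable_funTS; exact: measurable_excess.
rewrite /sdens ge0_integral_mscale//; last by move=> x _; exact: excess_ge0.
rewrite ge0_integral_density//; [|exact: boltzmann_fin|by move=> x _; exact: excess_ge0].
congr (_ * _)%E; rewrite integral_mkcond; apply: eq_integral => x _.
rewrite patchE; case: ifPn => [_|xp]; first by rewrite muleC.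
rewrite boltzmann_out ?mul0e// => -[/mem_set xp' _].
by move: xp; rewrite xp'.
Qed.

Section with_law.
Variables (nu : probability (seqs R) R) (rate : nat -> R) (rinf : R).
Hypotheses (rate0 : forall j, 0 <= rate j) (nuP : poisson_law rate V nu).
Hypothesis (rateinf : (fun n => \sum_(j < n) rate j) @ \oo --> rinf).

Lemma sum_rate_le n : \sum_(j < n) rate j <= rinf.
Proof.
rewrite -lee_fin -(cvg_nnseries rateinf).
exact: nnseries_ge.
Qed.

(** Coefficient of [V x_j] in the exponent after the energy has been linearised at [c] and
    [V beta t (D - D_K)] has been added. *)
Definition tilt_coef (c t : R) (K j : nat) : R :=
  beta * j.+1%:R * (mu - a * c + (if (j < K)%N then 0 else t)).

(* The quadratic energy is bounded by its tangent at [c]. *)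
Lemma tilted_moment_le (c t B : R) (K : nat) :
  (forall M, \sum_(j < M) rate j * expR (tilt_coef c t K j) <= V * B) ->
  (\int[nu]_x (w x * expeR ((V * beta * t)%:E * excess K x)) <=
   (expR (V * (beta * (a / 2) * c ^+ 2) + V * B - rinf))%:E)%E.
Proof.
move=> HB; apply: (exp_moment V0 rate0 nuP _ _ _ HB rateinf).
- apply: emeasurable_funM; first exact: measurable_boltzmann.
  apply: measurableT_comp; first exact: measurable_expeR.
  by apply: measurable_funeM; exact: measurable_excess.
- by move=> x; rewrite mule_ge0 ?boltzmann_ge0 ?expeR_ge0.
move=> x _; have [->|[s [xp Ds s0 cs wx]]] := boltzmann_cases x.
  by left; rewrite mul0e.
right; exists (Num.bound (V * s)), (V * beta * ((mu - a * c + t) * s - t * Dcut K x)).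
have x0 := xp.2; split.
- move=> j; apply: le_trans (ltW (archi_boundP _)); last by rewrite mulr_ge0// ltW.
  rewrite ler_pM2l//; apply: le_trans (_ : j.+1%:R * (x : nat -> R) j <= _).
    by rewrite ler_peMl// ler1n.
  rewrite -lee_fin -Ds; apply: le_trans (nnseries_ge j.+1 _).
    by rewrite lee_fin big_ord_recr/= lerDr; apply: sumr_ge0 => i _; rewrite mulr_ge0.
  by move=> i; rewrite mulr_ge0.
- have cv : (fun M => V * beta * ((mu - a * c + t) * (\sum_(j < M) j.+1%:R * (x : nat -> R) j)
      - t * Dcut K x)) @ \oo --> V * beta * ((mu - a * c + t) * s - t * Dcut K x).
    by apply: cvgMr; apply: cvgB; [exact: cvgMr|exact: cvg_cst].
  apply: cvg_trans cv; apply: near_eq_cvg; near=> M.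
  have KM : (K <= M)%N by near: M; exact: nbhs_infty_ge.
  have -> : \sum_(j < M) tilt_coef c t K j * (V * (x : nat -> R) j) =
     \sum_(j < M) (V * beta * ((mu - a * c + t) * (j.+1%:R * (x : nat -> R) j))
       - V * beta * (t * (if (j < K)%N then j.+1%:R * (x : nat -> R) j else 0))).
    apply: eq_bigr => j _; rewrite /tilt_coef; case: ifP => _; ring.
  rewrite sumrB -!mulr_sumr -mulrBr; congr (_ * (_ - t * _)).
  rewrite -big_mkcond/= /Dcut (big_ord_widen _ (fun j => j.+1%:R * (x : nat -> R) j) KM).
  by [].
rewrite wx -excessE// Ds -EFinB -EFinM /= lee_fin -expRD ler_expR.
rewrite -subr_ge0.
have := mulr_ge0 (ltW V0) (mulr_ge0 (ltW beta0) (mulr_ge0 (ltW a0) (sqr_ge0 (s - c)))).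
by lra.
Unshelve. all: by end_near. Qed.

Lemma partition_ge (n : nat -> nat) (M : nat) (D : R) :
  (forall j, (M <= j)%N -> n j = 0%N) ->
  D = \sum_(j < M) j.+1%:R * ((n j)%:R / V) ->
  ((expR (V * beta * (mu * D - a / 2 * D ^+ 2) - rinf) *
    \prod_(j < M) (rate j ^+ n j / (n j)`!%:R))%:E <= \int[nu]_x w x)%E.
Proof.
move=> nM DE; have mA := measurable_atom V n.
pose x : nat -> R := fun j => (n j)%:R / V.
have cvx (f : nat -> R) : (fun m => \sum_(j < m) f j * x j) @ \oo -->
    \sum_(j < M) f j * x j.
  apply: cvg_near_cst; near=> m.
  have Mm : (M <= m)%N by near: m; exact: nbhs_infty_ge.
  rewrite -(subnKC Mm) big_split_ord/= [X in _ + X]big1 ?addr0// => j _.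
  by rewrite /x nM ?leq_addr// mul0r mulr0.
have x0 j : 0 <= x j by rewrite divr_ge0// ltW.
have xp : ell1_pos x.
  split => //; rewrite /ell1/=.
  have -> : (\sum_(j <oo) `|x j|%:E)%E = (\sum_(j < M) 1 * x j)%:E.
    rewrite -(@cvg_nnseries _ (fun j => 1 * x j) _ (cvx (fun=> 1))); apply: eq_eseriesr => j _.
    by rewrite mul1r ger0_norm.
  exact: ltry.
have Dx : Dtot x = D%:E.
  by rewrite DE; exact: (@cvg_nnseries _ (fun j => j.+1%:R * x j) _ (cvx (fun j => j.+1%:R))).
have atomE : atom V n = [set x].
  by apply/seteqP; split => [y yn|y ->//]; apply/funext => j; exact: yn.
have := nu_atom_ge V0 rate0 nuP nM sum_rate_le.
move=> /(lee_wpmul2l (boltzmann_ge0 d a beta mu N x)).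
rewrite (boltzmann_in xp Dx) -EFinM mulrA -expRD => /le_trans; apply.
rewrite -[leLHS](_ : \int[nu]_y ((w x) * (\1_(atom V n) y)%:E) = _)%E; last first.
  rewrite (boltzmann_in xp Dx) ge0_integralZl_EFin ?expR_ge0//.
    by rewrite integral_indic// setIT.
  by apply/measurable_EFinP; exact: measurable_indic.
apply: ge0_le_integral => //.
- by move=> y _; rewrite mule_ge0 ?boltzmann_ge0.
- apply: emeasurable_funM => //.
  by apply/measurable_EFinP; exact: measurable_indic.
- exact: measurable_boltzmann.
move=> y _; rewrite indicE; case: (boolP (y \in _)) => [/set_mem|_]; last first.
  by rewrite mule0 boltzmann_ge0.
by rewrite atomE => ->; rewrite mule1.
Unshelve. all: by end_near. Qed.

End with_law.
End pmf_bounds.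

Section real_estimates.
Variable R : realType.

(** Here [exp y (1 - y) <= exp y exp (- y) = 1], while the polynomial times [1 - y] is
    [1 + y ^ 2 (1 - 2 y)]; hence the restriction on [y]. *)
Lemma expR_le_quadratic (y : R) : y <= 2^-1 -> expR y <= 1 + y + 2 * y ^+ 2.
Proof.
move=> y2; have h := expR_ge1Dx (- y).
have p : 0 < 1 - y by lra.
rewrite -(ler_pM2r p); apply: (@le_trans _ _ 1).
  by rewrite -[leRHS](expRxMexpNx_1 y) ler_pM2l ?expR_gt0.
have -> : (1 + y + 2 * y ^+ 2) * (1 - y) = 1 + y ^+ 2 * (1 - 2 * y) by ring.
by rewrite lerDl mulr_ge0 ?sqr_ge0//; lra.
Qed.

Lemma ln_le_sqrt (x : R) : 0 < x -> ln x <= 2 * Num.sqrt x.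
Proof.
move=> x0; have -> : ln x = 2 * ln (Num.sqrt x).
  by rewrite mulr_natl -lnXn ?sqrtr_gt0// sqr_sqrtr// ltW.
rewrite ler_pM2l//.
by apply/ltW/ln_sublinear; rewrite sqrtr_gt0.
Qed.

(** Stirling's upper bound with a logarithmic error, negligible after division by the volume. The
    induction proves it with [ln n] for [n >= 1]; [ln n.+1] also covers [n = 0]. *)
Lemma ln_fact_le (n : nat) :
  ln n`!%:R <= n%:R * ln n%:R - n%:R + ln n.+1%:R + 1 :> R.
Proof.
case: n => [|n]; first by rewrite fact0 ln1; lra.
apply: (@le_trans _ _ (n.+1%:R * ln n.+1%:R - n.+1%:R + ln n.+1%:R + 1)); last first.
  by rewrite lerD2r lerD2l ler_ln ?posrE// ler_nat.
elim: n => [|n IH]; first by rewrite ln1; lra.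
rewrite factS natrM lnM ?posrE ?ltr0n ?fact_gt0//.
have h : ln n.+1%:R - ln n.+2%:R <= - n.+2%:R^-1 :> R.
  rewrite -ln_div ?posrE//; have -> : n.+1%:R / n.+2%:R = 1 + - n.+2%:R^-1 :> R.
    have -> : n.+1%:R = n.+2%:R - 1 :> R by rewrite -[n.+2%:R]natr1 addrK.
    by rewrite mulrBl divff ?pnatr_eq0// mul1r.
  by apply: le_ln1Dx; rewrite ltrN2 invf_lt1// ltr1n.
have : n.+2%:R * (ln n.+1%:R - ln n.+2%:R) <= -1 :> R.
  have := ler_wpM2l (ler0n R n.+2) h.
  by rewrite mulrN divff// pnatr_eq0.
have -> : n.+2%:R = n.+1%:R + 1 :> R by rewrite natr1.
lra.
Qed.

Lemma cvg_invn : (fun n : nat => n%:R^-1 : R) @ \oo --> (0 : R).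
Proof.
apply/cvgrVy; last by rewrite /unstable.inv_fun; under eq_fun do rewrite invrK; exact: cvgr_idn.
by near=> n; rewrite invr_gt0 ltr0n; near: n; exact: nbhs_infty_gt.
Unshelve. all: by end_near. Qed.

Lemma cvg_inv_sqrt : (fun n : nat => (Num.sqrt n%:R)^-1 : R) @ \oo --> (0 : R).
Proof.
have h : (fun n : nat => Num.sqrt (n%:R^-1) : R) @ \oo --> Num.sqrt (0 : R).
  by apply: (@cvg_comp _ _ _ _ Num.sqrt); [exact: cvg_invn|exact: sqrt_continuous].
rewrite sqrtr0 in h; apply: cvg_trans h; apply: near_eq_cvg; apply: nearW => n.
by rewrite sqrtrV.
Qed.

Lemma ereal_cvg_dist (u : (\bar R)^nat) (l : R) :
  (forall e, 0 < e -> \forall n \near \oo, ((l - e)%:E <= u n <= (l + e)%:E)%E) ->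
  u @ \oo --> l%:E.
Proof.
move=> H; apply/fine_cvgP; split.
  have := H 1 ltr01; apply: filterS => n /andP[h1 h2].
  by rewrite fin_numElt (lt_le_trans (ltNyr _) h1) (le_lt_trans h2 (ltry _)).
apply/cvgrPdist_le => e e0; have := H e e0; apply: filterS => n /=.
case: (u n) => [r| |] /andP[]; rewrite ?lee_fin ?leye_eq ?leeNy_eq//= => h1 h2.
by rewrite ler_distlC; apply/andP; split; lra.
Qed.

Lemma vol_ge (d N : nat) : (0 < d)%N -> N%:R <= vol R d N.
Proof.
move=> d0; rewrite /vol; case: N => [|N]; first by rewrite exprn_ge0// mulr0.
apply: (@le_trans _ _ (2 * N.+1%:R)); first by rewrite ler_peMl// ler1n.
by rewrite -[leLHS]expr1 ler_eXn2l// -natrM ltr1n mul2n -addnn addnS.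
Qed.

Lemma vol_gt0 (d N : nat) : (0 < N)%N -> 0 < vol R d N.
Proof. by move=> N0; rewrite exprn_gt0// mulr_gt0// ltr0n. Qed.

Lemma cvg_inv_vol (d : nat) : (0 < d)%N -> (fun N => (vol R d N)^-1) @ \oo --> (0 : R).
Proof.
move=> d0; apply: (squeeze_cvgr _ (cvg_cst 0) cvg_invn); near=> N.
have N0 : (0 < N)%N by near: N; exact: nbhs_infty_gt.
rewrite invr_ge0 (ltW (vol_gt0 _ N0))/= lef_pV2 ?posrE ?ltr0n ?vol_gt0//.
exact: vol_ge.
Unshelve. all: by end_near. Qed.

End real_estimates.

Lemma cvg_sum_ord (R : realType) (f : nat -> nat -> R) (l : nat -> R) n :
  (forall j, f j @ \oo --> l j) ->
  (fun N => \sum_(j < n) f j N) @ \oo --> \sum_(j < n) l j.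
Proof.
move=> fl; elim: n => [|n IH].
  by under eq_fun do rewrite big_ord0; rewrite big_ord0; exact: cvg_cst.
under eq_fun do rewrite big_ord_recr/=.
by rewrite big_ord_recr/=; exact: cvgD.
Qed.

(** * Convergence of the condensate density *)

Section thermodynamic_limit.
Variables (R : realType) (d : nat) (a beta mu alpha : R).
Hypotheses (d0 : (0 < d)%N) (a0 : 0 < a) (beta0 : 0 < beta) (alpha0 : alpha <= 0).
Variables (c s : R).
Hypothesis crit0 : crit d beta a (mu + alpha) c s.
Notation lam := (a * c - (mu + alpha)).
Notation x_ := (xi d beta lam).
Notation Wl := (W d beta lam).
Notation qa := (qfree d beta alpha).

Let lam0 : 0 <= lam. Proof. by have [h _ _ _] := crit0; rewrite subr_ge0. Qed.

Let x_gt0 j : 0 < x_ j. Proof. exact: xi_gt0. Qed.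

(** Exponential growth rate of the partition function once the total Poisson rate [rinf] has been
    added back. *)
Definition limit_pressure : R := beta * (a / 2 * c ^+ 2) + Wl.

Let cvg_Wl : (fun n => \sum_(j < n) x_ j) @ \oo --> Wl.
Proof.
by apply: nnseries_cvg => [j|]; [exact/ltW|exact: W_EFin].
Qed.

Let cvg_s : (fun n => \sum_(j < n) j.+1%:R * x_ j) @ \oo --> s.
Proof.
have [_ Ds _ _] := crit0.
by apply: (@nnseries_cvg _ (fun j => j.+1%:R * x_ j)) => [j|//]; exact: kxi_ge0.
Qed.

Let sum_kx_le n : \sum_(j < n) j.+1%:R * x_ j <= s.
Proof.
have [_ Ds _ _] := crit0; rewrite -lee_fin -Ds; exact: Dxi_ge.
Qed.

Let sc : s <= c. Proof. by case: crit0. Qed.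

Let s0 : 0 <= s. Proof. by have := sum_kx_le 0; rewrite big_ord0. Qed.

Let qaE j : qa j = x_ j * expR (beta * j.+1%:R * (a * c - mu)).
Proof. by rewrite [LHS]qfreeE /xi -[RHS]mulrA -expRD; congr (_ * expR _); ring. Qed.

(* The mass missing from the first [M] cycle lengths is concentrated on cycles
   of length [M.+1]; this costs no entropy in the limit. *)
Definition last_mass (M : nat) : R :=
  (c - \sum_(j < M) j.+1%:R * x_ j) / M.+1%:R.

Lemma last_mass_ge M : x_ M <= last_mass M.
Proof.
rewrite /last_mass ler_pdivlMr// mulrC lerBrDl.
by apply: le_trans sc; have := sum_kx_le M.+1; rewrite big_ord_recr.
Qed.

Let peak : R := (4 * pi * beta) `^ (d%:R / 2).

Let peak_gt0 : 0 < peak.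
Proof. by rewrite powR_gt0// !mulr_gt0// ?pi_gt0. Qed.

Let ln_x j : - ln (x_ j) = ln peak + (1 + d%:R / 2) * ln j.+1%:R + beta * lam * j.+1%:R.
Proof.
rewrite /xi lnM ?posrE ?expR_gt0 ?qfree_gt0// expRK /qfree mulr0 mul0r expR0 mul1r.
have k0 : 0 < j.+1%:R `^ (1 + d%:R / 2) :> R by rewrite powR_gt0.
rewrite -/peak lnV ?posrE; last exact: mulr_gt0.
have Lk : ln (j.+1%:R `^ (1 + d%:R / 2)) = (1 + d%:R / 2) * ln j.+1%:R :> R.
  by rewrite ln_powR.
rewrite lnM ?posrE// Lk.
by move: (ln peak) (ln _) => P L; ring.
Qed.

(** The last mass is at most [c / (M + 1) <= 1], so its entropy is at most
    [last_mass M * (- ln (x_ M))]. Here [- ln (x_ M)] is [beta lam (M + 1)] plus a logarithm. The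
    first part gives the first term, which tends to 0 by complementary slackness; the logarithm is
    bounded by a square root and divided by [M + 1]. *)
Lemma ent_last_mass_le M : c <= M.+1%:R ->
  ent (last_mass M) (x_ M) <=
    beta * (lam * (c - \sum_(j < M) j.+1%:R * x_ j)) +
    c * (`|ln peak| + 2 + d%:R) * (Num.sqrt M.+1%:R)^-1.
Proof.
move=> cM; have r0 : 0 < last_mass M by exact: lt_le_trans (x_gt0 M) (last_mass_ge M).
have c0 : 0 <= c by exact: le_trans sc.
have k0 : 0 < M.+1%:R :> R by rewrite ltr0n.
have rc : last_mass M <= c / M.+1%:R.
  by rewrite ler_pM2r ?invr_gt0// gerBl; apply: sumr_ge0 => j _; exact: kxi_ge0.
rewrite /ent ln_div ?posrE//.
have lr : ln (last_mass M) <= 0.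
  by apply: ln_le0; apply: (le_trans rc); rewrite ler_pdivrMr// mul1r.
have rge := last_mass_ge M.
apply: (@le_trans _ _ (last_mass M * (- ln (x_ M)))).
  by have := mulr_ge0_le0 (ltW r0) lr; lra.
rewrite ln_x mulrDr addrC; apply: lerD.
  have -> : last_mass M * (beta * lam * M.+1%:R) = beta * (lam * (last_mass M * M.+1%:R)).
    by ring.
  by rewrite /last_mass divfK ?pnatr_eq0.
set k : R := M.+1%:R in k0 rc *.
have sk : 0 < Num.sqrt k by rewrite sqrtr_gt0.
have sk1 : 1 <= Num.sqrt k by rewrite -sqrtr1 ler_wsqrtr// ler1n.
have kk : k = Num.sqrt k ^+ 2 by rewrite sqr_sqrtr// ltW.
have d2 : 0 <= 1 + d%:R / 2 :> R by rewrite addr_ge0// divr_ge0.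
apply: (@le_trans _ _ (last_mass M * ((`|ln peak| + 2 + d%:R) * Num.sqrt k))).
  rewrite ler_pM2l//.
  have h1 : (1 + d%:R / 2) * ln k <= (1 + d%:R / 2) * (2 * Num.sqrt k).
    by rewrite ler_wpM2l// ln_le_sqrt.
  have h2 : ln peak <= `|ln peak| * Num.sqrt k.
    by apply: (le_trans (ler_norm _)); rewrite ler_peMr.
  lra.
apply: (@le_trans _ _ (c / k * ((`|ln peak| + 2 + d%:R) * Num.sqrt k))).
  by rewrite ler_wpM2r// mulr_ge0 ?addr_ge0// ltW.
rewrite {1}kk le_eqVlt; apply/orP; left; apply/eqP; field.
by rewrite gt_eqF.
Qed.

Lemma ent_last_mass_small e : 0 < e -> \forall M \near \oo,
  ent (last_mass M) (x_ M) <= e.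
Proof.
move=> e0; have [_ _ _ slack] := crit0.
have cv : (fun M => beta * (lam * (c - \sum_(j < M) j.+1%:R * x_ j)) +
    c * (`|ln peak| + 2 + d%:R) * (Num.sqrt M.+1%:R)^-1) @ \oo --> (0 : R).
  have lim0 : beta * (lam * (c - s)) + c * (`|ln peak| + 2 + d%:R) * 0 = 0.
    by rewrite slack !mulr0 addr0.
  rewrite -[X in _ --> X]lim0.
  apply: cvgD.
    by apply: cvgMr; apply: cvgMr; apply: cvgB; [exact: cvg_cst|exact: cvg_s].
  apply: cvgMr; by have := @cvg_inv_sqrt R; rewrite -cvg_shiftS.
near=> M; apply: le_trans (ent_last_mass_le _) _.
  have : (Num.bound c <= M)%N by near: M; exact: nbhs_infty_ge.
  rewrite -(ler_nat R) => h; apply: ltW.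
  apply: (lt_le_trans (archi_boundP _)); first exact: le_trans sc.
  by apply: (le_trans h); rewrite ler_nat.
near: M; move/cvgrPdist_le : cv => /(_ e e0).
by apply: filterS => M; rewrite sub0r normrN; exact: le_trans (ler_norm _).
Unshelve. all: by end_near. Qed.

Definition recovery (M j : nat) : R := if (j < M)%N then x_ j else last_mass M.

Lemma recovery_gt0 M j : 0 < recovery M j.
Proof.
rewrite /recovery; case: ifP => // _.
exact: lt_le_trans (x_gt0 M) (last_mass_ge M).
Qed.

Lemma sum_recovery M (f : nat -> R -> R) :
  \sum_(j < M.+1) f j (recovery M j) = \sum_(j < M) f j (x_ j) + f M (last_mass M).
Proof.
rewrite big_ord_recr/= {2}/recovery ltnn; congr (_ + _).
by apply: eq_bigr => j _; rewrite /recovery ltn_ord.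
Qed.

Lemma density_recovery M : \sum_(j < M.+1) j.+1%:R * recovery M j = c.
Proof.
rewrite (sum_recovery M (fun j r => j.+1%:R * r)) /last_mass [_ * (_ / _)]mulrC.
by rewrite divfK ?pnatr_eq0// addrC subrK.
Qed.

(** The recovery sequence has density exactly [c], so the tangent bound of the energy is an
    equality, and it agrees with the minimiser below [M]. Only the entropy of the last coordinate is
    lost. *)
Lemma recovery_value M :
  beta * (mu * c - a / 2 * c ^+ 2) +
   \sum_(j < M.+1) (recovery M j * ln (qa j) - recovery M j * ln (recovery M j) +
     recovery M j)
  = beta * (a / 2 * c ^+ 2) + \sum_(j < M.+1) x_ j - ent (last_mass M) (x_ M).
Proof.
have lnq j : ln (qa j) = ln (x_ j) + beta * j.+1%:R * (a * c - mu).
  by rewrite qaE lnM ?posrE ?expR_gt0// expRK.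
have -> : \sum_(j < M.+1)
    (recovery M j * ln (qa j) - recovery M j * ln (recovery M j) + recovery M j)
  = \sum_(j < M.+1) (recovery M j * ln (x_ j) - recovery M j * ln (recovery M j) + recovery M j)
    + beta * (a * c - mu) * \sum_(j < M.+1) j.+1%:R * recovery M j.
  rewrite mulr_sumr -big_split/=; apply: eq_bigr => j _; rewrite lnq; ring.
rewrite density_recovery.
rewrite (sum_recovery M (fun j r => r * ln (x_ j) - r * ln r + r)).
rewrite [X in _ = _ + X - _]big_ord_recr/=.
have -> : \sum_(j < M) (x_ j * ln (x_ j) - x_ j * ln (x_ j) + x_ j) = \sum_(j < M) x_ j.
  by apply: eq_bigr => j _; rewrite subrr add0r.
have r0 : 0 < last_mass M by exact: lt_le_trans (x_gt0 M) (last_mass_ge M).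
rewrite /ent ln_div ?posrE//.
by move: (ln (x_ M)) (ln (last_mass M)) (\sum_(_ < _) _) (last_mass M) (x_ M) => *; field.
Qed.

Lemma recovery_value_ge e : 0 < e -> \forall M \near \oo, limit_pressure - e <=
  beta * (mu * c - a / 2 * c ^+ 2) +
   \sum_(j < M.+1) (recovery M j * ln (qa j) - recovery M j * ln (recovery M j) + recovery M j).
Proof.
move=> e0; near=> M; rewrite recovery_value /limit_pressure.
have h1 : ent (last_mass M) (x_ M) <= e / 2.
  by near: M; apply: ent_last_mass_small; rewrite divr_gt0.
have h2 : Wl - e / 2 <= \sum_(j < M) x_ j.
  near: M; have e2 : 0 < e / 2 by rewrite divr_gt0.
  move/cvgrPdist_le : cvg_Wl => /(_ _ e2); apply: filterS => M.
  by rewrite ler_distlC => /andP[].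
have h3 : 0 <= x_ M by exact/ltW.
rewrite big_ord_recr/=; lra.
Unshelve. all: by end_near. Qed.

Lemma cvg_trunc_vol (r : R) : 0 <= r ->
  (fun N => (Num.truncn (vol R d N * r))%:R / vol R d N) @ \oo --> r.
Proof.
move=> r0; apply/cvgrPdist_le => e e0; near=> N.
have N0 : (0 < N)%N by near: N; exact: nbhs_infty_gt.
have V0 := vol_gt0 R d N0.
have Vr : 0 <= vol R d N * r by rewrite mulr_ge0// ltW.
have /andP[t1 t2] := truncn_itv Vr.
have Ve : (vol R d N)^-1 <= e.
  near: N; move/cvgrPdist_le : (@cvg_inv_vol R d d0) => /(_ e e0).
  by apply: filterS => N; rewrite sub0r normrN; exact: le_trans (ler_norm _).
have h1 : (Num.truncn (vol R d N * r))%:R / vol R d N <= r.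
  by rewrite ler_pdivrMr// [r * _]mulrC.
have h2 : r <= (Num.truncn (vol R d N * r))%:R / vol R d N + (vol R d N)^-1.
  by rewrite -[X in _ <= _ + X]mul1r -mulrDl ler_pdivlMr// [r * _]mulrC natr1 ltW.
rewrite ler_distl; apply/andP; split; lra.
Unshelve. all: by end_near. Qed.

Lemma cvg_ln_trunc_vol (r : R) : 0 <= r ->
  (fun N => (ln (Num.truncn (vol R d N * r)).+1%:R + 1) / vol R d N) @ \oo --> 0.
Proof.
move=> r0; pose B (N : nat) : R := 2 * Num.sqrt ((r + 1) * (vol R d N)^-1) + (vol R d N)^-1.
have cB : B @ \oo --> 0.
  have lim0 : 2 * Num.sqrt ((r + 1) * 0) + 0 = 0 :> R by rewrite mulr0 sqrtr0 mulr0 addr0.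
  rewrite -[X in _ --> X]lim0; apply: cvgD; last exact: cvg_inv_vol.
  apply: cvgMr; apply: (@cvg_comp _ _ _ _ Num.sqrt); last exact: sqrt_continuous.
  by apply: cvgMr; exact: cvg_inv_vol.
apply: (squeeze_cvgr _ (cvg_cst 0) cB); near=> N.
have N0 : (0 < N)%N by near: N; exact: nbhs_infty_gt.
have V0 := vol_gt0 R d N0.
have V1 : 1 <= vol R d N by apply: le_trans (vol_ge R N d0); rewrite ler1n.
have Vr : 0 <= vol R d N * r by rewrite mulr_ge0// ltW.
have /andP[t1 _] := truncn_itv Vr.
set n := Num.truncn _ in t1 *.
apply/andP; split.
  by rewrite divr_ge0 ?(ltW V0)// addr_ge0// ln_ge0// ler1n.
rewrite mulrDl mul1r lerD2r ler_pdivrMr//.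
apply: le_trans (ln_le_sqrt _) _ => //; rewrite -mulrA ler_pM2l//.
rewrite -[X in _ <= _ * X](sqr_sqrtr (ltW V0)) expr2 mulrA -sqrtrM; last first.
  by rewrite mulr_ge0 ?invr_ge0 ?(ltW V0)// addr_ge0.
rewrite divfK ?gt_eqF// -sqrtrM ?addr_ge0// ler_wsqrtr// -natr1 mulrDl mul1r.
by rewrite [r * _]mulrC; apply: lerD.
Unshelve. all: by end_near. Qed.

Lemma poisson_weight_ge (V q : R) (n : nat) : 0 < V -> 0 < q ->
  expR (V * (n%:R / V * ln q - n%:R / V * ln (n%:R / V) + n%:R / V)
        - (ln n.+1%:R + 1)) <= (V * q) ^+ n / n`!%:R.
Proof.
move=> V0 q0; have Vq : 0 < V * q by rewrite mulr_gt0.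
have -> : (V * q) ^+ n / n`!%:R = expR (n%:R * ln (V * q) - ln n`!%:R).
  rewrite expRB expRM_natl lnK ?posrE// lnK// posrE ltr0n fact_gt0//.
rewrite ler_expR; apply: (@le_trans _ _ (n%:R * ln (V * q) -
   (n%:R * ln n%:R - n%:R + ln n.+1%:R + 1))); last by rewrite lerB ?ln_fact_le.
rewrite le_eqVlt; apply/orP; left; apply/eqP.
case: n => [|n]; first by rewrite !mul0r; ring.
rewrite ln_div ?posrE// lnM ?posrE//.
by move: (ln V) (ln q) (ln n.+1%:R) (ln n.+2%:R) => *; field; rewrite gt_eqF.
Qed.

Section law.
Variables (qN : nat -> nat -> R) (C : nat -> R) (nu : nat -> probability (seqs R) R).
Hypotheses (qN0 : forall N j, 0 <= qN N j).
Hypothesis qNC : forall N j, (0 < N)%N -> qN N j <= C N * qa j.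
Hypothesis C1 : C @ \oo --> (1 : R).
Hypothesis qN_cvg : forall j, qN ^~ j @ \oo --> qa j.
Hypothesis nuP : forall N, (0 < N)%N ->
  poisson_law (fun j => vol R d N * qN N j) (vol R d N) (nu N).

Definition recovery_count (M N j : nat) : nat :=
  if (j < M.+1)%N then Num.truncn (vol R d N * recovery M j) else 0%N.

Lemma cvg_recovery_count M j : (j < M.+1)%N ->
  (fun N => (recovery_count M N j)%:R / vol R d N) @ \oo --> recovery M j.
Proof.
move=> jM; rewrite /recovery_count jM; apply: cvg_trunc_vol.
exact/ltW/recovery_gt0.
Qed.

(** After multiplication by the volume and subtraction of [rinf], a lower bound for the logarithm of
    the Boltzmann weight times the probability of one configuration; the last term of the sum is the
    Stirling error. *)
Definition atom_exponent (M N : nat) : R :=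
  beta * (mu * (\sum_(j < M.+1) j.+1%:R * ((recovery_count M N j)%:R / vol R d N))
    - a / 2 * (\sum_(j < M.+1) j.+1%:R * ((recovery_count M N j)%:R / vol R d N)) ^+ 2) +
  \sum_(j < M.+1) ((recovery_count M N j)%:R / vol R d N * ln (qN N j)
    - (recovery_count M N j)%:R / vol R d N * ln ((recovery_count M N j)%:R / vol R d N)
    + (recovery_count M N j)%:R / vol R d N
    - (ln (recovery_count M N j).+1%:R + 1) / vol R d N).

Lemma cvg_atom_exponent M : atom_exponent M @ \oo -->
  beta * (mu * c - a / 2 * c ^+ 2) +
   \sum_(j < M.+1) (recovery M j * ln (qa j) - recovery M j * ln (recovery M j) + recovery M j).
Proof.
have cD : (fun N => \sum_(j < M.+1) j.+1%:R * ((recovery_count M N j)%:R / vol R d N))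
    @ \oo --> c.
  rewrite -[X in _ --> X](density_recovery M).
  pose f j N : R := if (j < M.+1)%N then j.+1%:R * ((recovery_count M N j)%:R / vol R d N) else 0.
  pose l j : R := if (j < M.+1)%N then j.+1%:R * recovery M j else 0.
  have := @cvg_sum_ord R f l M.+1.
  under eq_fun do under eq_bigr do rewrite /f ltn_ord.
  under [X in _ --> X]eq_bigr do rewrite /l ltn_ord.
  apply=> j; rewrite /f /l; case: ifP => jM; last exact: cvg_cst.
  by apply: cvgMr; exact: cvg_recovery_count.
apply: cvgD.
  apply: cvgMr; apply: cvgB; first exact: cvgMr.
  by apply: cvgMr; under eq_fun do rewrite expr2; rewrite expr2; exact: cvgM.
pose g j N : R := (recovery_count M N j)%:R / vol R d N * ln (qN N j)
    - (recovery_count M N j)%:R / vol R d N * ln ((recovery_count M N j)%:R / vol R d N)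
    + (recovery_count M N j)%:R / vol R d N
    - (ln (recovery_count M N j).+1%:R + 1) / vol R d N.
pose f j N : R := if (j < M.+1)%N then g j N else 0.
pose l j : R := if (j < M.+1)%N then
  recovery M j * ln (qa j) - recovery M j * ln (recovery M j) + recovery M j else 0.
have := @cvg_sum_ord R f l M.+1.
under eq_fun do under eq_bigr do rewrite /f ltn_ord.
under [X in _ --> X]eq_bigr do rewrite /l ltn_ord.
apply=> j; rewrite /f /l /g; case: ifP => jM; last exact: cvg_cst.
have cr := cvg_recovery_count jM.
rewrite -[X in _ --> X]subr0; apply: cvgB; last first.
  by rewrite /recovery_count jM; apply: cvg_ln_trunc_vol; exact/ltW/recovery_gt0.
apply: cvgD => //; apply: cvgB; apply: cvgM => //.
  apply: (@cvg_comp _ _ _ _ (@ln R)); first exact: qN_cvg.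
  by apply: continuous_ln; exact: qfree_gt0.
apply: (@cvg_comp _ _ _ _ (@ln R)); first exact: cr.
by apply: continuous_ln; exact: recovery_gt0.
Qed.

Lemma exists_rate_sum N : (0 < N)%N -> exists rinf : R,
  (fun n => \sum_(j < n) vol R d N * qN N j) @ \oo --> rinf.
Proof.
move=> N0; have V0 := vol_gt0 R d N0.
have u0 j : 0 <= vol R d N * qN N j by rewrite mulr_ge0// ltW.
have ufin : (\sum_(j <oo) (vol R d N * qN N j)%:E)%E \is a fin_num.
  apply: nnseries_fin => //.
  have C0 : 0 <= C N.
    have := le_trans (qN0 N 0) (qNC 0 N0).
    by rewrite pmulr_lge0// qfree_gt0.
  apply: le_lt_trans (ltry (vol R d N * (C N * W d beta 0))).
  apply: nnseries_le => // n; rewrite -mulr_sumr ler_pM2l//.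
  apply: (@le_trans _ _ (\sum_(j < n) C N * qa j)).
    by apply: ler_sum => j _; exact: qNC.
  rewrite -mulr_sumr ler_wpM2l//.
  apply: le_trans (sum_q_le d0 beta0 n); apply: ler_sum => j _.
  rewrite qfreeE ger_pMr ?qfree_gt0// -expR0 ler_expR.
  by rewrite mulr_le0_ge0// mulr_ge0_le0// ltW.
exists (fine (\sum_(j <oo) (vol R d N * qN N j)%:E)%E).
by apply: (@nnseries_cvg _ (fun j => vol R d N * qN N j)) => //; rewrite fineK.
Qed.

Notation w N := (boltzmann d a beta mu N).

Lemma partition_lower e : 0 < e -> \forall N \near \oo,
  forall rinf : R, (fun n => \sum_(j < n) vol R d N * qN N j) @ \oo --> rinf ->
  ((expR (vol R d N * (limit_pressure - e) - rinf))%:E <= \int[nu N]_x w N x)%E.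
Proof.
move=> e0; have e2 : 0 < e / 2 by rewrite divr_gt0.
have [M _ /(_ M (leqnn M)) HM] := recovery_value_ge e2.
near=> N => rinf hr.
have N0 : (0 < N)%N by near: N; exact: nbhs_infty_gt.
have V0 := vol_gt0 R d N0.
have He : limit_pressure - e <= atom_exponent M N.
  have : limit_pressure - e / 2 - e / 2 <= atom_exponent M N.
    apply: (le_trans (lerB HM (lexx _))); near: N.
    move/cvgrPdist_le : (@cvg_atom_exponent M) => /(_ _ e2); apply: filterS => N.
    by rewrite ler_distlC => /andP[].
  lra.
have qpos : forall j : 'I_M.+1, 0 < qN N j.
  near: N; apply: filter_forall => j.
  by apply: (cvgr_gt (qa j)); [exact: qN_cvg|exact: qfree_gt0].
have rate0 j : 0 <= vol R d N * qN N j by rewrite mulr_ge0// ltW.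
have nM j : (M.+1 <= j)%N -> recovery_count M N j = 0%N.
  by move=> Mj; rewrite /recovery_count ltnNge Mj.
have P := partition_ge a beta mu V0 rate0 (nuP N0) hr nM erefl.
apply: (le_trans _ P) => {P}.
rewrite lee_fin.
apply: (@le_trans _ _ (expR (vol R d N * atom_exponent M N - rinf))).
  by rewrite ler_expR lerD2r ler_pM2l.
set D := \sum_(j < M.+1) _.
have -> : vol R d N * atom_exponent M N - rinf =
  (vol R d N * beta * (mu * D - a / 2 * D ^+ 2) - rinf) +
  \sum_(j < M.+1) (vol R d N * ((recovery_count M N j)%:R / vol R d N * ln (qN N j)
    - (recovery_count M N j)%:R / vol R d N * ln ((recovery_count M N j)%:R / vol R d N)
    + (recovery_count M N j)%:R / vol R d N)
    - (ln (recovery_count M N j).+1%:R + 1)).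
  rewrite /atom_exponent -/D mulrDr addrAC; congr (_ + _); first by rewrite mulrA.
  rewrite mulr_sumr; apply: eq_bigr => j _; rewrite mulrBr; congr (_ - _).
  by rewrite mulrC divfK// gt_eqF.
rewrite expRD ler_pM2l ?expR_gt0// expR_sum; apply: ler_prod => j _.
by rewrite expR_ge0 poisson_weight_ge.
Unshelve. all: by end_near. Qed.

Definition perturbed_sum (t : R) (K : nat) : R :=
  \sum_(j < K) x_ j * expR (- (beta * j.+1%:R * t)) + (Wl - \sum_(j < K) x_ j).

Lemma perturbed_sum_ge t K n :
  \sum_(j < n) x_ j * (if (j < K)%N then expR (- (beta * j.+1%:R * t)) else 1)
  <= perturbed_sum t K.
Proof.
pose g j := x_ j * (if (j < K)%N then expR (- (beta * j.+1%:R * t)) else 1).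
have g0 j : 0 <= g j by rewrite mulr_ge0 ?(ltW (x_gt0 j))//; case: ifP; rewrite ?expR_ge0.
apply: (@le_trans _ _ (\sum_(j < K + n) g j)).
  rewrite addnC big_split_ord/= lerDl; exact: sumr_ge0.
have sumW : \sum_(j < K + n) x_ j <= Wl.
  rewrite -lee_fin -(W_EFin d0 beta0 lam0); apply: nnseries_ge => j; exact/ltW.
rewrite big_split_ord/= /perturbed_sum; rewrite big_split_ord/= in sumW.
apply: lerD.
  by apply: ler_sum => j _; rewrite /g ltn_ord.
rewrite lerBrDl; apply: le_trans sumW; rewrite lerD2l; apply: ler_sum => j _.
by rewrite /g ltnNge leq_addr mulr1.
Qed.

Lemma perturbed_sum_le t K : (forall j, (j < K)%N -> - (beta * j.+1%:R * t) <= 2^-1) ->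
  perturbed_sum t K <= Wl - beta * t * (\sum_(j < K) j.+1%:R * x_ j)
    + 2 * beta ^+ 2 * t ^+ 2 * (\sum_(j < K) j.+1%:R ^+ 2 * x_ j).
Proof.
move=> Kt; rewrite /perturbed_sum addrCA -addrA lerD2l addrC !mulr_sumr -!sumrN -!big_split/=.
apply: ler_sum => j _; have := expR_le_quadratic (Kt j (ltn_ord j)).
move/(ler_wpM2l (ltW (x_gt0 j))); lra.
Qed.

(** At the tangent point [c + t / a] the coefficient of cycle index [j] is
    [beta (j + 1) (mu - a c - t)], plus [beta (j + 1) t] when [j >= K]. The part with [mu - a c]
    turns [qa] into [x_]; the two terms in [t] cancel from [K] on. *)
Lemma tilted_rates_le N t K M : (0 < N)%N ->
  \sum_(j < M) vol R d N * qN N j * expR (tilt_coef a beta mu (c + t / a) t K j)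
  <= vol R d N * (C N * perturbed_sum t K).
Proof.
move=> N0; have V0 := vol_gt0 R d N0.
have C0 : 0 <= C N.
  by have := le_trans (qN0 N 0) (qNC 0 N0); rewrite pmulr_lge0// qfree_gt0.
under eq_bigr do rewrite -mulrA.
rewrite -mulr_sumr ler_pM2l//.
apply: le_trans (ler_wpM2l C0 (perturbed_sum_ge t K M)).
rewrite mulr_sumr; apply: ler_sum => j _.
apply: (@le_trans _ _ (C N * qa j * expR (tilt_coef a beta mu (c + t / a) t K j))).
  by rewrite ler_pM2r ?expR_gt0// qNC.
rewrite -mulrA ler_wpM2l// qaE -mulrA -expRD le_eqVlt; apply/orP; left; apply/eqP.
congr (_ * _); rewrite /tilt_coef.
case: ifP => _; first by congr expR; field; rewrite gt_eqF.
by rewrite -expR0; congr expR; field; rewrite gt_eqF.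
Qed.

Lemma partition_upper N t K rinf : (0 < N)%N ->
  (fun n => \sum_(j < n) vol R d N * qN N j) @ \oo --> rinf ->
  (\int[nu N]_x (w N x * expeR ((vol R d N * beta * t)%:E * excess K x)) <=
   (expR (vol R d N * (beta * (a / 2) * (c + t / a) ^+ 2 + C N * perturbed_sum t K)
      - rinf))%:E)%E.
Proof.
move=> N0 hr; have V0 := vol_gt0 R d N0.
have rate0 j : 0 <= vol R d N * qN N j by rewrite mulr_ge0// ltW.
rewrite mulrDr; apply: (tilted_moment_le a0 beta0 V0 rate0 (nuP N0) hr) => M.
exact: tilted_rates_le.
Qed.

(** The linear term in [t] carries the claimed limit of the mean. One [e] stems from [C N], the
    other from the lower bound on the partition function. *)
Lemma excess_bound_gap e t K N : (forall j, (j < K)%N -> - (beta * j.+1%:R * t) <= 2^-1) ->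
  C N * perturbed_sum t K <= perturbed_sum t K + e ->
  beta * (a / 2) * (c + t / a) ^+ 2 + C N * perturbed_sum t K - (limit_pressure - e) <=
  beta * t * (c - \sum_(j < K) j.+1%:R * x_ j) +
    t ^+ 2 * (beta / (2 * a) + 2 * beta ^+ 2 * \sum_(j < K) j.+1%:R ^+ 2 * x_ j) + 2 * e.
Proof.
move=> Kt CN; have := perturbed_sum_le Kt; rewrite /limit_pressure.
have -> : beta * (a / 2) * (c + t / a) ^+ 2 =
  beta * (a / 2 * c ^+ 2) + beta * t * c + t ^+ 2 * (beta / (2 * a)).
  by field; rewrite gt_eqF.
lra.
Qed.

Theorem mean_excess_cvg K :
  mean_excess d a beta mu nu K @ \oo --> (c - \sum_(j < K) j.+1%:R * x_ j)%:E.
Proof.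
apply: ereal_cvg_dist => eps eps0.
pose E2 := beta / (2 * a) + 2 * beta ^+ 2 * \sum_(j < K) j.+1%:R ^+ 2 * x_ j.
have E20 : 0 < E2.
  apply: ltr_pwDl; first by rewrite divr_gt0// mulr_gt0.
  apply: mulr_ge0; first by rewrite mulr_ge0// sqr_ge0.
  by apply: sumr_ge0 => j _; rewrite mulr_ge0 ?sqr_ge0// ltW.
(* The first entry makes the quadratic error [t ^ 2 E2] at most [eps beta t / 2]; the second keeps
   the exponents of the first [K] coordinates below [1 / 2], as the quadratic bound on [exp]
   requires at [- t]. *)
pose t := Num.min (eps * beta / (2 * E2)) (2 * beta * K.+1%:R)^-1.
have t0 : 0 < t.
  by rewrite lt_min divr_gt0 ?mulr_gt0//= invr_gt0 !mulr_gt0.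
have tE : t * E2 <= eps * beta / 2.
  have : t <= eps * beta / (2 * E2) by rewrite ge_min lexx.
  rewrite invfM mulrA ler_pdivlMr//; lra.
have tK j : (j < K)%N -> beta * j.+1%:R * t <= 2^-1.
  move=> jK; have : t <= (2 * beta * K.+1%:R)^-1 by rewrite ge_min lexx orbT.
  rewrite -[leRHS]mul1r ler_pdivlMr ?mulr_gt0// => h.
  have : j.+1%:R <= K.+1%:R :> R by rewrite ler_nat ltnS ltnW.
  move/(ler_wpM2l (ltW (mulr_gt0 t0 beta0))); lra.
have Kp j : (j < K)%N -> - (beta * j.+1%:R * t) <= 2^-1.
  move=> _; apply: (@le_trans _ _ 0); rewrite ?invr_ge0// oppr_le0.
  by rewrite !mulr_ge0// ltW.
have Km j : (j < K)%N -> - (beta * j.+1%:R * - t) <= 2^-1.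
  by move=> jK; rewrite mulrN opprK tK.
(* Then [2 e] is the other half of the allowed error [eps beta t]. *)
pose e := eps * beta * t / 4.
have e0 : 0 < e by rewrite divr_gt0// !mulr_gt0.
have CP t' : \forall N \near \oo, C N * perturbed_sum t' K <= perturbed_sum t' K + e.
  have cC : (fun N => C N * perturbed_sum t' K) @ \oo --> perturbed_sum t' K.
    by rewrite -[X in _ --> X]mul1r; apply: cvgMl.
  move/cvgrPdist_le : cC => /(_ e e0); apply: filterS => N.
  by rewrite ler_distlC => /andP[].
near=> N.
have N0 : (0 < N)%N by near: N; exact: nbhs_infty_gt.
have V0 := vol_gt0 R d N0.
have [rinf hr] := exists_rate_sum N0.
have low : ((expR (vol R d N * (limit_pressure - e) - rinf))%:E <= \int[nu N]_x w N x)%E.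
  by move: rinf hr; near: N; exact: partition_lower.
have up t' := partition_upper t' K N0 hr.
have mw := measurable_boltzmann d a beta mu N.
have mX := @measurable_excess R K.
have wX x : w N x = 0%E \/ excess K x \is a fin_num.
  have [->|[s' [xp Ds _ _ _]]] := boltzmann_cases a mu beta0 V0 x; first by left.
  by right; rewrite -excessE// Ds.
have wfin x : w N x \is a fin_num by exact: boltzmann_fin.
(* Finiteness of the partition function is the upper bound at parameter 0. *)
have zfin : (\int[nu N]_x w N x)%E \is a fin_num.
  rewrite ge0_fin_numE; last by apply: integral_ge0 => x _; exact: boltzmann_ge0.
  apply: le_lt_trans (ltry _); apply: le_trans (up 0); apply: ge0_le_integral => //.
  - by move=> x _; exact: boltzmann_ge0.
  - apply: emeasurable_funM => //; apply: measurableT_comp; first exact: measurable_expeR.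
    exact: measurable_funeM.
  - by move=> x _; rewrite mulr0 mul0e expeR0 mule1.
pose Z := fine (\int[nu N]_x w N x)%E.
have wZ : (\int[nu N]_x w N x = Z%:E)%E by rewrite /Z fineK.
rewrite wZ lee_fin in low.
have Z0 : 0 < Z by apply: lt_le_trans low; exact: expR_gt0.
rewrite (mean_excessE beta0 V0 K Z0 wZ).
set J := (\int[nu N]_x (w N x * excess K x))%E.
have tau0 : 0 < vol R d N * beta * t by rewrite !mulr_gt0.
have jens (kap t' : R) : vol R d N * (beta * (a / 2) * (c + t' / a) ^+ 2 + C N * perturbed_sum t' K
      - (limit_pressure - e)) <= kap ->
    (\int[nu N]_x (w N x * expeR ((vol R d N * beta * t')%:E * excess K x)) <=
     (expR kap * Z)%:E)%E.
  move=> hk; apply: (le_trans (up t')); rewrite lee_fin.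
  apply: (@le_trans _ _ (expR kap * expR (vol R d N * (limit_pressure - e) - rinf))).
    rewrite -expRD ler_expR; lra.
  by rewrite ler_pM2l ?expR_gt0.
set l := c - \sum_(j < K) j.+1%:R * x_ j.
have CPp : C N * perturbed_sum t K <= perturbed_sum t K + e by near: N; exact: CP.
have CPm : C N * perturbed_sum (- t) K <= perturbed_sum (- t) K + e by near: N; exact: CP.
have et : t ^+ 2 * E2 + 2 * e <= eps * beta * t.
  have := ler_wpM2l (ltW t0) tE; rewrite /e; lra.
have gp := excess_bound_gap Kp CPp; rewrite -/E2 -/l in gp.
have gm := excess_bound_gap Km CPm; rewrite -/E2 -/l in gm.
apply/andP; split.
  have h : (vol R d N * beta * t * (l - eps)) * Z / (vol R d N * beta * t) = Z * (l - eps).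
    by field; rewrite !gt_eqF.
  have : ((Z * (l - eps))%:E <= J)%E.
    rewrite -h; apply: (exp_jensen_lower mw (@boltzmann_ge0 _ _ _ _ _ _) mX
      (@excess_ge0 _ K) wfin wX Z0 wZ tau0).
    rewrite -mulrN; apply: jens.
    have -> : - (vol R d N * beta * t * (l - eps)) = vol R d N * - (beta * t * (l - eps)).
      by ring.
    by rewrite ler_pM2l//; apply: (le_trans gm); rewrite sqrrN; lra.
  by rewrite EFinM lee_pdivlMl.
have h : (vol R d N * beta * t * (l + eps)) * Z / (vol R d N * beta * t) = Z * (l + eps).
  by field; rewrite !gt_eqF.
have : (J <= (Z * (l + eps))%:E)%E.
  rewrite -h; apply: (exp_jensen_upper mw (@boltzmann_ge0 _ _ _ _ _ _) mX
    (@excess_ge0 _ K) wfin wX Z0 wZ tau0).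
  apply: jens.
  have -> : vol R d N * beta * t * (l + eps) = vol R d N * (beta * t * (l + eps)) by ring.
  by rewrite ler_pM2l//; apply: (le_trans gp); lra.
by rewrite EFinM lee_pdivrMl.
Unshelve. all: by end_near. Qed.

Theorem condensate_density_cvg :
  condensate_density_exists d a beta mu nu /\
  condensate_density d a beta mu nu = (c - s)%:E.
Proof.
have lK K : limn (mean_excess d a beta mu nu K) = (c - \sum_(j < K) j.+1%:R * x_ j)%:E.
  by apply/cvg_lim => //; exact: mean_excess_cvg.
have cv : (fun K => limn (mean_excess d a beta mu nu K)) @ \oo --> (c - s)%:E.
  under eq_fun do rewrite lK; apply: cvg_EFin; first exact: nearW.
  by apply: cvgB; [exact: cvg_cst|exact: cvg_s].
split; last exact/cvg_lim.
split; last by apply/cvg_ex; eexists; exact: cv.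
by move=> K; apply/cvg_ex; eexists; exact: mean_excess_cvg.
Qed.

End law.
End thermodynamic_limit.

(** * Kernel weights and the periodic kernel *)

Section box_integrals.
Variable R : realType.

(** The integral of a nonnegative function is a supremum over simple functions below it, hence
    monotone without measurability. No measurability of the kernels or of their partial integrals
    then has to be known. *)
Lemma ge0_le_integral_nonmeas (d : measure_display) (T : measurableType d)
    (m : {measure set T -> \bar R}) (f g : T -> \bar R) :
  (forall x, 0 <= f x)%E -> (forall x, f x <= g x)%E ->
  (\int[m]_x f x <= \int[m]_x g x)%E.
Proof.
move=> f0 fg; have g0 x : (0 <= g x)%E by exact: le_trans (fg x).
rewrite !ge0_integralTE//; apply: ereal_sup_le => _ /= [h hf <-].
by exists h => // x; exact: le_trans (fg x).
Qed.

Lemma int_rV_ge0 d (f : 'rV[R]_d -> \bar R) :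
  (forall x, 0 <= f x)%E -> (0 <= int_rV f)%E.
Proof.
elim: d f => [|d IH] f f0 //=; apply: integral_ge0 => t _.
by apply: IH => v; exact: f0.
Qed.

Lemma int_rV_le d (f g : 'rV[R]_d -> \bar R) :
  (forall x, 0 <= f x)%E -> (forall x, f x <= g x)%E -> (int_rV f <= int_rV g)%E.
Proof.
elim: d f g => [|d IH] f g f0 fg //=; apply: ge0_le_integral_nonmeas => t.
  by apply: int_rV_ge0 => v; exact: f0.
by apply: IH => v; [exact: f0|exact: fg].
Qed.

Definition rect d (l u : 'I_d -> R) : set 'rV[R]_d :=
  [set x | forall i, l i <= x 0 i <= u i].

Lemma cons_row0 d (t : R) (v : 'rV[R]_d) :
  (row_mx (t%:M : 'rV[R]_1) v : 'rV[R]_(1 + d)) 0 (ord0 : 'I_d.+1) = t.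
Proof.
have -> : (ord0 : 'I_d.+1) = lshift d (@ord0 0) by exact: val_inj.
by rewrite [LHS](@row_mxEl _ _ 1 d) mxE.
Qed.

Lemma cons_rowS d (t : R) (v : 'rV[R]_d) (i : 'I_d) :
  (row_mx (t%:M : 'rV[R]_1) v : 'rV[R]_(1 + d)) 0 (lift ord0 i : 'I_d.+1) = v 0 i.
Proof. by rewrite -rshift1 [LHS](@row_mxEr _ _ 1 d). Qed.

Lemma int_rV_rect d (l u : 'I_d -> R) (c : R) : 0 <= c -> (forall i, l i <= u i) ->
  int_rV (fun x => (c * \1_(rect l u) x)%:E) = (c * \prod_i (u i - l i))%:E.
Proof.
elim: d l u c => [|d IH] l u c c0 lu /=.
  rewrite big_ord0 indicE mem_set// => i; by case: i.
have ind t (v : 'rV[R]_d) : \1_(rect l u) (row_mx (t%:M : 'rV[R]_1) v : 'rV[R]_(1 + d)) =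
    \1_`[l ord0, u ord0] t * \1_(rect (l \o lift ord0) (u \o lift ord0)) v :> R.
  rewrite !indicE -natrM mulnb; congr (_ %:R); congr nat_of_bool.
  apply/idP/andP => [/set_mem h|[/set_mem h1 /set_mem h2]].
    split; apply/mem_set; first by have := h ord0; rewrite cons_row0 /= in_itv.
    by move=> i; have := h (lift ord0 i); rewrite cons_rowS.
  apply/mem_set => i; case: (unliftP ord0 i) => [j|] ->.
    by rewrite cons_rowS; exact: h2.
  by rewrite cons_row0; move: h1; rewrite /= in_itv.
have Pi0 : 0 <= \prod_i (u (lift ord0 i) - l (lift ord0 i)).
  by apply: prodr_ge0 => i _; rewrite subr_ge0.
under eq_integral => t _.
  rewrite (_ : (fun v : 'rV[R]_d => _) = (fun v => (c * \1_`[l ord0, u ord0] t *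
    \1_(rect (l \o lift ord0) (u \o lift ord0)) v)%:E)); last first.
    by apply/funext => v; rewrite ind mulrA.
  rewrite IH; [|by rewrite mulr_ge0|by move=> i; exact: lu].
  rewrite /= mulrAC EFinM; over.
rewrite ge0_integralZl_EFin//; last 2 first.
  - by apply/measurable_EFinP; exact: measurable_indic.
  - by rewrite mulr_ge0.
rewrite integral_indic//= setIT lebesgue_measure_itv/= lte_fin.
rewrite big_ord_recl; case: ltP => [_|ul].
  by rewrite -EFinD -EFinM; congr (_ %:E); ring.
have -> : u ord0 = l ord0 by apply/eqP; rewrite eq_le ul lu.
by rewrite mule0 subrr mul0r mulr0.
Qed.

Lemma int_on_le d (A : set 'rV[R]_d) (f : 'rV[R]_d -> R) (l u : 'I_d -> R) (c : R) :
  0 <= c -> (forall i, l i <= u i) -> A `<=` rect l u ->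
  (forall x, A x -> 0 <= f x <= c) ->
  (int_on A f <= (c * \prod_i (u i - l i))%:E)%E.
Proof.
move=> c0 lu Al fc; rewrite -int_rV_rect//; apply: int_rV_le => x; rewrite lee_fin indicE.
  by case: (boolP (x \in A)) => [/set_mem/fc/andP[f0 _]|_]; rewrite ?mul1r ?mul0r.
case: (boolP (x \in A)) => [/set_mem Ax|_]; last by rewrite mul0r mulr_ge0.
by rewrite mul1r indicE mem_set ?mulr1; [have /andP[] := fc _ Ax|exact: Al].
Qed.

Lemma int_on_ge d (A : set 'rV[R]_d) (f : 'rV[R]_d -> R) (l u : 'I_d -> R) (c : R) :
  0 <= c -> (forall i, l i <= u i) -> rect l u `<=` A ->
  (forall x, A x -> 0 <= f x) -> (forall x, rect l u x -> c <= f x) ->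
  ((c * \prod_i (u i - l i))%:E <= int_on A f)%E.
Proof.
move=> c0 lu lA f0 fc; rewrite -int_rV_rect//; apply: int_rV_le => x; rewrite lee_fin.
  by rewrite mulr_ge0.
rewrite !indicE; case: (boolP (x \in rect l u)) => [/set_mem xl|_].
  by rewrite mem_set ?mul1r ?mulr1; [exact: fc|exact: lA].
rewrite mulr0; case: (boolP (x \in A)) => [/set_mem xA|_]; last by rewrite mul0r.
by rewrite mul1r f0.
Qed.

Lemma volE d N : vol R d N = \prod_(i < d) (N%:R - (- N%:R)).
Proof. by rewrite prodr_const card_ord opprK /vol mulr_natl. Qed.

End box_integrals.

Section kernel_weights.
Variables (R : realType) (d : nat) (beta alpha : R).
Hypotheses (d0 : (0 < d)%N) (beta0 : 0 < beta).

Definition heat_peak (t : R) : R := (4 * pi * t) `^ (- (d%:R / 2)).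

Lemma heat_peak_gt0 t : 0 < t -> 0 < heat_peak t.
Proof. by move=> t0; rewrite powR_gt0// !mulr_gt0// pi_gt0. Qed.

Lemma qfree_peak j : qfree d beta alpha j =
  expR (beta * alpha * j.+1%:R) / j.+1%:R * heat_peak (j.+1%:R * beta).
Proof.
rewrite /qfree /heat_peak -[RHS]mulrA; congr (_ * _).
have k0 : 0 < j.+1%:R :> R by rewrite ltr0n.
have b0 : 0 < 4 * pi * beta :> R by rewrite !mulr_gt0// pi_gt0.
have -> : 4 * pi * (j.+1%:R * beta) = 4 * pi * beta * j.+1%:R by ring.
move: (4 * pi * beta) b0 => b b0.
rewrite powRN powRM ?(ltW b0) ?(ltW k0)// powRD; last by apply/implyP; rewrite gt_eqF.
rewrite powRr1; last exact: ltW.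
by field; rewrite !gt_eqF ?powR_gt0.
Qed.

Variables (N : nat) (g : R -> 'rV[R]_d -> 'rV[R]_d -> R).
Hypothesis N0 : (0 < N)%N.

Let V0 : 0 < vol R d N. Proof. exact: vol_gt0. Qed.

Let Nle : forall i : 'I_d, - N%:R <= N%:R :> R.
Proof. by move=> _; rewrite (@le_trans _ _ 0)// oppr_le0. Qed.

Let int_fin j (M : R) :
  (forall x, box N x -> 0 <= g (j.+1%:R * beta) x x <= M) ->
  (0 <= int_on (@box R d N) (fun x => g (j.+1%:R * beta) x x) <= (M * vol R d N)%:E)%E.
Proof.
move=> gM; have M0 : 0 <= M.
  have /gM/andP[h1 h2] : box N (0 : 'rV[R]_d) by move=> i; rewrite mxE oppr_le0 ler0n.
  exact: le_trans h2.
apply/andP; split; last by rewrite volE; apply: int_on_le.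
apply: int_rV_ge0 => x; rewrite lee_fin indicE.
by case: (boolP (x \in _)) => [/set_mem/gM/andP[h _]|_]; rewrite ?mul1r ?mul0r.
Qed.

Lemma qkernel_ge0 j M :
  (forall x, box N x -> 0 <= g (j.+1%:R * beta) x x <= M) ->
  0 <= qkernel N beta alpha g j.
Proof.
move=> gM; rewrite /qkernel; case: ifP => // _.
rewrite mulr_ge0 ?divr_ge0 ?expR_ge0 ?mulr_ge0 ?(ltW V0)//.
by apply: fine_ge0; have /andP[] := int_fin gM.
Qed.

Lemma qkernel_le j (C : R) : 0 <= C ->
  ((j.+1 <= N)%N -> forall x, box N x ->
     0 <= g (j.+1%:R * beta) x x <= C * heat_peak (j.+1%:R * beta)) ->
  qkernel N beta alpha g j <= C * qfree d beta alpha j.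
Proof.
move=> C0 gM; rewrite /qkernel; case: ifP => [jN|_]; last first.
  by rewrite mulr_ge0// ltW// qfree_gt0.
have /andP[i0 iM] := int_fin (gM jN).
rewrite qfree_peak; set I := int_on _ _ in i0 iM *.
have If : I \is a fin_num by rewrite ge0_fin_numE// (le_lt_trans iM (ltry _)).
have : fine I <= C * heat_peak (j.+1%:R * beta) * vol R d N by rewrite -lee_fin fineK.
move=> h; have -> : C * (expR (beta * alpha * j.+1%:R) / j.+1%:R * heat_peak (j.+1%:R * beta)) =
  expR (beta * alpha * j.+1%:R) / (j.+1%:R * vol R d N) *
   (C * heat_peak (j.+1%:R * beta) * vol R d N).
  by field; rewrite !gt_eqF.
by rewrite ler_wpM2l// divr_ge0 ?expR_ge0// mulr_ge0// ltW.
Qed.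

(** Only points at distance at least [r] from the faces are used; they fill the fraction
    [(1 - r / N) ^ d] of the box. The choice [r = 0] suits a kernel without boundary effect. *)
Lemma qkernel_ge j (C c r : R) : (j.+1 <= N)%N -> 0 <= c -> 0 <= r <= N%:R ->
  (forall x, box N x -> 0 <= g (j.+1%:R * beta) x x <= C) ->
  (forall x, rect (fun=> - (N%:R - r)) (fun=> N%:R - r) x ->
     c * heat_peak (j.+1%:R * beta) <= g (j.+1%:R * beta) x x) ->
  qfree d beta alpha j * (c * (1 - r / N%:R) ^+ d) <= qkernel N beta alpha g j.
Proof.
move=> jN c0 /andP[r0 rN] gC gc; rewrite /qkernel jN.
have /andP[i0 iM] := int_fin gC.
have t0 : 0 < j.+1%:R * beta by rewrite mulr_gt0.
have hp0 := heat_peak_gt0 t0.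
have N0' : 0 < N%:R :> R by rewrite ltr0n.
have lo : ((c * heat_peak (j.+1%:R * beta) * \prod_(i < d) ((N%:R - r) - (- (N%:R - r))))%:E
    <= int_on (@box R d N) (fun x => g (j.+1%:R * beta) x x))%E.
  apply: int_on_ge => //.
  - by rewrite mulr_ge0// ltW.
  - by move=> _; rewrite (@le_trans _ _ 0)// ?oppr_le0 subr_ge0.
  - move=> x h i; have /andP[h1 h2] := h i.
    apply/andP; split; [apply: le_trans h1|apply: (le_trans h2)]; lra.
  - by move=> x /gC/andP[].
set I := int_on _ _ in i0 iM lo *.
have If : I \is a fin_num by rewrite ge0_fin_numE// (le_lt_trans iM (ltry _)).
have {lo} : c * heat_peak (j.+1%:R * beta) * (vol R d N * (1 - r / N%:R) ^+ d) <= fine I.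
  rewrite -lee_fin fineK//; apply: le_trans lo; rewrite lee_fin prodr_const card_ord.
  rewrite /vol -exprMn; have -> // : 2 * N%:R * (1 - r / N%:R) = N%:R - r - - (N%:R - r).
  by field; rewrite gt_eqF.
move=> h; rewrite qfree_peak.
have -> : expR (beta * alpha * j.+1%:R) / j.+1%:R * heat_peak (j.+1%:R * beta) *
   (c * (1 - r / N%:R) ^+ d) =
  expR (beta * alpha * j.+1%:R) / (j.+1%:R * vol R d N) *
   (c * heat_peak (j.+1%:R * beta) * (vol R d N * (1 - r / N%:R) ^+ d)).
  by field; rewrite !gt_eqF.
by rewrite ler_wpM2l// divr_ge0 ?expR_ge0// mulr_ge0// ltW.
Qed.

End kernel_weights.

Lemma ler_sum_uniq_subset (R : realType) (T : eqType) (A B : seq T) (F : T -> R) :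
  (forall x, 0 <= F x) -> uniq A -> uniq B -> {subset A <= B} ->
  \sum_(x <- A) F x <= \sum_(x <- B) F x.
Proof.
move=> F0 uA uB AB; have p : perm_eq A [seq x <- B | x \in A].
  apply: uniq_perm => //; first exact: filter_uniq.
  by move=> x; rewrite mem_filter; case: (boolP (x \in A)) => // /AB ->.
rewrite (perm_big _ p) big_filter big_mkcond/=; apply: ler_sum => x _.
by case: ifP.
Qed.

(** * The image sum of the periodic heat kernel *)

Section periodic.
Variables (R : realType) (d : nat).

Let int_range (M : nat) : seq int :=
  [seq Posz m | m <- iota 0 M.+1] ++ [seq Negz m | m <- iota 0 M].

Let mem_int_range M (z : int) : (`|z| <= M)%N -> z \in int_range M.
Proof.
case: z => n h; rewrite mem_cat; apply/orP; [left|right]; apply/mapP; exists n => //.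
all: by rewrite mem_iota.
Qed.

Let sum_int_range (y : R) M : 0 <= y < 1 ->
  \sum_(z <- int_range M) y ^+ `|z|%N <= (1 + y) / (1 - y).
Proof.
move=> /andP[y0 y1]; have y1' : 0 < 1 - y by rewrite subr_gt0.
have geo n : \sum_(m <- iota 0 n) y ^+ m <= (1 - y)^-1.
  rewrite -[leRHS]mul1r ler_pdivlMr// mulrC.
  have := subrX1 y n; rewrite /index_iota -(big_mkord xpredT (fun i => y ^+ i)) /index_iota subn0.
  move=> e; have -> : (1 - y) * \sum_(m <- iota 0 n) y ^+ m = 1 - y ^+ n by lra.
  by rewrite gerBl exprn_ge0.
rewrite big_cat !big_map mulrDl mul1r; apply: lerD; first exact: (geo M.+1).
rewrite (eq_bigr (fun m => y * y ^+ m)); last by move=> m _; rewrite -exprS.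
by rewrite -mulr_sumr ler_wpM2l.
Qed.

(** A finite set of lattice points lies in a cube, over which the sum of products factors into [d]
    one-dimensional sums, each at most the sum of [y ^ |z|] over all integers. *)
Let sum_cube (y : R) (A : seq 'rV[int]_d) : 0 <= y < 1 -> uniq A ->
  \sum_(z <- A) \prod_(i < d) y ^+ absz (z 0 i) <= ((1 + y) / (1 - y)) ^+ d.
Proof.
move=> y01 uA; have /andP[y0 _] := y01.
(* A crude common bound for all coordinates; the final estimate does not depend on it. *)
pose M := (\sum_(z <- A) \sum_(i < d) absz (z 0%R i))%N.
have zM z i : z \in A -> z 0 i \in int_range M.
  move=> zA; apply: mem_int_range; rewrite /M (big_rem z)//=.
  by apply: leq_trans (leq_addr _ _); rewrite (bigD1 i)//= leq_addr.
set s := int_range M in zM.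
have ss : size s = (M + M).+1 by rewrite size_cat !size_map !size_iota.
pose phi (f : {ffun 'I_d -> 'I_(M + M).+1}) : 'rV[int]_d := \row_i nth 0 s (f i).
pose psi (z : 'rV[int]_d) := [ffun i => inord (index (z 0 i) s) : 'I_(M + M).+1].
pose F (z : 'rV[int]_d) : R := \prod_(i < d) y ^+ absz (z 0 i).
have F0 z : 0 <= F z by apply: prodr_ge0 => i _; rewrite exprn_ge0.
have psiK z : z \in A -> phi (psi z) = z.
  move=> zA; apply/rowP => i; rewrite mxE ffunE inordK; first by rewrite nth_index// zM.
  by rewrite -ss index_mem zM.
apply: (@le_trans _ _ (\sum_(f <- map psi A) F (phi f))).
  by rewrite big_map big_seq [leRHS]big_seq; apply: ler_sum => z zA; rewrite psiK.
apply: (@le_trans _ _ (\sum_f F (phi f))).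
  rewrite -(big_enum _ _ _ (fun f => F (phi f)))/=; apply: ler_sum_uniq_subset => //.
  - by rewrite map_inj_in_uniq// => z1 z2 z1A z2A e; rewrite -(psiK _ z1A) e psiK.
  - exact: enum_uniq.
  - by move=> f _; rewrite mem_enum.
have -> : \sum_f F (phi f) = \sum_(f : {ffun 'I_d -> 'I_(M + M).+1})
    \prod_(i < d) y ^+ absz (nth 0 s (f i)).
  by apply: eq_bigr => f _; apply: eq_bigr => i _; rewrite mxE.
rewrite -(bigA_distr_bigA (fun (i : 'I_d) (k : 'I_(M + M).+1) => y ^+ absz (nth 0 s k))).
rewrite prodr_const card_ord.
have le1 : \sum_(k < (M + M).+1) y ^+ absz (nth 0 s k) <= (1 + y) / (1 - y).
  apply: le_trans (sum_int_range M y01).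
  by rewrite [leRHS](big_nth (0 : int)) -[int_range M]/s ss big_mkord.
have ge0 : 0 <= \sum_(k < (M + M).+1) y ^+ absz (nth 0 s k).
  by apply: sumr_ge0 => t _; rewrite exprn_ge0.
by rewrite lerXn2r ?nnegrE// (le_trans ge0 le1).
Qed.

(* For [k <= N] the image sum in the periodic kernel is at most the value at
   [k = N] of a geometric majorant. *)
Definition per_factor (beta : R) (N : nat) : R :=
  ((1 + expR (- (N%:R / beta))) / (1 - expR (- (N%:R / beta)))) ^+ d.

Lemma cvg_per_factor beta : 0 < beta -> per_factor beta @ \oo --> (1 : R).
Proof.
move=> b0; have cy : (fun N : nat => expR (- (N%:R / beta))) @ \oo --> (0 : R).
  have cb : (fun N : nat => beta * N%:R^-1) @ \oo --> (0 : R).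
    by rewrite -[X in _ --> X](mulr0 beta); apply: cvgMr; exact: cvg_invn.
  apply: (squeeze_cvgr _ (cvg_cst 0) cb); near=> N.
  have N0 : (0 < N)%N by near: N; exact: nbhs_infty_gt.
  have -> : beta * N%:R^-1 = (N%:R / beta)^-1 by rewrite invfM invrK mulrC.
  rewrite expR_ge0/= expRN lef_pV2 ?posrE ?expR_gt0 ?divr_gt0 ?ltr0n//.
  by apply: le_trans (expR_ge1Dx _); rewrite lerDr.
have lim1 : ((1 + 0) / (1 - 0)) ^+ d = 1 :> R by rewrite addr0 subr0 divr1 expr1n.
rewrite -[X in _ --> X]lim1 /per_factor.
have cq : (fun N : nat => (1 + expR (- (N%:R / beta))) / (1 - expR (- (N%:R / beta))))
    @ \oo --> ((1 + 0) / (1 - 0) : R).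
  apply: cvgM; first by apply: cvgD => //; exact: cvg_cst.
  apply: cvgV; first by rewrite subr0.
  by apply: cvgB => //; exact: cvg_cst.
elim: (d) => [|n IH]; first by under eq_fun do rewrite expr0; exact: cvg_cst.
by under eq_fun do rewrite exprS; rewrite exprS; exact: cvgM.
Unshelve. all: by end_near. Qed.

(** The image [z = 0] gives the lower bound. The cutoff [k <= N] means [t <= N beta], so
    [N ^ 2 m ^ 2 / t >= (N / beta) |m|] for integers [m], and Gaussian images are dominated by a
    geometric series. *)
Lemma heat_per_diag (beta : R) (N j : nat) (x : 'rV[R]_d) : 0 < beta ->
  (j.+1 <= N)%N ->
  heat_peak d (j.+1%:R * beta) <= heat_per N (j.+1%:R * beta) x x <=
  per_factor beta N * heat_peak d (j.+1%:R * beta).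
Proof.
move=> b0 jN; set t := j.+1%:R * beta.
have t0 : 0 < t by rewrite mulr_gt0.
have hp0 := heat_peak_gt0 d t0.
have N0 : 0 < N%:R :> R by rewrite ltr0n (leq_trans _ jN).
pose G (z : 'rV[int]_d) : R :=
  heat t x (x + (2 * N%:R) *: map_mx (fun m : int => m%:~R) z).
have GE z : G z = heat_peak d t * expR (- (\sum_(i < d) (N%:R * (z 0 i)%:~R) ^+ 2 / t)).
  rewrite /G /heat /heat_peak; congr (_ * expR (- _)).
  rewrite /sqnorm mulr_suml; apply: eq_bigr => i _; rewrite !mxE.
  by field; rewrite gt_eqF.
have G0 z : 0 <= G z by rewrite GE mulr_ge0 ?expR_ge0// ltW.
set y := expR (- (N%:R / beta)).
have y01 : 0 <= y < 1 by rewrite expR_ge0 expR_lt1 oppr_lt0 divr_gt0.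
have Gy z : G z <= heat_peak d t * \prod_(i < d) y ^+ absz (z 0 i).
  rewrite GE ler_pM2l// -sumrN expR_sum; apply: ler_prod => i _; rewrite expR_ge0/=.
  rewrite /y -expRM_natl ler_expR mulrN lerN2 exprMn.
  have -> : ((z 0 i)%:~R : R) ^+ 2 = (absz (z 0 i))%:R ^+ 2.
    by rewrite -(@real_normK _ (z 0 i)%:~R) ?num_real// -intr_norm -abszE.
  set m := (absz (z 0 i))%:R.
  have mm : m <= m ^+ 2 by rewrite -natrX ler_nat; case: absz => // n; rewrite leq_pmulr.
  have jN' : t <= N%:R * beta by rewrite ler_pM2r// ler_nat.
  rewrite ler_pdivlMr//; apply: (@le_trans _ _ (m * (N%:R / beta) * (N%:R * beta))).
    by rewrite ler_wpM2l// mulr_ge0 ?divr_ge0 ?ler0n// ltW.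
  have -> : m * (N%:R / beta) * (N%:R * beta) = N%:R ^+ 2 * m by field; rewrite gt_eqF.
  by rewrite ler_wpM2l// sqr_ge0.
have le_esum : (\esum_(z in [set: 'rV[int]_d]) (G z)%:E <=
    (per_factor beta N * heat_peak d t)%:E)%E.
  apply: ge_ereal_sup => _ [A [finA _] <-].
  rewrite fsbig_finite//= sumEFin lee_fin.
  have uA : uniq (finmap.enum_fset (fset_set A)) by exact: finmap.fset_uniq.
  move: (finmap.enum_fset _) uA => sA uA.
  apply: (@le_trans _ _ (\sum_(z <- sA) heat_peak d t * \prod_(i < d) y ^+ absz (z 0 i))).
    by apply: ler_sum => z _; exact: Gy.
  rewrite -mulr_sumr mulrC ler_pM2r//; exact: sum_cube.
have ge_esum : ((heat_peak d t)%:E <= \esum_(z in [set: 'rV[int]_d]) (G z)%:E)%E.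
  apply: esum_ge; exists [set 0]; first by split.
  rewrite fsbig_set1 GE lee_fin big1 ?oppr0 ?expR0 ?mulr1// => i _.
  by rewrite mxE mulr0 expr0n/= mul0r.
have Gf : (\esum_(z in [set: 'rV[int]_d]) (G z)%:E)%E \is a fin_num.
  by rewrite ge0_fin_numE ?(le_lt_trans le_esum (ltry _))// esum_ge0// => z _; rewrite lee_fin.
by rewrite /heat_per -/G -!lee_fin fineK// ge_esum le_esum.
Qed.

End periodic.

(** * The Dirichlet kernel *)

Section gaussian.
Variable R : realType.

(* Density at 0 of a coordinate of the Brownian increment over time [t], which
   has variance [2 t]. *)
Definition peak1 (t : R) : R := (Num.sqrt (4 * pi * t))^-1.

Lemma peak1_gt0 t : 0 < t -> 0 < peak1 t.
Proof. by move=> t0; rewrite invr_gt0 sqrtr_gt0 !mulr_gt0// pi_gt0. Qed.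

Lemma peak1X d t : 0 < t -> peak1 t ^+ d = heat_peak d t.
Proof.
move=> t0; have p0 : 0 <= 4 * pi * t by rewrite !mulr_ge0 ?pi_ge0// ltW.
rewrite /peak1 /heat_peak powRN exprVn -powR12_sqrt//; congr (_^-1).
by rewrite -powR_mulrn ?powR_ge0// -powRrM [2^-1 * _]mulrC.
Qed.

Let sd_neq0 (t : R) : 0 < t -> Num.sqrt (2 * t) != 0.
Proof. by move=> t0; rewrite gt_eqF// sqrtr_gt0 mulr_gt0. Qed.

Let normal_peakE (t : R) : 0 < t -> normal_peak (Num.sqrt (2 * t)) = peak1 t.
Proof.
move=> t0; rewrite /normal_peak sqr_sqrtr; last by rewrite mulr_ge0// ltW.
by rewrite /peak1; congr (Num.sqrt _)^-1; rewrite -mulr_natr; ring.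
Qed.

Let normal_pdf_val (t x : R) : 0 < t ->
  normal_pdf 0 (Num.sqrt (2 * t)) x = peak1 t * expR (- (x ^+ 2 / (4 * t))).
Proof.
move=> t0; rewrite normal_pdfE ?sd_neq0// normal_peakE//; congr (_ * expR _).
rewrite subr0 sqr_sqrtr; last by rewrite mulr_ge0// ltW.
by rewrite mulNr -mulr_natr; congr (- (_ / _)); ring.
Qed.

Let mpdf (t : R) (A : set R) : measurable_fun A (fun x => (normal_pdf 0 (Num.sqrt (2 * t)) x)%:E).
Proof.
by apply: measurable_funTS; apply/measurable_EFinP; exact: measurable_normal_pdf.
Qed.

Lemma normal_itv_le (t x y : R) : 0 < t -> x <= y ->
  (normal_prob 0 (Num.sqrt (2 * t)) `[x, y] <= ((y - x) * peak1 t)%:E)%E.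
Proof.
move=> t0 xy; rewrite /normal_prob.
apply: (@le_trans _ _ (\int[lebesgue_measure]_(z in `[x, y]) (peak1 t)%:E)%E).
  apply: ge0_le_integral => //.
  - by move=> z _; rewrite lee_fin normal_pdf_ge0.
  - exact: mpdf.
  by move=> z _; rewrite lee_fin -normal_peakE// normal_pdf_ub// sd_neq0.
rewrite integral_cst//= lebesgue_measure_itv/= lte_fin; case: ltP => h.
  by rewrite -EFinD -EFinM mulrC.
by rewrite mule0 lee_fin mulr_ge0 ?subr_ge0// ltW// peak1_gt0.
Qed.

Lemma normal_itv_ge (t x y eps : R) : 0 < t -> x <= y -> - eps <= x -> y <= eps ->
  (((y - x) * (peak1 t * expR (- (eps ^+ 2 / (4 * t)))))%:E <=
   normal_prob 0 (Num.sqrt (2 * t)) `[x, y])%E.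
Proof.
move=> t0 xy ex ye; rewrite /normal_prob.
set c := peak1 t * _; have c0 : 0 <= c by rewrite mulr_ge0 ?expR_ge0// ltW// peak1_gt0.
apply: (@le_trans _ _ (\int[lebesgue_measure]_(z in `[x, y]) c%:E)%E).
  rewrite integral_cst//= lebesgue_measure_itv/= lte_fin; case: ltP => h.
    by rewrite -EFinD -EFinM mulrC.
  by rewrite mule0 lee_fin mulr_le0_ge0// subr_le0.
apply: ge0_le_integral => //; first exact: mpdf.
move=> z; rewrite /= in_itv/= => /andP[xz zy]; rewrite lee_fin normal_pdf_val//.
rewrite ler_pM2l ?peak1_gt0// ler_expR lerN2 ler_pM2r ?invr_gt0 ?mulr_gt0//.
rewrite -(@real_normK _ z) ?num_real// -(@real_normK _ eps) ?num_real//.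
rewrite lerXn2r ?nnegrE// (le_trans _ (ler_norm eps))//.
by rewrite ler_norml (le_trans ex)//= (le_trans zy).
Qed.

Lemma measurable_norm_gt (y : R) : measurable [set z : R | (y < `|z|)%R].
Proof.
rewrite (_ : [set z : R | _] = `]y, +oo[ `|` `]-oo, - y[); first exact: measurableU.
apply/seteqP; split => z /=; rewrite !in_itv/= andbT lter_normr.
  by move=> /orP[|h]; [left|right; rewrite ltrNr].
by move=> [->//|h]; apply/orP; right; rewrite ltrNr.
Qed.

(** Half of the Gaussian exponent is evaluated at [y]; the other half, with the factor [sqrt 2], is
    the density of twice the variance, whose total mass is 1. *)
Lemma normal_tail (t y : R) : 0 < t -> 0 <= y ->
  (normal_prob 0 (Num.sqrt (2 * t)) [set z | (y < `|z|)%R] <=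
   (Num.sqrt 2 * expR (- (y ^+ 2 / (8 * t))))%:E)%E.
Proof.
move=> t0 y0; rewrite /normal_prob; have t20 : 0 < 2 * t by rewrite mulr_gt0.
have mA := measurable_norm_gt y.
set k := Num.sqrt 2 * _.
have k0 : 0 <= k by rewrite mulr_ge0 ?sqrtr_ge0 ?expR_ge0.
apply: (@le_trans _ _ (\int[lebesgue_measure]_(z in [set z | (y < `|z|)%R])
   (k%:E * (normal_pdf 0 (Num.sqrt (2 * (2 * t))) z)%:E))%E).
  apply: ge0_le_integral => //.
  - by move=> z _; rewrite lee_fin normal_pdf_ge0.
  - exact: mpdf.
  - by apply: measurable_funeM; exact: mpdf.
  move=> z /= yz; rewrite -EFinM lee_fin !normal_pdf_val// /k.
  have -> : peak1 t = Num.sqrt 2 * peak1 (2 * t).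
    rewrite /peak1; have -> : 4 * pi * (2 * t) = 2 * (4 * pi * t) by ring.
    move: (4 * pi * t) => v; by rewrite sqrtrM// invfM mulrA divff ?mul1r// gt_eqF// sqrtr_gt0.
  have -> : expR (- (z ^+ 2 / (4 * t))) =
      expR (- (z ^+ 2 / (4 * (2 * t)))) * expR (- (z ^+ 2 / (8 * t))).
    by rewrite -expRD; congr expR; field; rewrite gt_eqF.
  have le : expR (- (z ^+ 2 / (8 * t))) <= expR (- (y ^+ 2 / (8 * t))).
    rewrite ler_expR lerN2 ler_pM2r ?invr_gt0 ?mulr_gt0//.
    by rewrite -(@real_normK _ z) ?num_real// lerXn2r ?nnegrE// ltW.
  set A := expR (- (z ^+ 2 / (4 * (2 * t)))).
  have h : 0 <= Num.sqrt 2 * peak1 (2 * t) * A.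
    by rewrite !mulr_ge0 ?expR_ge0 ?sqrtr_ge0// ltW// peak1_gt0.
  by have := ler_wpM2l h le; lra.
rewrite ge0_integralZl_EFin//; [|by move=> z _; rewrite lee_fin normal_pdf_ge0|exact: mpdf].
rewrite -[leRHS]mule1 lee_wpmul2l ?lee_fin//.
rewrite -(@integral_normal_pdf R 0 (Num.sqrt (2 * (2 * t)))).
apply: ge0_subset_integral => //; first exact: mpdf.
by move=> z _; rewrite lee_fin normal_pdf_ge0.
Qed.

End gaussian.

Section brownian_estimates.
Context (R : realType) (d : nat) (disp : measure_display) (W : measurableType disp).
Variables (P : probability W R) (B : R -> W -> 'rV[R]_d).
Hypothesis HB : brownian P B.

Lemma measurable_increment (s t : R) i : 0 <= s -> 0 <= t ->
  measurable_fun [set: W] (fun w => (B t w - B s w) 0 i).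
Proof.
have [mB _ _ _ _] := HB; move=> s0 t0.
rewrite (_ : (fun w => _) = (fun w => B t w 0 i - B s w 0 i)).
  by apply: measurable_funB; exact: mB.
by apply/funext => w; rewrite !mxE.
Qed.

Lemma measurable_increment_in (s t : R) i (A : set R) : 0 <= s -> 0 <= t ->
  measurable A -> measurable [set w | A ((B t w - B s w) 0 i)].
Proof.
by move=> s0 t0 mA; rewrite -[X in measurable X]setTI; exact: measurable_increment.
Qed.

(** Partition of [[0, t]] into three increments numbered 0, 1, 2, continued as a constant to give
    the infinite time sequence of the independence clause. *)
Definition times (u v t : R) (j : nat) : R :=
  match j with 0%N => 0 | 1%N => u | 2%N => v | _ => t end.

Section partition.
Variables (u v t : R).
Hypotheses (u0 : 0 <= u) (uv : u <= v) (vt : v <= t).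

Lemma times_ge0 j : 0 <= times u v t j.
Proof.
have v0 : 0 <= v by exact: le_trans uv.
by case: j => [|[|[|j]]] //=; exact: le_trans vt.
Qed.

Let timesS j : times u v t j <= times u v t j.+1.
Proof. by case: j => [|[|[|j]]]. Qed.

Definition incr (ij : 'I_d * nat) (w : W) : R :=
  (B (times u v t ij.2.+1) w - B (times u v t ij.2) w) 0 ij.1.

Lemma incr_indep : mutually_independent P incr.
Proof. by have [_ _ _ _ ind] := HB; exact: ind. Qed.

Lemma measurable_incr ij (A : set R) : measurable A -> measurable (incr ij @^-1` A).
Proof. by move=> mA; apply: measurable_increment_in => //; exact: times_ge0. Qed.

Lemma incr_law i j (A : set R) : times u v t j < times u v t j.+1 -> measurable A ->
  P (incr (i, j) @^-1` A) =
  normal_prob 0 (Num.sqrt (2 * (times u v t j.+1 - times u v t j))) A.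
Proof.
have [_ _ _ law _] := HB; move=> tt mA.
by rewrite -(law _ _ i)// times_ge0.
Qed.

Lemma prob_incr_rect j (l r : 'I_d -> R) :
  times u v t j < times u v t j.+1 ->
  P (\bigcap_(ij in [set` [seq (i, j) | i <- enum 'I_d]]) incr ij @^-1` `[l ij.1, r ij.1]) =
  (\big[*%E/1]_(i < d) normal_prob 0 (Num.sqrt (2 * (times u v t j.+1 - times u v t j)))
     `[l i, r i])%E.
Proof.
move=> tt; rewrite (incr_indep (A := fun ij => `[l ij.1, r ij.1]%classic))//.
  by rewrite big_map big_enum; apply: eq_bigr => i _; rewrite incr_law.
by rewrite map_inj_uniq ?enum_uniq// => i1 i2 [].
Qed.

End partition.

Lemma prob_rect (t : R) (l r : 'I_d -> R) : 0 < t ->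
  P [set w | rect l r (B t w)] =
  (\big[*%E/1]_(i < d) normal_prob 0 (Num.sqrt (2 * t)) `[l i, r i])%E.
Proof.
move=> t0; have [_ B0 _ _ _] := HB.
(* For the degenerate partition [u = v = t] the increment numbered 0 is [B t] itself. *)
have := @prob_incr_rect t t t (ltW t0) (lexx t) (lexx t) 0 l r t0.
rewrite /= subr0 => <-; congr (P _); apply/seteqP; split => w.
  move=> h _ /mapP[i _ ->]; rewrite /incr /= B0 subr0 in_itv/=; exact: h.
move=> h i; have := h (i, 0%N); rewrite /incr/= B0 subr0 in_itv/=; apply.
by apply/mapP; exists i; rewrite ?mem_enum.
Qed.

Lemma lee_prod_const (F : 'I_d -> \bar R) (c : R) : (forall i, 0 <= F i)%E ->
  (forall i, F i <= c%:E)%E -> (\big[*%E/1]_(i < d) F i <= (c ^+ d)%:E)%E.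
Proof.
move=> F0 Fc; rewrite -[in leRHS](card_ord d) -prodr_const -prodEFin.
suff : (0 <= \big[*%E/1]_(i < d) F i <= \big[*%E/1]_(i < d) c%:E)%E by case/andP.
apply: (big_ind2 (fun x y => (0 <= x <= y)%E)); first by rewrite lexx lee01.
  by move=> x1 x2 y1 y2 /andP[? ?] /andP[? ?]; rewrite mule_ge0//= lee_pmul.
by move=> i _; rewrite F0 Fc.
Qed.

(** Substitute for conditioning on a continuous variable: a conditional bound on every cell of a
    countable partition. *)
Lemma countable_split (G T : set W) (F : (set W)^nat) (kap : R) :
  0 <= kap -> measurable G -> measurable T -> (forall k, measurable (F k)) ->
  trivIset setT F -> \bigcup_k F k = setT ->
  (forall k, P (G `&` F k `&` T) <= kap%:E * P (G `&` F k))%E ->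
  (P (G `&` T) <= kap%:E * P G)%E.
Proof.
move=> k0 mG mT mF tF cF H.
have mGF k : measurable (G `&` F k) by exact: measurableI.
have GE : G = \bigcup_k (G `&` F k) by rewrite -setI_bigcupr cF setIT.
have tGF : trivIset setT (fun k => G `&` F k) by exact: trivIset_setIl.
rewrite [in leLHS]GE setI_bigcupl measure_bigcup//; last 2 first.
  - by move=> k _; exact: measurableI.
  - exact: trivIset_setIr.
rewrite {2}GE measure_bigcup//.
under eq_eseriesl do rewrite in_setT.
under [in leRHS]eq_eseriesl do rewrite in_setT.
rewrite -nneseriesZl//; apply: lee_nneseries => // k _; exact: H.
Qed.

Definition cell (eta : R) (z : int) : set R := `[z%:~R * eta, (z + 1)%:~R * eta[%classic.

Lemma cellP (eta x : R) (z : int) : 0 < eta ->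
  (cell eta z x <-> z = Num.floor (x / eta)).
Proof.
move=> e0; rewrite /cell /= in_itv/= -ler_pdivlMr// -ltr_pdivrMr//.
by split => [/floor_def->//|->]; rewrite floor_itv.
Qed.

Definition coord_seq (j : nat) : seq ('I_d * nat) := [seq (i, j) | i <- enum 'I_d].

Lemma mem_coord_seq (ij : 'I_d * nat) j : (ij \in coord_seq j) = (ij.2 == j).
Proof.
apply/mapP/eqP => [[i _ ->]//|]; case: ij => i k /= ->.
by exists i; rewrite ?mem_enum.
Qed.

Lemma uniq_coord_seq j : uniq (coord_seq j).
Proof. by rewrite map_inj_uniq ?enum_uniq// => i1 i2 []. Qed.

(* Discretise the increments numbered [1] (over [u, v]) and [o] into cells of
   width [eps / 2]. Given their cells, [B t] can hit a cube of side [eps] only if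
   the remaining increment, which takes time at least [t / 2], lies in a cube of
   side [2 eps]; independence then bounds the conditional hitting probability. *)
Section bad_increment.
Variables (u v t eps : R) (l : 'I_d -> R) (i0 : 'I_d) (E : set R).
Hypotheses (u0 : 0 <= u) (uv : u < v) (vt : v <= t) (eps0 : 0 < eps) (mE : measurable E).
Variables (x o : nat).
Hypothesis xo : (x = 0%N /\ o = 2) \/ (x = 2 /\ o = 0%N).
Hypothesis len : t / 2 <= times u v t x.+1 - times u v t x.

Let eta := eps / 2.
Let eta0 : 0 < eta. Proof. by rewrite divr_gt0. Qed.
Let uv' := ltW uv.
Let t0 : 0 < t. Proof. exact: lt_le_trans (le_lt_trans u0 uv) vt. Qed.

Let s12 := coord_seq 1 ++ coord_seq o.

(** The flag [b] decides whether the bad event [E] is imposed on coordinate [i0]. Two increments in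
    their cells have a sum known up to [2 eta = eps], so the third one is confined to an interval of
    length [eps + 2 eta]. *)
Let sets (b : bool) (f : {ffun 'I_d -> int} * {ffun 'I_d -> int}) (ij : 'I_d * nat) : set R :=
  if ij.2 == 1%N then cell eta (f.1 ij.1) `&` (if b && (ij.1 == i0) then E else setT)
  else if ij.2 == o then cell eta (f.2 ij.1)
  else `[l ij.1 - ((f.1 ij.1)%:~R + (f.2 ij.1)%:~R) * eta - 2 * eta,
         l ij.1 + eps - ((f.1 ij.1)%:~R + (f.2 ij.1)%:~R) * eta]%classic.

Let msets b f ij : measurable (sets b f ij).
Proof.
rewrite /sets; case: ifP => _; last by case: ifP => _; exact: measurable_itv.
by apply: measurableI; [exact: measurable_itv|case: ifP => _].
Qed.

Let cyl12 b f : set W := \bigcap_(ij in [set` s12]) incr u v t ij @^-1` sets b f ij.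

Let mcap b f (s : seq ('I_d * nat)) :
  measurable (\bigcap_(ij in [set` s]) incr u v t ij @^-1` sets b f ij).
Proof.
apply: fin_bigcap_measurable => [|ij _]; first exact: finite_seq.
by apply: measurable_incr => //; exact: msets.
Qed.

Let xN1 : x != 1%N. Proof. by case: xo => -[-> _]. Qed.
Let oN1 : o != 1%N. Proof. by case: xo => -[_ ->]. Qed.
Let xNo : x != o. Proof. by case: xo => -[-> ->]. Qed.

Let F (k : nat) : set W :=
  if pickle_inv k is Some f then cyl12 false f else set0.

Let cyl12P b f w : cyl12 b f w <->
  (b -> E (incr u v t (i0, 1%N) w)) /\
  forall i, f.1 i = Num.floor (incr u v t (i, 1%N) w / eta) /\
            f.2 i = Num.floor (incr u v t (i, o) w / eta).
Proof.
split.
  move=> h; split.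
    move=> bT; have := h (i0, 1%N); rewrite /= mem_cat !mem_coord_seq/= => /(_ isT).
    by rewrite /sets/= bT eqxx => -[].
  move=> i; split.
    have := h (i, 1%N); rewrite /= mem_cat !mem_coord_seq/= => /(_ isT).
    by rewrite /sets/= => -[/cellP->].
  have := h (i, o); rewrite /= mem_cat !mem_coord_seq/= eqxx orbT => /(_ isT).
  by rewrite /sets/= (negbTE oN1) eqxx => /cellP->.
move=> [hE h] [i j]; rewrite /= mem_cat !mem_coord_seq/=.
have [->|jN1] /= := eqVneq j 1%N; move=> H.
  rewrite /sets/=; split; first by apply/cellP => //; have [] := h i.
  by case: ifP => // /andP[bT /eqP->]; exact: hE.
rewrite /sets/= (negbTE jN1) H (eqP H); apply/cellP => //; by have [] := h i.
Qed.

Lemma prob_bad_increment :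
  (P ([set w | E ((B v w - B u w) 0 i0)%R] `&`
      [set w | rect l (fun i => l i + eps)%R (B t w)]) <=
   ((2 * eps * peak1 (t / 2)) ^+ d)%:E * P [set w | E ((B v w - B u w) 0 i0)%R])%E.
Proof.
have [_ B0 _ _ _] := HB.
have t20 : 0 < t / 2 by rewrite divr_gt0.
have p0 := peak1_gt0 t20.
pose cells : countType := ({ffun 'I_d -> int} * {ffun 'I_d -> int})%type.
set G := [set w | E _]; set T := [set w | rect _ _ _].
have mG : measurable G by apply: measurable_increment_in => //; exact: le_trans uv'.
have mT : measurable T.
  have -> : T = \bigcap_(i in [set` enum 'I_d])
      [set w | `[l i, l i + eps]%classic ((B t w - B 0 w) 0 i)].
    apply/seteqP; split => w h i; first by move=> _; rewrite /= B0 subr0 in_itv/=; exact: h.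
    by have := h i; rewrite /= B0 subr0 in_itv/=; apply; rewrite mem_enum.
  apply: fin_bigcap_measurable => [|i _]; first exact: finite_seq.
  by apply: measurable_increment_in => //; exact: ltW.
apply: (@countable_split G T F) => //.
- by rewrite exprn_ge0// !mulr_ge0// ltW.
- by move=> k; rewrite /F; case: pickle_inv => // f; exact: mcap.
- apply/trivIsetP => k1 k2 _ _ k12; rewrite /F.
  case e1: (pickle_inv k1) => [f1|]; last by rewrite set0I.
  case e2: (pickle_inv k2) => [f2|]; last by rewrite setI0.
  apply/seteqP; split => // w [/cyl12P[_ h1] /cyl12P[_ h2]].
  have f12 : f1 = f2.
    case: f1 f2 h1 h2 {e1 e2} => [f1 f1'] [f2 f2'] /= h1 h2; congr pair; apply/ffunP => i.
      by rewrite (h1 i).1 (h2 i).1.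
    by rewrite (h1 i).2 (h2 i).2.
  have := @pickle_invK cells k1; have := @pickle_invK cells k2; rewrite e1 e2 f12/= => p2 p1.
  by rewrite -p1 -p2 eqxx in k12.
- apply/seteqP; split => // w _.
  pose f := ([ffun i => Num.floor (incr u v t (i, 1%N) w / eta)],
             [ffun i => Num.floor (incr u v t (i, o) w / eta)]).
  exists (pickle f) => //; rewrite /F pickleK_inv.
  by apply/cyl12P; split => // i; rewrite !ffunE.
move=> k; rewrite /F; case: (pickle_inv k) => [f|]; last first.
  by rewrite setI0 set0I !measure0 mule0.
have GF : G `&` cyl12 false f = cyl12 true f.
  apply/seteqP; split => w; first by move=> [Gw /cyl12P[_ h]]; apply/cyl12P.
  by move=> /cyl12P[h1 h2]; split; [exact: h1|apply/cyl12P].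
rewrite GF.
pose sx := coord_seq x.
have sub : cyl12 true f `&` T `<=`
    \bigcap_(ij in [set` s12 ++ sx]) incr u v t ij @^-1` sets true f ij.
  move=> w [cw Tw] [i j]; rewrite /= mem_cat => /orP[h|]; first exact: cw.
  rewrite mem_coord_seq/= => /eqP ->; rewrite /sets/= (negbTE xN1) (negbTE xNo).
  have /cyl12P[_ /(_ i)[c1 c2]] := cw.
  have := Tw i.
  have Bt : B t w 0 i = incr u v t (i, x) w + incr u v t (i, 1%N) w + incr u v t (i, o) w.
    by case: xo => -[-> ->]; rewrite /incr/= B0 !mxE; ring.
  have := (cellP _ _ eta0).2 c1; have := (cellP _ _ eta0).2 c2.
  rewrite /cell /= !in_itv/= !intrD !mulrDl !mul1r Bt /eta.
  by move=> /andP[? ?] /andP[? ?] /andP[? ?]; apply/andP; split; lra.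
apply: (@le_trans _ _
    (P (\bigcap_(ij in [set` s12 ++ sx]) incr u v t ij @^-1` sets true f ij))).
  by apply: le_measure => //; rewrite inE; [apply: measurableI => //|]; exact: mcap.
have U12 : uniq s12.
  rewrite cat_uniq !uniq_coord_seq/= andbT; apply/hasPn => ij.
  by rewrite !mem_coord_seq => /eqP ->.
have U : uniq (s12 ++ sx).
  rewrite cat_uniq U12 uniq_coord_seq/= andbT; apply/hasPn => ij.
  by rewrite mem_cat !mem_coord_seq => /eqP ->; rewrite (negbTE xN1) (negbTE xNo).
have ind := incr_indep u0 uv' vt.
rewrite (ind _ _ U (msets true f)).
have -> : P (cyl12 true f) = (\big[*%E/1]_(ij <- s12) P (incr u v t ij @^-1` sets true f ij))%E.
  exact: (ind _ _ U12 (msets true f)).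
(* Both sides share the factors of the discretised increments; only those of the long increment are
   left to bound. *)
rewrite big_cat/= muleC; apply: lee_wpmul2r.
  by apply: prode_ge0 => ij _.
rewrite big_map big_enum/=; apply: lee_prod_const => // i.
have tt : times u v t x < times u v t x.+1 by rewrite -subr_gt0 (lt_le_trans t20).
rewrite (incr_law u0 uv' vt _ tt)//.
rewrite /sets/= (negbTE xN1) (negbTE xNo).
set y := l i - _ - _; set z := l i + eps - _.
have yz : z - y = 2 * eps by rewrite /y /z /eta; field.
apply: le_trans (normal_itv_le _ _) _.
- by rewrite subr_gt0.
- by rewrite -subr_ge0 yz mulr_ge0// ltW.
rewrite yz lee_fin ler_pM2l ?mulr_gt0// /peak1.
rewrite lef_pV2 ?posrE ?sqrtr_gt0 ?mulr_gt0 ?pi_gt0 ?subr_gt0//.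
by rewrite ler_wsqrtr// ler_pM2l// mulr_gt0// pi_gt0.
Qed.

End bad_increment.
End brownian_estimates.

(** * Dyadic chaining for a single path *)

Section chaining.
Variable R : realType.

Definition dyad (t : R) (n j : nat) : R := t * (j%:R / 2 ^+ n).

(* Summable with total mass at most [1], but decaying more slowly than the typical
   size [2 ^ (- n / 2)] of the increments. *)
Definition chain_coef (n : nat) : R := (7 / 8) ^+ n / 8.

Lemma chain_coef_gt0 n : 0 < chain_coef n.
Proof. by rewrite divr_gt0// exprn_gt0// divr_gt0. Qed.

Lemma geometric_sum_le (y : R) n : 0 <= y < 1 -> \sum_(m < n) y ^+ m <= (1 - y)^-1.
Proof.
move=> /andP[y0 y1]; rewrite -[leRHS]mul1r ler_pdivlMr ?subr_gt0// mulrC.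
have := subrX1 y n => e; have -> : (1 - y) * \sum_(m < n) y ^+ m = 1 - y ^+ n by lra.
by rewrite gerBl exprn_ge0.
Qed.

Lemma sum_chain_coef n : \sum_(m < n) chain_coef m <= 1.
Proof.
rewrite -mulr_suml ler_pdivrMr// mul1r.
have y01 : 0 <= (7 / 8 : R) < 1 by apply/andP; split; lra.
apply: le_trans (geometric_sum_le _ y01) _.
by have -> : 1 - 7 / 8 = 8^-1 :> R; [lra|rewrite invrK].
Qed.

Lemma dyad_ge0 t n j : 0 <= t -> 0 <= dyad t n j.
Proof. by move=> t0; rewrite mulr_ge0// divr_ge0// exprn_ge0. Qed.

Lemma dyad_le t n j : 0 <= t -> (j <= 2 ^ n)%N -> dyad t n j <= t.
Proof.
move=> t0 jn; rewrite ler_piMr// ler_pdivrMr ?exprn_gt0// mul1r -natrX ler_nat//.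
Qed.

Lemma dyad_double t n j : dyad t n.+1 j.*2 = dyad t n j.
Proof.
rewrite /dyad -muln2 natrM exprS; congr (_ * _).
by field; rewrite expf_neq0.
Qed.

(** An even point of level [n + 1] belongs to level [n] and an odd one is a single step away from
    such a point, so at most one increment per level is spent. *)
Lemma chaining (f : R -> R) (t r : R) : 0 <= r -> f 0 = 0 ->
  (forall n j, (j < 2 ^ n)%N -> `|f (dyad t n j.+1) - f (dyad t n j)| <= r * chain_coef n) ->
  forall n j, (j <= 2 ^ n)%N -> `|f (dyad t n j)| <= r.
Proof.
move=> r0 f0 H n j jn.
suff : `|f (dyad t n j)| <= r * \sum_(m < n.+1) chain_coef m.
  by move=> /le_trans; apply; rewrite ler_piMr// sum_chain_coef.
have dy0 m : f (dyad t m 0) = 0 by rewrite /dyad mul0r mulr0.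
elim: n j jn => [|n IH] j jn.
  rewrite big_ord1; move: jn; rewrite expn0 leq_eqVlt ltnS leqn0 => /orP[] /eqP ->.
    by have := H 0%N 0%N isT; rewrite dy0 subr0.
  by rewrite dy0 normr0 mulr_ge0// ltW// chain_coef_gt0.
have jh : (j./2 <= 2 ^ n)%N by rewrite -(doubleK (2 ^ n)%N) half_leq// -mul2n -expnS.
rewrite big_ord_recr/= mulrDr.
have -> : j = (odd j + j./2.*2)%N by rewrite odd_double_half.
have jlt : (odd j + j./2.*2 <= 2 ^ n.+1)%N by rewrite odd_double_half.
have c0 : 0 <= r * chain_coef n.+1 by rewrite mulr_ge0// ltW// chain_coef_gt0.
case: (odd j) jlt => /= jlt; last first.
  by rewrite add0n dyad_double -[leLHS]addr0 lerD// IH.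
rewrite add1n in jlt *.
have := H n.+1 j./2.*2 jlt; have := IH _ jh; rewrite dyad_double => h1 h2.
have -> : f (dyad t n.+1 j./2.*2.+1) = f (dyad t n j./2) +
  (f (dyad t n.+1 j./2.*2.+1) - f (dyad t n j./2)) by rewrite addrC subrK.
by apply: (le_trans (ler_normD _ _)); exact: lerD.
Qed.

Lemma dyadic_bounds (f : R -> R) (t lo hi : R) : 0 < t ->
  {within `[0, +oo[, continuous f} ->
  (forall n j, (j <= 2 ^ n)%N -> lo <= f (dyad t n j) <= hi) ->
  forall s, 0 <= s <= t -> lo <= f s <= hi.
Proof.
move=> t0 fc H s /andP[s0 st].
have A s' : 0 <= s' -> `[0, +oo[%classic s' by move=> h; rewrite /= in_itv/= h.
have fs : f @ within `[0, +oo[%classic (nbhs s) --> f s.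
  by move/subspace_continuousP : fc; apply; exact: A.
suff [h1 h2] : (forall e, 0 < e -> lo <= f s + e) /\ (forall e, 0 < e -> f s <= hi + e).
  by apply/andP; split; apply/ler_addgt0Pr.
have key e : 0 < e -> exists2 y, lo <= y <= hi & `|f s - y| <= e.
  move=> e0; move/cvgrPdist_le : fs => /(_ e e0)/nbhs_ballP[del /= del0 hd].
  have [n hn] : exists n, t / 2 ^+ n < del.
    exists (Num.bound (t / del)); rewrite ltr_pdivrMr ?exprn_gt0// mulrC -ltr_pdivrMr//.
    apply: (lt_trans (archi_boundP _)); first by rewrite divr_ge0// ltW.
    by rewrite -natrX ltr_nat ltn_expl.
  have z0 : 0 <= s / t * 2 ^+ n by rewrite mulr_ge0 ?divr_ge0 ?exprn_ge0// ltW.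
  have /andP[k1 k2] := truncn_itv z0; set k := Num.truncn _ in k1 k2.
  have kn : (k <= 2 ^ n)%N.
    rewrite -(ler_nat R) natrX; apply: (le_trans k1).
    by rewrite ler_piMl ?exprn_ge0// ler_pdivrMr// mul1r.
  exists (f (dyad t n k)); first exact: H.
  have p2 : 0 < 2 ^+ n :> R by rewrite exprn_gt0.
  apply: hd; last by apply: A; apply: dyad_ge0; exact: ltW.
  have d1 : dyad t n k <= s.
    rewrite /dyad mulrC -ler_pdivlMr// ler_pdivrMr//.
  have d2 : s <= dyad t n k + t / 2 ^+ n.
    have : s / t * 2 ^+ n <= k%:R + 1 by rewrite natr1 ltW.
    rewrite -ler_pdivlMr// ler_pdivrMr// => h; apply: (le_trans h).
    by rewrite /dyad le_eqVlt; apply/orP; left; apply/eqP; ring.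
  rewrite /ball/= ger0_norm ?subr_ge0//; lra.
split=> e e0; have [y /andP[y1 y2]] := key e e0; rewrite ler_distl => /andP[h1 h2]; lra.
Qed.

End chaining.

(** * Leaving the box before returning to a small cube *)

Section exit_estimate.
Context (R : realType) (d : nat) (disp : measure_display) (W : measurableType disp).
Variables (P : probability W R) (B : R -> W -> 'rV[R]_d).
Hypothesis HB : brownian P B.
Variable N : nat.

Definition stay (x : 'rV[R]_d) (t : R) : set W :=
  [set w | forall s, 0 <= s <= t -> box N (x + B s w)].

Let path_continuous w i :
  {within `[0, +oo[, continuous (fun s : R => B s w 0 i)}.
Proof.
have [_ _ cB _ _] := HB; apply/subspace_continuousP => s sA.
move/subspace_continuousP : (cB w) => /(_ s sA) h.
apply: (@cvg_comp _ _ _ (fun s => B s w) (fun M : 'rV[R]_d => M 0 i) _ _ _ h).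
exact: coord_continuous.
Qed.

(** Continuity of the paths turns an uncountable intersection into a countable one, which makes
    [stay] measurable and open to chaining. *)
Lemma stay_dyadic x t : 0 < t -> stay x t =
  \bigcap_n \bigcap_(j in [set j | (j <= 2 ^ n)%N]) \bigcap_(i in [set` enum 'I_d])
    [set w | `[- N%:R - x 0 i, N%:R - x 0 i]%classic ((B (dyad t n j) w - B 0 w) 0 i)].
Proof.
move=> t0; have [_ B0 _ _ _] := HB.
apply/seteqP; split => w h.
  move=> n _ j /= jn i _; have := h (dyad t n j) _ i.
  rewrite /= B0 subr0 in_itv/= !mxE lerBlDl lerBrDl; apply.
  by rewrite dyad_ge0 ?dyad_le// ltW.
move=> s st i.
have := @dyadic_bounds _ (fun s => B s w 0 i) t (- N%:R - x 0 i) (N%:R - x 0 i) t0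
  (path_continuous (w := w) (i := i)) _ s st.
rewrite mxE lerBlDl lerBrDl; apply => n j jn.
by have := h n Logic.I j jn i; rewrite /= B0 subr0 in_itv/= mem_enum; apply.
Qed.

Lemma measurable_stay x t : 0 < t -> measurable (stay x t).
Proof.
move=> t0; rewrite stay_dyadic//; apply: bigcap_measurableType => n _.
apply: bigcap_measurableType => j _.
apply: fin_bigcap_measurable => [|i _]; first exact: finite_seq.
by apply: (measurable_increment_in HB) => //; apply: dyad_ge0; exact: ltW.
Qed.

Lemma measurable_rect_event t (l r : 'I_d -> R) : 0 < t ->
  measurable [set w | rect l r (B t w)].
Proof.
move=> t0; have [_ B0 _ _ _] := HB.
have -> : [set w | rect l r (B t w)] = \bigcap_(i in [set` enum 'I_d])
    [set w | `[l i, r i]%classic ((B t w - B 0 w) 0 i)].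
  apply/seteqP; split => w h i; first by move=> _; rewrite /= B0 subr0 in_itv/=; exact: h.
  by have := h i; rewrite /= B0 subr0 in_itv/=; apply; rewrite mem_enum.
apply: fin_bigcap_measurable => [|i _]; first exact: finite_seq.
by apply: (measurable_increment_in HB) => //; exact: ltW.
Qed.

Lemma measure_bigcup_seq_le (I : choiceType) (s : seq I) (A : I -> set W) (c : R) :
  0 <= c -> (forall i, measurable (A i)) -> (forall i, P (A i) <= c%:E)%E ->
  (P (\bigcup_(i in [set` s]) A i) <= ((size s)%:R * c)%:E)%E.
Proof.
move=> c0 mA Ac; elim: s => [|i s IH].
  rewrite (_ : [set` [::]] = set0) ?bigcup_set0 ?measure0 ?mul0r//.
  by apply/seteqP; split.
have -> : \bigcup_(k in [set` i :: s]) A k = A i `|` \bigcup_(k in [set` s]) A k.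
  apply/seteqP; split => [w [k /=]|w [Aw|[k /= ks Aw]]].
  - by rewrite inE => /orP[/eqP ->|ks] Aw; [left|right; exists k].
  - by exists i => //=; rewrite mem_head.
  - by exists k => //=; rewrite inE ks orbT.
apply: le_trans (measureU2 _ _ _) _ => //.
  by apply: fin_bigcup_measurable => // ; exact: finite_seq.
by rewrite /= -natr1 mulrDl mul1r addrC EFinD leeD.
Qed.

Definition bad (t r : R) (n : nat) (ij : 'I_d * nat) : set W :=
  [set w | [set z : R | (r * chain_coef R n < `|z|)%R]
     ((B (dyad t n ij.2.+1) w - B (dyad t n ij.2) w) 0 ij.1)].

(** The constant is [4 * 8 ^ 2 * 8 ^ 4]: the 4 from [sqrt 2 <= 2] and [exp (- z) <= 2 / z ^ 2], the
    others from the 8 in the Gaussian tail and the 8 in [chain_coef]. *)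
Definition bad_const (t : R) : R := 2 ^+ 20 * t ^+ 2.

(* [2 * (1 / 2 / (7 / 8) ^+ 2) ^+ 2]: the number of dyadic intervals times the
   Chebyshev-type bound of order 4 on each increment. *)
Definition bad_ratio : R := 2048 / 2401.

Lemma bad_ratio_bounds : 0 <= bad_ratio < 1.
Proof. by rewrite /bad_ratio; apply/andP; split; lra. Qed.

Lemma bad_const_ge0 t : 0 <= bad_const t.
Proof. by apply: mulr_ge0; [exact: exprn_ge0|exact: sqr_ge0]. Qed.

Lemma dyad_step (t : R) n j : dyad t n j.+1 - dyad t n j = t / 2 ^+ n.
Proof. by rewrite /dyad -natr1; field; rewrite expf_neq0. Qed.

Lemma bad_prob (t r : R) n ij : 0 < t -> 0 < r ->
  (P (bad t r n ij) <= (bad_const t / r ^+ 4 * (bad_ratio / 2) ^+ n)%:E)%E.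
Proof.
move=> t0 r0; have [_ _ _ law _] := HB.
have c0 := chain_coef_gt0 R n; have p2 : 0 < 2 ^+ n :> R by rewrite exprn_gt0.
have step : dyad t n ij.2 < dyad t n ij.2.+1.
  by rewrite -subr_gt0 dyad_step divr_gt0.
rewrite /bad law; last 2 first.
  - by rewrite step dyad_ge0// ltW.
  - exact: measurable_norm_gt.
rewrite dyad_step; apply: le_trans (normal_tail _ _) _.
- by rewrite divr_gt0.
- by rewrite mulr_ge0// ltW.
rewrite lee_fin; set z := _ / (8 * _).
have z0 : 0 < z by rewrite divr_gt0 ?exprn_gt0 ?mulr_gt0 ?divr_gt0.
have e1 : expR (- z) <= 2 / z ^+ 2.
  rewrite expRN -[2 / _]invrK lef_pV2 ?posrE ?expR_gt0 ?invr_gt0 ?divr_gt0 ?exprn_gt0//.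
  rewrite invf_div; have := expR_ge1Dxn 1 (ltW z0); rewrite (_ : 2`! = 2)%N//; lra.
have s2 : Num.sqrt 2 <= 2 :> R.
  rewrite -[leRHS]ger0_norm// -sqrtr_sqr ler_wsqrtr//; lra.
apply: (@le_trans _ _ (2 * (2 / z ^+ 2))).
  by apply: ler_pM; rewrite ?sqrtr_ge0 ?expR_ge0.
rewrite le_eqVlt; apply/orP; left; apply/eqP.
have y2 : (7 / 8 : R) ^+ n != 0 by rewrite expf_neq0// gt_eqF// divr_gt0.
have -> : (bad_ratio / 2) ^+ n = (((7 / 8) ^+ n) ^+ 4 * (2 ^+ n) ^+ 2)^-1.
  rewrite -!exprM mulnC [(n * 2)%N]mulnC !exprM -exprMn -exprVn; congr (_ ^+ n).
  by rewrite /bad_ratio; field.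
rewrite /z /bad_const /chain_coef; field.
by rewrite !gt_eqF//.
Qed.

Definition exit_const (t : R) : R := d%:R * bad_const t / (1 - bad_ratio).

Definition arrival (t eps : R) (x : 'rV[R]_d) (l : 'I_d -> R) : set W :=
  [set w | rect (fun i => l i - x 0 i) (fun i => l i - x 0 i + eps) (B t w)].

(** By chaining, a path from [x] that leaves the box has a bad dyadic increment. Level 0 must be
    excluded, since it leaves no free time for the return; there the arrival event itself bounds the
    increment by [eps <= r / 8]. This explains the shift to levels [n.+1]. *)
Lemma exit_bound (t r eps : R) (x : 'rV[R]_d) (l : 'I_d -> R) :
  0 < t -> 0 < r -> 0 < eps -> eps <= r / 8 ->
  (forall i, l i <= x 0 i <= l i + eps) ->
  rect (fun=> - (N%:R - r)) (fun=> N%:R - r) x ->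
  (P (arrival t eps x l) <= P (stay x t `&` arrival t eps x l) +
     ((2 * eps * peak1 (t / 2)) ^+ d * (exit_const t / r ^+ 4))%:E)%E.
Proof.
move=> t0 r0 eps0 er lx xin; set T := arrival _ _ _ _; have [_ B0 _ _ _] := HB.
have t20 : 0 < t / 2 by rewrite divr_gt0.
set kap := (_ ^+ d); have k0 : 0 <= kap.
  by rewrite exprn_ge0// !mulr_ge0// ltW// peak1_gt0.
have mT : measurable T by exact: measurable_rect_event.
have mS := measurable_stay x t0.
have bc0 : 0 <= bad_const t / r ^+ 4.
  by apply: divr_ge0; [exact: bad_const_ge0|rewrite exprn_ge0// ltW].
have /andP[bro0 bro1] := bad_ratio_bounds.
have br0 : 0 <= bad_ratio / 2 by apply: divr_ge0.
pose A n (ij : 'I_d * nat) : set W :=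
  if (ij.2 < 2 ^ n.+1)%N then bad t r n.+1 ij `&` T else set0.
pose sq n := [seq (i, j) | i <- enum 'I_d, j <- iota 0 (2 ^ n.+1)].
pose U n : set W := \bigcup_(ij in [set` sq n]) A n ij.
have mA n ij : measurable (A n ij).
  rewrite /A; case: ifP => // _; apply: measurableI => //.
  apply: (measurable_increment_in HB); rewrite ?dyad_ge0 ?(ltW t0)//.
  exact: measurable_norm_gt.
have mU n : measurable (U n).
  by apply: fin_bigcup_measurable => //; exact: finite_seq.
have PA n ij : (P (A n ij) <= (kap * (bad_const t / r ^+ 4 * (bad_ratio / 2) ^+ n.+1))%:E)%E.
  rewrite /A; case: ifP => [jn|_]; last first.
    by rewrite measure0 lee_fin mulr_ge0// mulr_ge0// exprn_ge0.
  have p2 : 0 < 2 ^+ n.+1 :> R by rewrite exprn_gt0.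
  have u0 : 0 <= dyad t n.+1 ij.2 by rewrite dyad_ge0// ltW.
  have uv : dyad t n.+1 ij.2 < dyad t n.+1 ij.2.+1.
    by rewrite -subr_gt0 dyad_step divr_gt0.
  have vt : dyad t n.+1 ij.2.+1 <= t by rewrite dyad_le// ltW.
  have mE := @measurable_norm_gt R (r * chain_coef R n.+1).
  have half : t / 2 = dyad t n.+1 (2 ^ n).
    rewrite /dyad natrX exprS; field; exact: expf_neq0.
  have bd (x' o : nat) : ((x' = 0 /\ o = 2) \/ (x' = 2 /\ o = 0))%N ->
    t / 2 <= times (dyad t n.+1 ij.2) (dyad t n.+1 ij.2.+1) t x'.+1 -
             times (dyad t n.+1 ij.2) (dyad t n.+1 ij.2.+1) t x' ->
    (P (bad t r n.+1 ij `&` T) <= kap%:E * P (bad t r n.+1 ij))%E.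
    move=> xo len.
    exact: (prob_bad_increment HB (fun i => l i - x 0 i) ij.1 u0 uv vt eps0 mE xo len).
  have : (P (bad t r n.+1 ij `&` T) <= kap%:E * P (bad t r n.+1 ij))%E.
    (* The dyadic interval lies in one half of [[0, t]]; the long increment is taken from the other
       half. *)
    have [jh|jh] := leqP (2 ^ n)%N ij.2.
      apply: (bd 0 2)%N; first by left.
      rewrite /= subr0 half ler_pM2l// ler_pM2r ?invr_gt0// ler_nat//.
    apply: (bd 2 0)%N; first by right.
    have : dyad t n.+1 ij.2.+1 <= t / 2.
      by rewrite half ler_pM2l// ler_pM2r ?invr_gt0// ler_nat.
    rewrite /=; lra.
  move=> /le_trans; apply; rewrite EFinM lee_wpmul2l ?lee_fin//.
  exact: bad_prob.
have PU n : (P (U n) <= (kap * (d%:R * (bad_const t / r ^+ 4)) * bad_ratio ^+ n.+1)%:E)%E.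
  have c0 : 0 <= kap * (bad_const t / r ^+ 4 * (bad_ratio / 2) ^+ n.+1).
    by rewrite mulr_ge0// mulr_ge0// exprn_ge0.
  have := @measure_bigcup_seq_le _ (sq n) (A n) _ c0 (mA n) (PA n).
  rewrite -/(U n); move/le_trans; apply.
  rewrite size_allpairs size_iota size_enum_ord lee_fin natrM natrX le_eqVlt.
  move: (bad_ratio) (bad_const t) => br bc.
  apply/orP; left; apply/eqP; rewrite expr_div_n; field.
  by rewrite !expf_neq0// gt_eqF.
have cover : T `<=` (stay x t `&` T) `|` \bigcup_n U n.
  move=> w Tw; have [Uw|nU] := pselect ((\bigcup_n U n) w); first by right.
  left; split => //; rewrite stay_dyadic// => n _ j /= jn i _.
  have chain : forall n j, (j <= 2 ^ n)%N -> `|B (dyad t n j) w 0 i| <= r.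
    apply: (@chaining _ (fun s => B s w 0 i)); first exact: ltW.
      by rewrite B0 mxE.
    (* At level 0 the only increment is [B t], and [r / 8 = r * chain_coef 0]. *)
    move=> m k km; case: m km => [|m] km.
      move: km; rewrite expn0 ltnS leqn0 => /eqP ->.
      rewrite /dyad mul0r mulr0 B0 [(0 : 'rV_d) 0 i]mxE subr0 expr0 divr1 mulr1.
      rewrite /chain_coef expr0 mul1r; apply: le_trans er.
      have /andP[h1 h2] := Tw i; have /andP[h3 h4] := lx i.
      by rewrite ler_norml; apply/andP; split; lra.
    rewrite leNgt; apply/negP => h; apply: nU; exists m => //; exists (i, k).
      by apply/allpairsP; exists (i, k); rewrite mem_enum mem_iota.
    by rewrite /A/= km; split => //; rewrite /bad/= !mxE.
  have := chain n j jn; rewrite ler_norml => /andP[h1 h2].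
  have /andP[h3 h4] := xin i; rewrite /= B0 subr0 in_itv/=; apply/andP; split; lra.
have mcU : measurable (\bigcup_n U n) by exact: bigcup_measurable.
apply: (@le_trans _ _ (P ((stay x t `&` T) `|` \bigcup_n U n))).
  by apply: le_measure => //; rewrite inE//; apply: measurableU => //; exact: measurableI.
apply: le_trans (measureU2 _ _ _) _ => //; first exact: measurableI.
rewrite leeD2l//; apply: le_trans (measure_sigma_subadditive _ mU mcU (@subset_refl _ _)) _.
apply: (@le_trans _ _ (\sum_(n <oo)
    (kap * (d%:R * (bad_const t / r ^+ 4)) * bad_ratio ^+ n.+1)%:E)%E).
  by apply: lee_nneseries => // n _; exact: PU.
have q0 : 0 <= kap * (d%:R * (bad_const t / r ^+ 4)) by rewrite mulr_ge0// mulr_ge0.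
apply: nnseries_le => [j|n]; first by rewrite mulr_ge0// exprn_ge0.
rewrite -mulr_sumr.
have -> : kap * (exit_const t / r ^+ 4) =
    kap * (d%:R * (bad_const t / r ^+ 4)) * (1 - bad_ratio)^-1.
  by rewrite /exit_const; move: (bad_ratio) (bad_const t) => br bc; ring.
rewrite ler_wpM2l//; apply: le_trans (geometric_sum_le n bad_ratio_bounds).
by apply: ler_sum => j _; rewrite exprS ler_piMl ?exprn_ge0// ltW.
Qed.

End exit_estimate.

(** * Pointwise bounds for the killed kernel on the diagonal *)

Section dirichlet.
Context (R : realType) (d : nat).

Lemma borel_rect (l u : 'I_d -> R) : borel (rect l u).
Proof.
have -> : rect l u = ~` (~` rect l u) by rewrite setCK.
rewrite -setTD; apply: sigma_algebraCD; apply: sub_sigma_algebra.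
rewrite /=; apply: closed_openC.
have -> : rect l u = \bigcap_(i in [set: 'I_d])
    ((fun x : 'rV[R]_d => x 0 i) @^-1` `[l i, u i]).
  by apply/seteqP; split => x h i; [move=> _; rewrite /= in_itv/=; exact: h|
    have := h i Logic.I; rewrite /= in_itv].
apply: closed_bigI => i _; apply: preimage_closed; last exact: interval_closed.
by move=> x _; exact: coord_continuous.
Qed.

Variables (N : nat) (g : R -> 'rV[R]_d -> 'rV[R]_d -> R).
Hypotheses (N0 : (0 < N)%N) (gN : killed_density N g).

Let Npos : 0 < N%:R :> R. Proof. by rewrite ltr0n. Qed.

Lemma kernel_continuous t x eta : 0 < t -> box N x -> 0 < eta ->
  exists2 del, 0 < del & forall y, box N y -> (forall i, `|x 0 i - y 0 i| < del) ->
    `|g t x x - g t x y| <= eta.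
Proof.
move=> t0 bx eta0; have [dW [W [P [B [_ _ gc _]]]]] := gN.
move/subspace_continuousP : (gc t t0) => /(_ (x, x) (conj bx bx)).
move/cvgrPdist_le => /(_ eta eta0); rewrite /within/=.
move=> [[Q1 Q2] /= [nQ1 nQ2] QH].
move/nbhs_ballP : nQ2 => [del /= del0 hdel]; exists del => // y yb yx.
apply: (QH (x, y)) => //; split => /=; first exact: nbhs_singleton.
apply: hdel; split => // i j; rewrite (ord1 i); exact: yx.
Qed.

(** Lower corner of a cube of side [eps] with vertex [x], directed towards the centre so that it
    stays in the box even for [x] on the boundary. *)
Definition corner (eps : R) (x : 'rV[R]_d) (i : 'I_d) : R :=
  if x 0 i <= 0 then x 0 i else x 0 i - eps.

Lemma corner_bounds eps x i : 0 < eps -> corner eps x i <= x 0 i <= corner eps x i + eps.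
Proof.
by move=> e0; rewrite /corner; case: ifP => _; apply/andP; split; lra.
Qed.

Lemma corner_box eps x : 0 < eps -> eps <= N%:R -> box N x ->
  rect (corner eps x) (fun i => corner eps x i + eps) `<=` box N.
Proof.
move=> e0 eN bx y hy i; have := hy i; have /andP[h1 h2] := bx i.
rewrite /corner; case: ifP => [x0|/negbT]; first by move=> /andP[? ?]; apply/andP; split; lra.
by rewrite -ltNge => x0 /andP[? ?]; apply/andP; split; lra.
Qed.

Lemma corner_dist eps x y i : 0 < eps ->
  rect (corner eps x) (fun i => corner eps x i + eps) y -> `|x 0 i - y 0 i| <= eps.
Proof.
move=> e0 /(_ i) /andP[h1 h2]; have /andP[h3 h4] := corner_bounds x i e0.
by rewrite ler_norml; apply/andP; split; lra.
Qed.

Let prod_eps (c eps : R) (x : 'rV[R]_d) :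
  c * \prod_(i < d) (corner eps x i + eps - corner eps x i) = c * eps ^+ d.
Proof.
rewrite -[in RHS](card_ord d) -prodr_const; congr (_ * _).
by apply: eq_bigr => i _; rewrite addrC addKr.
Qed.

Lemma arrival_le (dW : measure_display) (W : measurableType dW) (P : probability W R)
    (B : R -> W -> 'rV[R]_d) t eps x : brownian P B -> 0 < t -> 0 < eps ->
  (P (arrival B t eps x (corner eps x)) <= (heat_peak d t * eps ^+ d)%:E)%E.
Proof.
move=> HB t0 e0; rewrite /arrival (prob_rect HB)//.
rewrite -peak1X// -exprMn; apply: lee_prod_const => i.
  by rewrite /normal_prob; apply: integral_ge0 => z _; rewrite lee_fin normal_pdf_ge0.
have le_eps : corner eps x i - x 0 i <= corner eps x i - x 0 i + eps by rewrite lerDl ltW.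
by apply: (le_trans (normal_itv_le t0 le_eps)); rewrite lee_fin; lra.
Qed.

Lemma arrival_ge (dW : measure_display) (W : measurableType dW) (P : probability W R)
    (B : R -> W -> 'rV[R]_d) t eps x : brownian P B -> 0 < t -> 0 < eps ->
  ((heat_peak d t * (1 - d%:R * (eps ^+ 2 / (4 * t))) * eps ^+ d)%:E <=
   P (arrival B t eps x (corner eps x)))%E.
Proof.
move=> HB t0 e0; rewrite /arrival (prob_rect HB)//.
have p0 := peak1_gt0 t0.
apply: (@le_trans _ _ (\prod_(i < d) (eps * (peak1 t * expR (- (eps ^+ 2 / (4 * t))))))%:E).
  rewrite prodr_const card_ord lee_fin exprMn exprMn peak1X// -expRM_natl.
  rewrite [leRHS]mulrC.
  rewrite ler_pM2r ?exprn_gt0// ler_pM2l ?heat_peak_gt0//.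
  by apply: le_trans (expR_ge1Dx _); rewrite mulrN.
rewrite -prodEFin.
suff : (0 <= \big[*%E/1]_(i < d) (eps * (peak1 t * expR (- (eps ^+ 2 / (4 * t)))))%:E <=
  \big[*%E/1]_(i < d) normal_prob 0 (Num.sqrt (2 * t))
     `[(corner eps x i - x 0 i)%R, (corner eps x i - x 0 i + eps)%R])%E by case/andP.
apply: (big_ind2 (fun u v => (0 <= u <= v)%E)); first by rewrite lexx lee01.
  by move=> x1 x2 y1 y2 /andP[? ?] /andP[? ?]; rewrite mule_ge0//= lee_pmul.
move=> i _; rewrite lee_fin !mulr_ge0 ?expR_ge0 ?(ltW p0) ?(ltW e0)//=.
have /andP[h3 h4] := corner_bounds x i e0.
have le_eps : corner eps x i - x 0 i <= corner eps x i - x 0 i + eps by rewrite lerDl ltW.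
have ge_l : - eps <= corner eps x i - x 0 i by lra.
have le_u : corner eps x i - x 0 i + eps <= eps by lra.
by apply: (le_trans _ (normal_itv_ge t0 le_eps ge_l le_u)); rewrite lee_fin; lra.
Qed.

Lemma killed_arrival t eps x : 0 < t -> box N x ->
  exists (dW : measure_display) (W : measurableType dW) (P : probability W R)
    (B : R -> W -> 'rV[R]_d), brownian P B /\
   (P (stay B N x t `&` arrival B t eps x (corner eps x)) =
    int_on (rect (corner eps x) (fun i => (corner eps x i + eps)%R) `&` @box R d N) (g t x))%E.
Proof.
move=> t0 bx; have [dW [W [P [B [HB _ _ gA]]]]] := gN.
exists dW, W, P, B; split => //; rewrite -gA//; last exact: borel_rect.
congr (P _); apply/seteqP; split => w [h1 h2]; split => // i; have := h2 i.
  by rewrite mxE lerBlDl -addrA [- _ + _]addrC addrA lerBrDl.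
by rewrite mxE lerBlDl -addrA [- _ + _]addrC addrA lerBrDl.
Qed.

Let g_ge0 t x y : 0 < t -> box N x -> box N y -> 0 <= g t x y.
Proof. by have [dW [W [P [B [_ h _ _]]]]] := gN; exact: h. Qed.

(** Killing only lowers the probability of reaching a small cube, and continuity passes from the
    average of the kernel over the cube to its diagonal value. *)
Lemma dirichlet_upper t x : 0 < t -> box N x -> g t x x <= heat_peak d t.
Proof.
move=> t0 bx; apply/ler_addgt0Pr => eta eta0.
have [del del0 hdel] := kernel_continuous t0 bx eta0.
pose eps := Num.min (del / 2) N%:R.
have e0 : 0 < eps by rewrite lt_min divr_gt0.
have eN : eps <= N%:R by rewrite ge_min lexx orbT.
have ed : eps < del.
  by apply: (@le_lt_trans _ _ (del / 2)); [rewrite ge_min lexx|lra].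
have [g1|g1] := leP (g t x x) eta; first by rewrite (le_trans g1)// lerDr ltW// heat_peak_gt0.
have [dW [W [P [B [HB PE]]]]] := killed_arrival eps t0 bx.
have cb := corner_box e0 eN bx.
have : ((g t x x - eta) * eps ^+ d <= heat_peak d t * eps ^+ d)%R.
  rewrite -lee_fin; apply: le_trans (arrival_le x HB t0 e0).
  apply: (@le_trans _ _ (P (stay B N x t `&` arrival B t eps x (corner eps x)))); last first.
    have mA : measurable (arrival B t eps x (corner eps x)).
      exact: (measurable_rect_event HB).
    apply: le_measure; [apply: mem_set|exact: mem_set|by move=> w []].
    by apply: measurableI => //; exact: (measurable_stay HB).
  rewrite PE -(prod_eps _ _ x); apply: int_on_ge.
  - by rewrite subr_ge0 ltW.
  - by move=> i; rewrite lerDl ltW.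
  - by move=> y hy; split => //; exact: cb.
  - by move=> y [_ by_]; exact: g_ge0.
  - move=> y hy; have := hdel y (cb _ hy) (fun i => le_lt_trans (corner_dist i e0 hy) ed).
    rewrite ler_norml => /andP[_]; lra.
by rewrite ler_pM2r ?exprn_gt0// lerBlDr.
Qed.

Definition dirichlet_const (t : R) : R := (2 * peak1 (t / 2)) ^+ d * exit_const d t.

(** The exit error contains the same [eps ^+ d] as the arrival probability, so it survives division
    by the volume of the cube as a loss of order [r ^ (- 4)], uniformly in [eps]. *)
Lemma dirichlet_lower t r x : 0 < t -> 0 < r -> r <= N%:R ->
  rect (fun=> - (N%:R - r)) (fun=> N%:R - r) x ->
  heat_peak d t - dirichlet_const t / r ^+ 4 <= g t x x.
Proof.
move=> t0 r0 rN xin.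
have bx : box N x.
  move=> i; have /andP[h1 h2] := xin i; apply/andP; split; lra.
apply/ler_addgt0Pr => eta eta0; have eta20 : 0 < eta / 2 by rewrite divr_gt0.
have [del del0 hdel] := kernel_continuous t0 bx eta20.
have hp0 := heat_peak_gt0 d t0.
(* With [eps <= 1] and [eps <= b] also [eps ^ 2 <= b], so the Gaussian correction
   [heat_peak * d * eps ^ 2 / (4 t)] is at most [eta / 2]; the other half of [eta] pays for
   continuity. The [d.+1] keeps the denominator positive. *)
pose b := eta / 2 * (4 * t) / (heat_peak d t * d.+1%:R).
have b0 : 0 < b by rewrite !(divr_gt0, mulr_gt0).
pose eps := Num.min (Num.min (del / 2) N%:R) (Num.min (r / 8) (Num.min 1 b)).
have e0 : 0 < eps by rewrite !lt_min b0 ltr01 Npos !divr_gt0.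
have eN : eps <= N%:R by rewrite !ge_min lexx !orbT.
have er : eps <= r / 8 by rewrite !ge_min lexx !orbT.
have e1 : eps <= 1 by rewrite !ge_min lexx !orbT.
have eb : eps <= b by rewrite !ge_min lexx !orbT.
have ed : eps < del.
  by apply: (@le_lt_trans _ _ (del / 2)); [rewrite !ge_min lexx|lra].
have small : heat_peak d t * (d%:R * (eps ^+ 2 / (4 * t))) <= eta / 2.
  have : eps ^+ 2 <= b by rewrite expr2 (le_trans _ eb)// ler_piMr// ltW.
  rewrite /b ler_pdivlMr ?mulr_gt0// => h.
  rewrite mulrA mulrA ler_pdivrMr ?mulr_gt0//; apply: le_trans h.
  rewrite mulrA [leLHS]mulrC ler_wpM2l ?sqr_ge0// ler_pM2l// ler_nat//.
have [dW [W [P [B [HB PE]]]]] := killed_arrival eps t0 bx.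
have cb := corner_box e0 eN bx.
have h1 := arrival_ge x HB t0 e0.
have h2 := exit_bound HB t0 r0 e0 er (fun i => corner_bounds x i e0) xin.
have h3 : (int_on (rect (corner eps x) (fun i => corner eps x i + eps)%R `&` @box R d N) (g t x) <=
    ((g t x x + eta / 2) * eps ^+ d)%:E)%E.
  rewrite -(prod_eps _ _ x); apply: int_on_le.
  - by rewrite addr_ge0 ?(ltW eta20)// g_ge0.
  - by move=> i; rewrite lerDl ltW.
  - exact: subIsetl.
  - move=> y [hy by_]; rewrite g_ge0//=.
    have := hdel y by_ (fun i => le_lt_trans (corner_dist i e0 hy) ed).
    by rewrite ler_norml => /andP[+ _]; lra.
have := le_trans h1 (le_trans h2 (leeD2r _ _)).
rewrite PE => /(_ _ h3); rewrite -EFinD lee_fin.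
have -> : (2 * eps * peak1 (t / 2)) ^+ d * (exit_const d t / r ^+ 4) =
   dirichlet_const t / r ^+ 4 * eps ^+ d.
  rewrite /dirichlet_const (_ : 2 * eps * peak1 (t / 2) = eps * (2 * peak1 (t / 2))); last by ring.
  rewrite [(eps * _) ^+ d]exprMn; move: (_ ^+ d) (exit_const d t) => A E; ring.
rewrite -mulrDl ler_pM2r ?exprn_gt0//; lra.
Qed.

End dirichlet.

(** * Boundary conditions *)

Lemma qkernel_eq0 (R : realType) (d N : nat) (beta alpha : R)
    (g : R -> 'rV[R]_d -> 'rV[R]_d -> R) j :
  (N <= j)%N -> qkernel N beta alpha g j = 0.
Proof. by move=> Nj; rewrite /qkernel ltnNge Nj. Qed.

Section boundary_conditions.
Context (R : realType) (d : nat) (beta alpha : R).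
Hypothesis beta0 : 0 < beta.
Notation qa := (qfree d beta alpha).

Let time_gt0 j : 0 < j.+1%:R * beta. Proof. by rewrite mulr_gt0. Qed.

Lemma qper_bounds N j : (0 < N)%N ->
  0 <= qkernel N beta alpha (@heat_per R d N) j <= per_factor d beta N * qa j /\
  ((j < N)%N -> qa j <= qkernel N beta alpha (@heat_per R d N) j).
Proof.
move=> N0; have hp0 := heat_peak_gt0 d (time_gt0 j).
have heat_bound : (j < N)%N -> forall x : 'rV[R]_d, box N x ->
    0 <= heat_per N (j.+1%:R * beta) x x <=
    per_factor d beta N * heat_peak d (j.+1%:R * beta).
  move=> jN x _; have /andP[lo hi] := heat_per_diag x beta0 jN.
  by rewrite hi andbT; apply: le_trans lo; exact: ltW.
have factor_ge0 : 0 <= per_factor d beta N.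
  have e1 : expR (- (N%:R / beta)) <= 1 by rewrite -[leRHS]expR0 ler_expR oppr_le0 divr_ge0// ltW.
  by apply: exprn_ge0; rewrite divr_ge0 ?subr_ge0// addr_ge0 ?expR_ge0.
split; last first.
  move=> jN; have := qkernel_ge (c := 1) (r := 0) alpha beta0 N0 jN ler01 _ (heat_bound jN).
  rewrite mul0r [1 - 0]subr0 expr1n !mulr1; apply; first by rewrite lexx/=.
  by move=> x _; rewrite mul1r; have /andP[] := heat_per_diag x beta0 jN.
rewrite (qkernel_le alpha beta0 N0 factor_ge0 heat_bound) andbT.
have [Nj|jN] := leqP N j; first by rewrite qkernel_eq0.
exact: (qkernel_ge0 alpha N0 (heat_bound jN)).
Qed.

Lemma cvg_qper j : (fun N => qkernel N beta alpha (@heat_per R d N) j) @ \oo --> qa j.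
Proof.
have cC : (fun N => per_factor d beta N * qa j) @ \oo --> qa j.
  by rewrite -[X in _ --> X]mul1r; apply: cvgMl; exact: cvg_per_factor.
apply: (squeeze_cvgr _ (cvg_cst (qa j)) cC); near=> N.
have jN : (j < N)%N by near: N; exact: nbhs_infty_gt.
have [/andP[_ ->] /(_ jN) ->//] := qper_bounds j (leq_ltn_trans (leq0n j) jN).
Unshelve. all: by end_near. Qed.

Section killed.
Variable gDir : nat -> R -> 'rV[R]_d -> 'rV[R]_d -> R.
Hypothesis gDirP : forall N, (0 < N)%N -> killed_density N (gDir N).

Let gDir_bound N j x : (0 < N)%N -> box N x ->
  0 <= gDir N (j.+1%:R * beta) x x <= 1 * heat_peak d (j.+1%:R * beta).
Proof.
move=> N0 bx; rewrite mul1r (dirichlet_upper N0 (gDirP N0))// andbT.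
by have [dW [W [P [B [_ g0 _ _]]]]] := gDirP N0; exact: g0.
Qed.

Lemma qdir_bounds N j : (0 < N)%N -> 0 <= qkernel N beta alpha (gDir N) j <= qa j.
Proof.
move=> N0; have bnd x := @gDir_bound N j x N0.
rewrite (qkernel_ge0 alpha N0 bnd)/=.
by have := qkernel_le alpha beta0 N0 ler01 (fun _ => bnd); rewrite mul1r.
Qed.

(* Points at distance [sqrt N] from the boundary fill the box up to a vanishing
   fraction, while the killing costs only [O(N^-2)] there. *)
Lemma cvg_qdir j : (fun N => qkernel N beta alpha (gDir N) j) @ \oo --> qa j.
Proof.
have t0 := time_gt0 j; set t := j.+1%:R * beta in t0.
have hp0 := heat_peak_gt0 d t0.
pose K := dirichlet_const d t / heat_peak d t.
pose c N : R := 1 - K * (N%:R^-1 * N%:R^-1).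
have c1 : c @ \oo --> (1 : R).
  rewrite -[X in _ --> X](subr0 1) -(mulr0 K) -(mulr0 0).
  apply: cvgB; first exact: cvg_cst.
  by apply: cvgMr; apply: cvgM; exact: cvg_invn.
have s1 : (fun N => 1 - (Num.sqrt N%:R)^-1) @ \oo --> (1 : R).
  by rewrite -[X in _ --> X](subr0 1); apply: cvgB; [exact: cvg_cst|exact: cvg_inv_sqrt].
have lo : (fun N => qa j * (c N * (1 - (Num.sqrt N%:R)^-1) ^+ d)) @ \oo --> qa j.
  rewrite -[X in _ --> X]mulr1 -[X in _ * X]mulr1 -[X in _ * (_ * X)](expr1n _ d).
  apply: cvgMr; apply: cvgM => //.
  apply: (@cvg_comp _ _ _ _ (fun y : R => y ^+ d) _ _ _ s1); exact: exprn_continuous.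
apply: (squeeze_cvgr _ lo (cvg_cst (qa j))); near=> N.
have jN : (j < N)%N by near: N; exact: nbhs_infty_gt.
have N0 : (0 < N)%N by exact: leq_ltn_trans (leq0n j) jN.
have cN0 : 0 <= c N by near: N; exact: (cvgr_ge _ c1 _ ltr01).
have NR : 0 < N%:R :> R by rewrite ltr0n.
have sq0 : 0 < Num.sqrt N%:R :> R by rewrite sqrtr_gt0.
have sqE : Num.sqrt N%:R ^+ 2 = N%:R :> R by rewrite sqr_sqrtr// ltW.
have sqN : Num.sqrt N%:R <= N%:R :> R.
  by rewrite -[leRHS]sqE expr2 ler_peMl ?(ltW sq0)// -[leLHS]sqrtr1 ler_wsqrtr// ler1n.
have /andP[_ ->] := qdir_bounds j N0; rewrite andbT.
have := qkernel_ge (c := c N) (r := Num.sqrt N%:R) alpha beta0 N0 jN cN0 _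
  (fun x => @gDir_bound N j x N0).
have -> : Num.sqrt N%:R / N%:R = (Num.sqrt N%:R)^-1 :> R.
  by rewrite -[X in _ / X]sqE; field; rewrite gt_eqF.
apply; first by rewrite (ltW sq0).
move=> x xin; have := dirichlet_lower N0 (gDirP N0) t0 sq0 sqN xin.
have -> : c N * heat_peak d t = heat_peak d t - dirichlet_const d t / Num.sqrt N%:R ^+ 4.
  by rewrite -[4%N]/(2 * 2)%N exprM sqE /c /K; field; rewrite !gt_eqF.
exact.
Unshelve. all: by end_near. Qed.

End killed.

Lemma cvg_qbc bc (gDir : nat -> R -> 'rV[R]_d -> 'rV[R]_d -> R) :
  (bc = Dir -> forall N, (0 < N)%N -> killed_density N (gDir N)) ->
  exists C : nat -> R,
  [/\ forall N j, 0 <= qbc bc gDir beta alpha N j,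
      forall N j, (0 < N)%N -> qbc bc gDir beta alpha N j <= C N * qa j,
      C @ \oo --> (1 : R)
    & forall j, qbc bc gDir beta alpha ^~ j @ \oo --> qa j].
Proof.
case: bc => [_|_|/(_ erefl) gP].
- exists (fun=> 1); split => [N j|N j _||j]; last by exact: cvg_cst.
  + exact/ltW/qfree_gt0.
  + by rewrite mul1r.
  + exact: cvg_cst.
(* [N = 0] is split off: all weights vanish there, while the kernel bounds need a box of positive
   size. *)
- exists (per_factor d beta); split => [[|N] j|N j N0||j]; last exact: cvg_qper.
  + by rewrite /= qkernel_eq0.
  + by have [/andP[]] := qper_bounds j (ltn0Sn N).
  + by have [/andP[]] := qper_bounds j N0.
  + exact: cvg_per_factor.
- exists (fun=> 1); split => [[|N] j|N j N0||j]; last exact: cvg_qdir.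
  + by rewrite /= qkernel_eq0.
  + by have /andP[] := qdir_bounds gP j (ltn0Sn N).
  + by rewrite mul1r; have /andP[] := qdir_bounds gP j N0.
  + exact: cvg_cst.
Qed.

End boundary_conditions.

Theorem theorem2p18 (R : realType) (d : nat) (a : R) (bc : boundary)
  (gDir : nat -> R -> 'rV[R]_d -> 'rV[R]_d -> R)
  (beta mu alpha : R) (nu : nat -> probability (seqs R) R) :
  (0 < d)%N -> 0 < a ->
  (bc = Dir -> forall N, (0 < N)%N -> killed_density N (gDir N)) ->
  0 < beta -> alpha <= 0 ->
  (forall N, (0 < N)%N ->
     poisson_law (fun j => vol R d N * qbc bc gDir beta alpha N j) (vol R d N)
       (nu N)) ->
  exists xi : nat -> R,
    [/\ is_minimiser (Ipmf d a beta mu alpha) xi,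
        forall y, is_minimiser (Ipmf d a beta mu alpha) y -> y = xi
      & forall y, ell1 y -> (Ipmf d a beta mu alpha y = 0%E <-> y = xi)] /\
    condensate_density_exists d a beta mu nu /\
    (forall m, pressure d a beta m alpha \is a fin_num) /\
    derivable (fun m : R => fine (pressure d a beta m alpha)) mu 1 /\
    (forall m, Hgap a alpha xi m \is a fin_num) /\
    derivable (fun m : R => fine (Hgap a alpha xi m)) mu 1 /\
    [/\ condensate_density d a beta mu nu =
          pos_part ((derive1 (fun m : R => fine (pressure d a beta m alpha)) mu)%:E
                    - rho_c d beta)%E,
        pos_part ((derive1 (fun m : R => fine (pressure d a beta m alpha)) mu)%:E
                  - rho_c d beta)%E =
          pos_part (((mu + alpha) / a)%:E - rho_c d beta)%E
      & pos_part (((mu + alpha) / a)%:E - rho_c d beta)%E =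
          (derive1 (fun m : R => fine (Hgap a alpha xi m)) mu)%:E].
Proof.
move=> d0 a0 gP beta0 alpha0 nuP.
have [c [s cs]] := crit_exists d0 beta0 a0 (mu + alpha).
have [macs Ds _ _] := cs; have l0 : 0 <= a * c - (mu + alpha) by rewrite subr_ge0.
set x := xi d beta (a * c - (mu + alpha)).
have xp : ell1_pos x by exact: xi_ell1_pos.
(* [Dtot] of a tilted weight is [Dxi] by unfolding, so this is the density clause of [crit]. *)
have Dx : Dtot x = s%:E by [].
have IE y : Ipmf d a beta mu alpha y =
    (Fpmf d a beta (mu + alpha) y - (fbase d beta a (mu + alpha) c)%:E)%E.
  by rewrite /Ipmf (inf_Fpmf_crit d0 beta0 a0 cs).
have Ix : Ipmf d a beta mu alpha x = 0%E by rewrite IE (Fpmf_crit d0 beta0 a0 cs) subee.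
have Imin y : ell1 y -> (Ipmf d a beta mu alpha x <= Ipmf d a beta mu alpha y)%E.
  move=> ly; rewrite Ix IE sube_ge0//.
  by rewrite -(inf_Fpmf_crit d0 beta0 a0 cs); apply: ereal_inf_lbound; exists y.
have Iuniq y : (Ipmf d a beta mu alpha y <= 0)%E -> y = x.
  by rewrite IE sube_le0 => /(Fpmf_min_unique d0 beta0 a0 cs).
have [C [q0 qC C1 qcvg]] := cvg_qbc alpha beta0 gP.
have [cde cd] := condensate_density_cvg d0 a0 beta0 alpha0 cs q0 qC C1 qcvg nuP.
have dp := derive_pressure d0 beta0 a0 cs.
have dH := derive_Hgap a0 alpha mu xp Dx.
have [e1 e2 e3] := crit_excess beta0 a0 cs.
exists x; split; [split|split; [|split; [|split; [|split; [|split]]]]] => //.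
- by split=> //; case: xp.
- by move=> y [ly /(_ x)]; rewrite Ix => h; apply: Iuniq; apply: h; case: xp.
- by move=> y ly; split=> [Iy|->//]; apply: Iuniq; rewrite Iy.
- by move=> m; rewrite (pressureE d0 beta0 a0).
- by move=> m; rewrite (HgapE a alpha m xp Dx).
- split; rewrite ?derive1E.
  + by rewrite cd (@derive_val _ _ _ _ _ _ _ dp) e1.
  + by rewrite (@derive_val _ _ _ _ _ _ _ dp) e1 e2.
  + by rewrite (@derive_val _ _ _ _ _ _ _ dH) e2 e3.
Qed.
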